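(* Let $\sigma$ be the L-system rule of a plane-filling folding curve on the square grid, with alphabet $\{A,B,+,-\}$, and let $\tau$ be the boundary L-system rule on the alphabet $\{L,R,S,l,r,s\}$ computed from the word $\sigma(A)$ by the procedure described in the context. Let $\sigma^\infty(A)$, $\tau^\infty(R)$, $\tau^\infty(L)\subset\mathbb R^2$ be the limits, as $n\to\infty$, of the compatibly normalised curves $M_n(\sigma^n(A))$, $M_n(\tau^n(R))$, $M_n(\tau^n(L))$. Then the curves $\tau^\infty(R)$ and $\tau^\infty(L)$ form the boundary of the plane-filling curve $\sigma^\infty(A)$, i.e. $$\partial\big(\sigma^\infty(A)\big)=\tau^\infty(R)\cup\tau^\infty(L).$$
   Context: **Folding L-system.** Words have the form $X_0s_1X_1s_2\cdots s_mX_m$ with $X_i\in\{A,B\}$, $X_i\neq X_{i+1}$, $s_i\in\{+,-\}$. Put $\tilde A=B$, $\tilde B=A$, $\tilde +=-$, $\tilde -=+$. A folding rule is a substitution with $\sigma(A)=X_0s_1X_1\cdots s_mX_m$ a word of this form, $\sigma(B)=\tilde X_m\tilde s_m\tilde X_{m-1}\cdots\tilde s_1\tilde X_0$, $\sigma(+)=+$, $\sigma(-)=-$, extended to words by concatenation; $\sigma^n$ is the $n$-fold iterate. A word is drawn as a path in the grid $\mathbb Z^2$: $A$ and $B$ mean ''move forward one unit'', $+$ means ''turn right by $90^\circ$'', $-$ means ''turn left by $90^\circ$''. The path is determined by its starting point and initial direction (one of the four axis directions). A vertex $(i,j)$ is even if $i+j$ is even and odd otherwise; $A$ edges start at even vertices,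 $B$ edges at odd vertices. Each vertex is regarded as the centre of a unit square (of the same parity) of the dual grid. **Plane-filling.** $\sigma$ is plane-filling if $\sigma(A)$ contains at least two letters from $\{A,B\}$ and for every $n\ge 1$ the following holds. Identify $\mathbb R^2=\mathbb C$, draw $\sigma^n(A)$ starting from $0$ with some fixed initial direction, and let $c_n\in\mathbb Z[i]$ be its end point. For each unit edge of $\mathbb Z^2$ with even endpoint $u$ and odd endpoint $w$, take the copy of the path $\sigma^n(A)$, rotated by a multiple of $90^\circ$ and translated, that goes from $c_nu$ to $c_nw$. Then these copies, over all edges of the grid, together traverse every unit edge of $\mathbb Z^2$ exactly once. (In particular $\sigma^n(A)$ traverses no edge twice. As $\sigma^n(B)$ is drawn as the backward traversal of a rotated $\sigma^n(A)$, the copies on edges running from an odd to an even vertex are copies of $\sigma^n(B)$.) **Boundary alphabet.** Words in $L,R,S,l,r,s$ are drawn as diagonal paths, starting at the centre of a unit square (a point of $\mathbb Z^2$) with an initial diagonal direction. Each letter means: move half a diagonal of a unit square (reaching a corner of the square), then turn left by $90^\circ$ ($L,l$), turn right by $90^\circ$ ($R,r$), or do not turn ($S,s$), then move another half diagonal, reaching the centre of a square. There is no turn at square centres between consecutive letters. Upper (lower) case indicates that the segment starts in an even (odd) square. **Computation of $\tau$.** First ignore case (so $S$ and $s$ are the same symbol) and use an auxiliary symbol $v$ (''reverse''). *Reduce.* As long as a list contains $v$, take the leftmost $v$ and replace the three-letter block $XvY$ around it by one letter according to $RvR\mapsto S$, $LvL\mapsto S$, $RvL\mapsto v$, $LvR\mapsto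 v$, $SvS\mapsto v$, $SvR\mapsto L$, $RvS\mapsto L$, $SvL\mapsto R$, $LvS\mapsto R$. *Invert.* Reverse the order of a list and interchange $L\leftrightarrow R$ (fixing $S$). 1. From $\sigma(A)$, replace $A,B,+,-$ by $R,R,S,v$ respectively, apply Reduce, and keep only the entries in odd positions $1,3,5,\dots$. The result is the turn sequence of $\tau(R)$. 2. From $\sigma(A)$, replace $A,B,+,-$ by $L,L,v,S$ respectively, apply Reduce, and keep only the entries in odd positions. The result is the turn sequence of $\tau(L)$. 3. The turn sequence of $\tau(l)$ is Invert of that of $\tau(R)$; the turn sequence of $\tau(r)$ is Invert of that of $\tau(L)$. 4. The turn sequence of $\tau(S)$ is Reduce of the concatenation $\tau(R)\,v\,\tau(r)$; the turn sequence of $\tau(s)$ is Reduce of the concatenation $\tau(r)\,v\,\tau(R)$. 5. Cases. The first letter of each of $\tau(R),\tau(L),\tau(S)$ is upper case if the first letter of $\sigma(A)$ is $A$, and lower case otherwise. The first letter of each of $\tau(r),\tau(l),\tau(s)$ is lower case if the last letter of $\sigma(A)$ is $A$, and upper case otherwise. Within each word, a letter following $L,R,l,r$ has the opposite case to its predecessor, and a letter following $S$ or $s$ has the same case as its predecessor. $\tau$ is extended to words by concatenation and $\tau^n$ is its $n$-fold iterate. (Example: $\sigma(A)=A-B$ gives $\tau(L)=Ll$, $\tau(R)=S$, $\tau(l)=S$, $\tau(r)=Rr$, $\tau(S)=Lr$, $\tau(s)=Rl$.) **Placement and limits.** The curves $\tau^n(R)$ and $\tau^n(L)$ are drawn starting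 at the starting point of the path $\sigma^n(A)$; the initial direction of $\tau^n(R)$ is $45^\circ$ to the left (counterclockwise), and that of $\tau^n(L)$ is $45^\circ$ to the right (clockwise), of the first edge of $\sigma^n(A)$. Let $M_n$ be the orientation-preserving similarity of $\mathbb R^2$ sending the start point of $\sigma^n(A)$ to $(0,0)$ and its end point to $(1,0)$. Then $\sigma^\infty(A)$, $\tau^\infty(R)$, $\tau^\infty(L)$ are the limits in the Hausdorff metric on compact subsets of $\mathbb R^2$ of the images of $M_n(\sigma^n(A))$, $M_n(\tau^n(R))$, $M_n(\tau^n(L))$. $\partial$ denotes the topological boundary in $\mathbb R^2$. *)

(* Defs.v *)
From HB Require Import structures.
From mathcomp Require Import all_boot all_order all_algebra.
From mathcomp Require Import all_classical all_reals all_analysis.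

Set Implicit Arguments.
Unset Strict Implicit.
Unset Printing Implicit Defensive.

Import Order.TTheory GRing.Theory Num.Theory.
Import numFieldNormedType.Exports.

Local Open Scope classical_set_scope.
Local Open Scope ring_scope.

Inductive symbol := A | B | Plus | Minus.

Definition tilde (x : symbol) : symbol :=
  match x with A => B | B => A | Plus => Minus | Minus => Plus end.

Definition is_forward (x : symbol) : bool :=
  match x with A | B => true | Plus | Minus => false end.

Fixpoint folding_word (w : seq symbol) : bool :=
  match w with
  | [:: A] | [:: B] => true
  | A :: s :: ((B :: _) as w') | B :: s :: ((A :: _) as w') =>
      ~~ is_forward s && folding_word w'
  | _ => false
  end.

Definition folding_rule (sigma : symbol -> seq symbol) : Prop :=
  [/\ folding_word (sigma A),
      sigma B = rev (map tilde (sigma A)),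
      sigma Plus = [:: Plus]
    & sigma Minus = [:: Minus]].

Definition subst_iter (T : Type) (f : T -> seq T) (n : nat) (x : T) : seq T :=
  iter n (fun w => flatten (map f w)) [:: x].

(* [K * K] is the plane with coordinates in [K]: the grid for [K := int], the
   real plane for [K := R]. *)
Definition turn_left (K : pzRingType) (d : K * K) : K * K := (- d.2, d.1).
Definition turn_right (K : pzRingType) (d : K * K) : K * K := (d.2, - d.1).
Definition east (K : pzRingType) : K * K := (1, 0).

(* The vertices visited after the starting point [p]. *)
Fixpoint draw_from (K : pzRingType) (p d : K * K) (w : seq symbol) :
    seq (K * K) :=
  match w with
  | [::] => [::]
  | (A | B) :: w' => (p + d) :: draw_from (p + d) d w'
  | Plus :: w' => draw_from p (turn_right d) w'
  | Minus :: w' => draw_from p (turn_left d) w'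
  end.

Definition draw (K : pzRingType) (p d : K * K) (w : seq symbol) :
    seq (K * K) := p :: draw_from p d w.

Definition endpoint (K : pzRingType) (p d : K * K) (w : seq symbol) : K * K :=
  last p (draw_from p d w).

(* Complex multiplication; on [int * int], multiplication of Z[i]. *)
Definition cmul (K : pzRingType) (z w : K * K) : K * K :=
  (z.1 * w.1 - z.2 * w.2, z.1 * w.2 + z.2 * w.1).

Definition even_vertex (v : int * int) : bool := (2 %| v.1 + v.2)%Z.

(* Unit edges of the grid, each listed once: as the pair of its even and its
   odd endpoint. *)
Definition grid_edge (e : (int * int) * (int * int)) : bool :=
  [&& even_vertex e.1, ~~ even_vertex e.2
    & `|e.2.1 - e.1.1| + `|e.2.2 - e.1.2| == 1].

(* The image of the path [V], which runs from 0 to [c], under the map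
   z |-> c u + (w - u) z; as w - u is a unit of Z[i], this is a rotation by a
   multiple of 90 degrees followed by a translation, and it sends 0 to c u and
   c to c w. *)
Definition path_copy (c : int * int) (V : seq (int * int))
    (e : (int * int) * (int * int)) : seq (int * int) :=
  [seq cmul c e.1 + cmul (e.2 - e.1) z | z <- V].

(* The k-th step of the path [V] runs along the edge [e], in either
   direction. *)
Definition traverses (V : seq (int * int)) (k : nat)
    (e : (int * int) * (int * int)) : Prop :=
  (k.+1 < size V)%N /\
  ((nth 0 V k, nth 0 V k.+1) = e \/ (nth 0 V k.+1, nth 0 V k) = e).

(* The initial direction is fixed to be east: another choice rotates the whole
   family of copies about 0. *)
Definition plane_filling (sigma : symbol -> seq symbol) : Prop :=
  (2 <= count is_forward (sigma A))%N /\
  forall n, (1 <= n)%N ->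
    let w := subst_iter sigma n A in
    let V := draw 0 (east int) w in
    let c := endpoint 0 (east int) w in
    forall e, grid_edge e ->
      exists! fk : ((int * int) * (int * int)) * nat,
        grid_edge fk.1 /\ traverses (path_copy c V fk.1) fk.2 e.

Inductive turn := Lft | Rgt | Str.

(* The letters L, R, S, l, r, s; the boolean is true for upper case. *)
Definition bletter : Type := bool * turn.

(* [None] is the auxiliary symbol v. *)
Definition reduce_rule (x y : turn) : option turn :=
  match x, y with
  | Rgt, Rgt | Lft, Lft => Some Str
  | Rgt, Lft | Lft, Rgt | Str, Str => None
  | Str, Rgt | Rgt, Str => Some Lft
  | Str, Lft | Lft, Str => Some Rgt
  end.

(* Rewrites the block around the leftmost v. A list without v, or whose
   leftmost v is not surrounded by two turns, is left unchanged. *)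
Fixpoint reduce_step (s : seq (option turn)) : seq (option turn) :=
  match s with
  | Some x :: None :: Some y :: s' => reduce_rule x y :: s'
  | Some x :: None :: _ => s
  | Some x :: s' => Some x :: reduce_step s'
  | _ => s
  end.

(* An effective step shortens the list by two, so that [size s] steps are
   enough to reach a list on which [reduce_step] has no effect. *)
Definition reduce (s : seq (option turn)) : seq (option turn) :=
  iter (size s) reduce_step s.

Fixpoint odd_entries (T : Type) (s : seq T) : seq T :=
  match s with
  | x :: _ :: s' => x :: odd_entries s'
  | _ => s
  end.

(* Forgets the constructor [Some]; any v still present is dropped. *)
Definition turns (s : seq (option turn)) : seq turn := pmap id s.

Definition swap_turn (x : turn) : turn :=
  match x with Lft => Rgt | Rgt => Lft | Str => Str end.

Definition invert (s : seq turn) : seq turn := rev (map swap_turn s).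

Definition right_code (x : symbol) : option turn :=
  match x with A | B => Some Rgt | Plus => Some Str | Minus => None end.

Definition left_code (x : symbol) : option turn :=
  match x with A | B => Some Lft | Plus => None | Minus => Some Str end.

Definition turns_R (w : seq symbol) : seq turn :=
  turns (odd_entries (reduce (map right_code w))).
Definition turns_L (w : seq symbol) : seq turn :=
  turns (odd_entries (reduce (map left_code w))).
Definition turns_l (w : seq symbol) : seq turn := invert (turns_R w).
Definition turns_r (w : seq symbol) : seq turn := invert (turns_L w).
Definition turns_S (w : seq symbol) : seq turn :=
  turns (reduce (map Some (turns_R w) ++ None :: map Some (turns_r w))).
Definition turns_s (w : seq symbol) : seq turn :=
  turns (reduce (map Some (turns_r w) ++ None :: map Some (turns_R w))).

(* [up] is the case of the first letter. *)
Fixpoint with_case (up : bool) (s : seq turn) : seq bletter :=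
  match s with
  | [::] => [::]
  | Str :: s' => (up, Str) :: with_case up s'
  | x :: s' => (up, x) :: with_case (~~ up) s'
  end.

Definition is_A (x : symbol) : bool := if x is A then true else false.

(* The rule tau computed from the word [w] = sigma(A). *)
Definition boundary_rule (w : seq symbol) (x : bletter) : seq bletter :=
  let up_first := is_A (head B w) in
  let up_last := ~~ is_A (last B w) in
  match x with
  | (true, Rgt) => with_case up_first (turns_R w)
  | (true, Lft) => with_case up_first (turns_L w)
  | (true, Str) => with_case up_first (turns_S w)
  | (false, Rgt) => with_case up_last (turns_r w)
  | (false, Lft) => with_case up_last (turns_l w)
  | (false, Str) => with_case up_last (turns_s w)
  end.

Definition turn_dir (K : pzRingType) (x : turn) (d : K * K) : K * K :=
  match x with Lft => turn_left d | Rgt => turn_right d | Str => d end.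

(* Here the direction [d] is half a diagonal of a unit square; each letter
   contributes a corner and a centre of a square. *)
Fixpoint bdraw_from (K : pzRingType) (p d : K * K) (w : seq bletter) :
    seq (K * K) :=
  match w with
  | [::] => [::]
  | x :: w' =>
      let q := p + d in
      let d' := turn_dir x.2 d in
      q :: (q + d') :: bdraw_from (q + d') d' w'
  end.

Definition bdraw (K : pzRingType) (p d : K * K) (w : seq bletter) :
    seq (K * K) := p :: bdraw_from p d w.

Definition polyline (R : realType) (V : seq (R * R)) : set (R * R) :=
  [set x | exists2 k, (k.+1 < size V)%N &
     exists2 t : R, 0 <= t <= 1 &
       x = nth 0 V k + t *: (nth 0 V k.+1 - nth 0 V k)].

(* The orientation-preserving similarity z |-> (z - p) / (q - p), where the
   quotient of complex numbers is written in coordinates. *)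
Definition similarity (R : realType) (p q z : R * R) : R * R :=
  let w := q - p in
  (w.1 ^+ 2 + w.2 ^+ 2)^-1 *: cmul (z - p) (w.1, - w.2).

(* M_n, for sigma^n(A) drawn from 0 with initial direction east. *)
Definition normalize (R : realType) (sigma : symbol -> seq symbol) (n : nat) :
    R * R -> R * R :=
  similarity 0 (endpoint 0 (east R) (subst_iter sigma n A)).

Definition sigma_curve (R : realType) (sigma : symbol -> seq symbol)
    (n : nat) : set (R * R) :=
  normalize sigma n @`
    polyline (draw 0 (east R) (subst_iter sigma n A)).

(* tau^n(R) starts 45 degrees to the left of east, tau^n(L) 45 degrees to the
   right. *)
Definition tau_curve_R (R : realType) (sigma : symbol -> seq symbol)
    (n : nat) : set (R * R) :=
  normalize sigma n @`
    polyline (bdraw 0 (2^-1, 2^-1)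
                (subst_iter (boundary_rule (sigma A)) n (true, Rgt))).

Definition tau_curve_L (R : realType) (sigma : symbol -> seq symbol)
    (n : nat) : set (R * R) :=
  normalize sigma n @`
    polyline (bdraw 0 (2^-1, - 2^-1)
                (subst_iter (boundary_rule (sigma A)) n (true, Lft))).

Definition euclidean_dist (R : realType) (x y : R * R) : R :=
  Num.sqrt ((x.1 - y.1) ^+ 2 + (x.2 - y.2) ^+ 2).

Definition hausdorff_dist (R : realType) (X Y : set (R * R)) : \bar R :=
  maxe
    (ereal_sup [set ereal_inf [set (euclidean_dist x y)%:E | y in Y] | x in X])
    (ereal_sup [set ereal_inf [set (euclidean_dist x y)%:E | x in X] | y in Y]).

(* [X] is the limit of the sequence [Xn] in the Hausdorff metric on nonempty
   compact sets. *)
Definition hausdorff_limit (R : realType) (Xn : nat -> set (R * R))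
    (X : set (R * R)) : Prop :=
  [/\ compact X, X !=set0 &
      hausdorff_dist (Xn n) X @[n --> \oo] --> (0 : \bar R)%E].

Definition boundary (T : topologicalType) (X : set T) : set T :=
  closure X `\` interior X.

(* Main.v *)
(* The plane-filling hypothesis turns sigma into a substitution P on the oriented
   edges of the grid: the paths P(g) reverse with g, join up around every face,
   and tile the edges of the grid. So do the paths of the iterates P^n.

   Take the free group on the half-diagonals, each of which joins the base of an
   oriented edge to the face on its left. The left side of a path is a word in
   this group. Reduce is free reduction, so that tau^n(R) and tau^n(L) draw the
   reduced words of the two sides of P^n(g0), g0 being the first edge. A winding
   number argument shows that the images of the four edges around a face form a
   loop that encloses whole faces only. Hence a half-diagonal survives the
   reduction if and only if exactly one of the two edges at its vertex that bound
   its face lies on the path. The curves tau^n therefore visit, up to a bounded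
   distance, the vertices where edges covered by P^n(g0) meet edges that are not.

   The three limits consist of the points whose rescalings stay close to the
   corresponding vertices at all levels n. If a point of the limit of sigma^n(A)
   is not interior, then at each level both covered and uncovered edges lie
   within bounded distance of it, so that the border is close to it. Conversely,
   a border vertex has an uncovered edge g1 at it. Most faces are filled by a
   single tile after enough substitution steps, by counting, so that an iterate of
   g1 covers a large disc alone; the centre of the disc is not in the limit
   of sigma^n(A), and it is close to the border vertex after rescaling. *)
Require Import Defs.
From HB Require Import structures.
From mathcomp Require Import all_boot all_order all_algebra.
From mathcomp Require Import all_classical all_reals all_analysis.
From mathcomp Require Import zify ring lra.
Set Implicit Arguments.
Unset Strict Implicit.
Unset Printing Implicit Defensive.
Import Order.TTheory GRing.Theory Num.Theory.
Import numFieldNormedType.Exports.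
Local Open Scope classical_set_scope.
Local Open Scope ring_scope.

(** * Oriented edges and winding numbers *)

(** The tiles are not discs: a path may touch itself and other paths at vertices, so the loop around
    the image of a face is pinched in many places. Winding numbers of edge loops, computed face by
    face, stand in for the Jordan curve theorem, and loops are cut at their pinches. This works
    because a folding path turns at every vertex: consecutive edges share the left or the right
    face, so the winding number to the right of a loop is constant along it. Reduce is sequential
    and can get stuck at a v without a turn on both sides. In the free group the normal form does
    not depend on the order of cancellation, and substitution becomes an endomorphism, so one level
    of tau settles all iterates. That a tile fills a whole face at all rests on planarity: otherwise
    both pairs of opposite sides of a face would have paths in contact, and the two contacts would
    have to cross. The limits need no exact positions: the dilation is expanding, so a bounded error
    at a deep level improves to one fixed bound at the levels above it. *)

(* East, north, west and south are [(false, false)], [(true, false)],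
   [(false, true)] and [(true, true)]. *)
Definition dir : Type := (bool * bool)%type.
Definition rotl (d : dir) : dir := (~~ d.1, d.2 (+) d.1).
Definition rotr (d : dir) : dir := (~~ d.1, d.2 (+) ~~ d.1).
Definition opp (d : dir) : dir := (d.1, ~~ d.2).
Definition dx (d : dir) : int := if d.1 then 0 else if d.2 then -1 else 1.
Definition dy (d : dir) : int := if d.1 then if d.2 then -1 else 1 else 0.

Notation oedge := ((int * int) * dir)%type.
Definition tip (x : oedge) : int * int := (x.1.1 + dx x.2, x.1.2 + dy x.2).
Definition enext (x : oedge) : oedge := (tip x, rotl x.2).
Definition eright (x : oedge) : oedge := (tip x, rotr x.2).
Definition erev (x : oedge) : oedge := (tip x, opp x.2).
Definition swivel (x : oedge) : oedge := (x.1, rotl x.2).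
Definition eprev (x : oedge) : oedge := erev (swivel x).
(* A face is named by its south-west corner. *)
Definition lface (x : oedge) : int * int :=
  (x.1.1 - (x.2.1 (+) x.2.2)%:Z, x.1.2 - x.2.2%:Z).
Definition rface (x : oedge) : int * int := lface (erev x).
(** Between two moves a folding word has exactly one quarter turn, so these are the only successors.
    A left turn keeps the left face, a right turn the right face. *)
Definition esucc (x y : oedge) : bool := (y == enext x) || (y == eright x).

Ltac oedges :=
  repeat match goal with
  | x : (int * int * dir)%type |- _ => case: x => [[? ?] [[] []]]
  | x : oedge |- _ => case: x => [[? ?] [[] []]]
  end.

Lemma pairE (S T : Type) (a c : S) (b d : T) : a = c -> b = d -> (a, b) = (c, d).
Proof. by move=> -> ->. Qed.

Ltac osolve :=
  rewrite /eprev /enext /eright /rface /lface /erev /swivel /tip /rotl /rotr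
    /opp /dx /dy /=; do ?[apply: pairE => //]; try lia.

Lemma erevK : involutive erev. Proof. by move=> x; oedges; osolve. Qed.
Lemma eprevK : cancel eprev enext. Proof. by move=> x; oedges; osolve. Qed.
Lemma enextK : cancel enext eprev. Proof. by move=> x; oedges; osolve. Qed.
Lemma enext4 x : enext (enext (enext (enext x))) = x.
Proof. by oedges; osolve. Qed.
Lemma eprev_next3 x : eprev x = enext (enext (enext x)).
Proof. by oedges; osolve. Qed.
Lemma lface_next x : lface (enext x) = lface x. Proof. by oedges; osolve. Qed.
Lemma lface_prev x : lface (eprev x) = lface x. Proof. by oedges; osolve. Qed.
Lemma rface_right x : rface (eright x) = rface x. Proof. by oedges; osolve. Qed.
Lemma lface_rev x : lface (erev x) = rface x. Proof. by []. Qed.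
Lemma rface_rev x : rface (erev x) = lface x.
Proof. by rewrite /rface erevK. Qed.
Lemma eright_rev x : enext (erev (eright x)) = erev x.
Proof. by oedges; osolve. Qed.
Lemma enext_rev x : enext (erev x) = (x.1, rotr x.2).
Proof. by oedges; osolve. Qed.
Lemma enext_inj : injective enext. Proof. exact: can_inj enextK. Qed.
Lemma erev_inj : injective erev. Proof. exact: can_inj erevK. Qed.
Lemma erev_neq x : erev x != x.
Proof. by oedges; rewrite /erev /tip /opp /dx /dy /= xpair_eqE /= andbF. Qed.
Lemma rface_neq x : rface x != lface x.
Proof. by oedges; apply/eqP; case=> /=; osolve. Qed.
Lemma lfaceP x y : lface x = lface y ->
  [\/ y = x, y = enext x, y = enext (enext x) | y = enext (enext (enext x))].
Proof.
oedges; case; rewrite /= => h1 h2;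
 solve [apply: Or41; osolve | apply: Or42; osolve | apply: Or43; osolve | apply: Or44; osolve].
Qed.
Lemma esuccP x y : esucc x y -> (lface y = lface x) \/ (rface y = rface x).
Proof.
by case/orP=> /eqP->; [left; exact: lface_next | right; exact: rface_right].
Qed.
Lemma eright_next x : eright (erev (enext x)) = erev x.
Proof. by oedges; osolve. Qed.
Lemma esucc_revl x y : esucc x y -> esucc (erev y) (erev x).
Proof.
case/orP=> /eqP->; apply/orP; [right|left]; apply/eqP.
  by rewrite eright_next.
by rewrite eright_rev.
Qed.
Lemma esucc_rev x y : esucc (erev y) (erev x) = esucc x y.
Proof.
by apply/idP/idP=> /esucc_revl; rewrite ?erevK.
Qed.
Lemma esucc_tip x y : esucc x y -> y.1 = tip x.
Proof. by case/orP=> /eqP->. Qed.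

(* Counts the vertical edges that meet a ray going east from the centre of the
   face [f], with sign. *)
Definition weight (f : int * int) (x : oedge) : int :=
  if x.2.1 && (f.1 < x.1.1) then
    if x.2.2 then - ((x.1.2 - 1 == f.2)%:Z) else (x.1.2 == f.2)%:Z
  else 0.
Definition winding (W : seq oedge) (f : int * int) : int :=
  \sum_(x <- W) weight f x.

Lemma winding_cat W1 W2 f : winding (W1 ++ W2) f = winding W1 f + winding W2 f.
Proof. by rewrite /winding big_cat. Qed.

Lemma winding_perm W1 W2 f : perm_eq W1 W2 -> winding W1 f = winding W2 f.
Proof. by move=> h; rewrite /winding (perm_big _ h). Qed.

Definition level (f p : int * int) : int := ((p.2 == f.2) && (f.1 < p.1))%:Z.

Lemma count_sum (W : seq oedge) x :
  (count_mem x W)%:Z = \sum_(y <- W) (y == x)%:Z :> int.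
Proof.
elim: W => [|y W IH]; first by rewrite big_nil.
by rewrite big_cons -IH /= PoszD.
Qed.

Lemma sum_telescope (h : int * int -> int) x W : path esucc x W ->
  \sum_(y <- x :: W) (h (tip y) - h y.1) = h (tip (last x W)) - h x.1.
Proof.
elim: W x => [|y W IH] x /=; first by rewrite big_seq1.
by case/andP=> /esucc_tip hy hp; rewrite big_cons IH // hy; ring.
Qed.

Lemma sum_cycle (h : int * int -> int) W : cycle esucc W ->
  \sum_(y <- W) (h (tip y) - h y.1) = 0.
Proof.
case: W => [|x W]; first by rewrite big_nil.
rewrite [cycle _ _]/= rcons_path => /andP[hp /esucc_tip hl].
by rewrite sum_telescope // hl subrr.
Qed.

(** For a vertical edge the two rays differ by that edge only, and the identity holds term by term.
    For a horizontal edge it is conservation of flow: what a closed path carries vertically across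
    the half-row of vertices marked by [level] has entered that half-row through [x]. *)
Lemma winding_jump W x : cycle esucc W ->
  winding W (lface x) - winding W (rface x)
    = (count_mem x W)%:Z - (count_mem (erev x) W)%:Z.
Proof.
move=> cW.
wlog d2: x / x.2.2 = false => [wl|].
  case: (boolP x.2.2) => [h|/negbTE]; last exact: wl.
  have := wl (erev x); rewrite lface_rev rface_rev erevK => {}wl.
  by rewrite -opprB wl ?opprB // /erev /= h.
rewrite /winding !count_sum -!sumrB.
case: x d2 => [[a b] [[] c]] /= ->.
  apply: eq_bigr => -[[i j] [[] []]] _; rewrite /weight /erev /rface /lface /tip /=
    !xpair_eqE /= ?andbF ?andbT /= /dx /dy /=; do ?case: ifP; lia.
apply/eqP; rewrite -subr_eq0 -sumrB; apply/eqP.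
rewrite -[RHS](sum_cycle (fun p => - level (a, b) p) cW).
apply: eq_bigr => -[[i j] [[] []]] _; rewrite /weight /level /erev /rface /lface /tip /=
    !xpair_eqE /= ?andbF ?andbT /= /dx /dy /=; do ?case: ifP; lia.
Qed.

(** * Loops around unions of faces *)

Lemma cycle_const (T : Type) (f : oedge -> T) (r : rel oedge) (W : seq oedge) :
  cycle r W -> {in W &, forall x y, r x y -> f x = f y} ->
  {in W &, forall x y, f x = f y}.
Proof.
case: W => // x0 p; rewrite [cycle _ _]/= rcons_path => /andP[hp _] h.
suff H : {in x0 :: p, forall y, f y = f x0} by move=> x y /H -> /H ->.
elim/last_ind: p hp h => [|p z IH]; first by move=> _ _ y; rewrite inE => /eqP->.
rewrite rcons_path => /andP[hp hz] h.
have sub u : u \in x0 :: p -> u \in x0 :: rcons p z.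
  by rewrite !inE mem_rcons inE; case/orP=> ->; rewrite ?orbT.
have {}IH := IH hp (fun x y hx hy => h x y (sub _ hx) (sub _ hy)).
move=> y; rewrite inE mem_rcons inE orbCA => /orP[/eqP->|]; last exact: IH.
rewrite -(IH (last x0 p)) ?mem_last //; apply/esym/h => //.
- exact/sub/mem_last.
- by rewrite inE mem_rcons inE eqxx orbT.
Qed.

Definition simple_loop (W : seq oedge) : Prop :=
  [/\ cycle esucc W, uniq W & {in W, forall x, erev x \notin W}].

Lemma simple_jump W x : simple_loop W -> x \in W ->
  winding W (lface x) = winding W (rface x) + 1.
Proof.
case=> cW uW aW xW; apply/eqP; rewrite addrC -subr_eq winding_jump //.
by rewrite !count_uniq_mem // xW (negbTE (aW x xW)).
Qed.

Lemma winding_foreign W x : cycle esucc W -> x \notin W -> erev x \notin W ->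
  winding W (lface x) = winding W (rface x).
Proof.
move=> cW h1 h2; apply/eqP; rewrite -subr_eq0 winding_jump //.
by rewrite (count_memPn h1) (count_memPn h2).
Qed.

(** A right turn keeps the right face. A left turn keeps the left face, whose winding number exceeds
    that of the right face by 1 at every edge of a simple loop. *)
Lemma simple_const W : simple_loop W ->
  {in W &, forall x y, winding W (rface x) = winding W (rface y)}.
Proof.
move=> sW; have [cW _ _] := sW.
apply: (cycle_const cW) => x y xW yW /esuccP[h|->//].
by apply: (addIr 1); rewrite -!simple_jump // h.
Qed.

Lemma loop_bound (W : seq oedge) : exists M : nat,
  {in W, forall x : oedge, `|x.1.1| < M%:Z /\ `|x.1.2| < M%:Z}.
Proof.
elim: W => [|y W [M hM]]; first by exists 0%N.
exists (`|y.1.1| + `|y.1.2| + M).+1 => x; rewrite inE => /orP[/eqP->|/hM]; lia.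
Qed.

Lemma winding_far W : exists M : int, forall f, M <= f.1 -> winding W f = 0.
Proof.
have [M hM] := loop_bound W; exists M%:Z => f hf.
rewrite /winding big1_seq // => -[[i j] d] /hM /= xM; rewrite /weight /=.
by have -> : (f.1 < i) = false; [lia | rewrite andbF].
Qed.

(** Walking west from far away, the value starts at 0 and switches between [k] and [k + 1] at each
    crossing of the loop. The first crossing forces 0 to be one of these two values. *)
Lemma winding_values W k : simple_loop W ->
  {in W, forall x, winding W (rface x) = k} ->
  forall f, winding W f = 0 \/
    (k = 0 \/ k = -1) /\ (winding W f = k \/ winding W f = k + 1).
Proof.
move=> sW hk [i j]; have [cW _ _] := sW; have [M hM] := winding_far W.
have [n] : exists n : nat, M <= i + n%:Z by exists `|M - i|%N; lia.
elim: n i => [|n IH] i hi; first by left; apply: hM; rewrite /=; lia.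
have /IH {}IH : M <= i + 1 + n%:Z by lia.
pose y : oedge := ((i + 1, j), (true, false)).
have ly : lface y = (i, j) by rewrite /y; osolve.
have ry : rface y = (i + 1, j) by rewrite /y; osolve.
case: (boolP (y \in W)) => hy.
  have := simple_jump sW hy; have := hk y hy; rewrite ly ry.
  by case: IH => [->|[? [] ->]] *; right; lia.
case: (boolP (erev y \in W)) => hry.
  have := simple_jump sW hry; have := hk _ hry.
  rewrite rface_rev lface_rev ly ry.
  by case: IH => [->|[? [] ->]] *; right; lia.
by have := winding_foreign cW hy hry; rewrite ly ry => ->.
Qed.

Lemma simple_value W k : simple_loop W -> W != [::] ->
  {in W, forall x, winding W (rface x) = k} -> k = 0 \/ k = -1.
Proof.
move=> sW; case: W sW => // x W sW _ hk.
have xW : x \in x :: W by rewrite inE eqxx.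
case: (winding_values sW hk (lface x)) => [|[]//].
by rewrite (simple_jump sW xW) hk // => h; right; lia.
Qed.

(* Such a loop runs once around every face of the region that it encloses. *)
Definition good_loop (W : seq oedge) : Prop :=
  [/\ simple_loop W, {in W, forall x, winding W (rface x) = 0}
    & {in W, forall x, enext x \in W}].

Lemma good_nil : good_loop [::]. Proof. by []. Qed.

Lemma good_rot W1 W2 : good_loop (W1 ++ W2) -> good_loop (W2 ++ W1).
Proof.
have pe : perm_eq (W1 ++ W2) (W2 ++ W1) by rewrite perm_catC.
have me := perm_mem pe.
case=> [[cW uW aW] wW nW]; split.
- split.
  + by rewrite -(rot_size_cat W1 W2) rot_cycle.
  + by rewrite -(perm_uniq pe).
  + by move=> x; rewrite -!me; exact: aW.
- by move=> x; rewrite -me -(winding_perm _ pe); exact: wW.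
- by move=> x; rewrite -!me; exact: nW.
Qed.

Lemma good_orbit W x y : good_loop W -> x \in W -> lface y = lface x -> y \in W.
Proof.
case=> _ _ nW xW /esym /lfaceP[] ->; rewrite ?xW //; repeat apply: (nW) => //.
Qed.

(** Here [x] and [z] arrive at one vertex from opposite sides and both turn right. Exchanging their
    continuations gives two left turns. *)
Lemma esucc_closing x y z :
  esucc x y -> y != enext x -> esucc z (enext x) -> z != x -> esucc z y.
Proof.
case/orP=> /eqP->; first by rewrite eqxx.
move=> _ /orP[] /eqP h zx; first by move/enext_inj: h zx => ->; rewrite eqxx.
apply/orP; left; apply/eqP.
have -> : z = erev (enext (erev (enext x))) by rewrite h eright_rev erevK.
by rewrite !enext_rev /enext /eright /=; case: (x.2) => [[] []].
Qed.

(** The loop is cut at a vertex that it visits twice. The winding numbers of the pieces add up;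
    their right-hand values lie in {0, -1} and have sum 0, so both are 0 and neither piece has a
    negative winding number. If [enext u] were missing from the piece of [u], its right face would
    have winding number 1 in that piece, against the value 0 for the whole loop. *)
Lemma good_split x X Y : good_loop (x :: X ++ enext x :: Y) ->
  good_loop X /\ good_loop (x :: enext x :: Y).
Proof.
set W := _ :: _; move=> gW.
have [sW wW nW] := gW; have [cW uW aW] := sW.
case: X => [|x1 X] in W gW sW wW nW cW uW aW *; first by split=> //; exact: good_nil.
pose W1 := x1 :: X; pose W2 := x :: enext x :: Y.
have pe : perm_eq W (W1 ++ W2).
  rewrite /W /W1 /W2 -cat_cons -[x :: (x1 :: X)]cat1s -catA perm_catCA.
  by rewrite perm_cat2l.
have me := perm_mem pe.
have sub1 : {subset W1 <= W} by move=> u hu; rewrite me mem_cat hu.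
have sub2 : {subset W2 <= W} by move=> u hu; rewrite me mem_cat hu orbT.
move: (uW); rewrite (perm_uniq pe) cat_uniq => /and3P[u1 dis u2].
have x1n : x1 != enext x.
  apply: contraNneq dis => e; apply/hasP; exists x1; last by rewrite inE eqxx.
  by rewrite !inE e eqxx orbT.
move: (cW); rewrite /W /= rcons_cat cat_path /= => /and4P[h1 h2 h3 h4].
have ln : last x1 X != x.
  apply: contraTneq uW => e; rewrite /W /= -cat_cons mem_cat.
  by rewrite -[in X in X || _]e mem_last.
have s1 : simple_loop W1.
  split=> //; last by move=> u hu; apply: contra (aW u (sub1 _ hu)) => /sub1.
  by rewrite /W1 /= rcons_path h2 /=; exact: (esucc_closing h1).
have s2 : simple_loop W2.
  split=> //; last by move=> u hu; apply: contra (aW u (sub2 _ hu)) => /sub2.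
  by rewrite /W2 /= h4 /esucc eqxx.
have split_w f : winding W f = winding W1 f + winding W2 f.
  by rewrite (winding_perm _ pe) winding_cat.
have x1W : x1 \in W1 by rewrite inE eqxx.
have xW2 : x \in W2 by rewrite inE eqxx.
have k1 := @simple_const W1 s1; have k2 := @simple_const W2 s2.
have r1 : rface x1 = rface x.
  by move: h1 => /orP[] /eqP e; [rewrite e eqxx in x1n | rewrite e rface_right].
have c1 : {in W1, forall u, winding W1 (rface u) = winding W1 (rface x)}.
  by move=> u hu; rewrite (k1 _ x1) // r1.
have c2 : {in W2, forall u, winding W2 (rface u) = winding W2 (rface x)}.
  by move=> u hu; rewrite (k2 _ x).
have v1 := simple_value s1 isT c1; have v2 := simple_value s2 isT c2.
have xx : winding W1 (rface x) + winding W2 (rface x) = 0.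
  by rewrite -split_w wW // inE eqxx.
have z1 : winding W1 (rface x) = 0.
  by case: v1 v2 xx => -> [] ->.
have z2 : winding W2 (rface x) = 0 by move: xx; rewrite z1 add0r.
have p1 f : 0 <= winding W1 f.
  by case: (winding_values s1 c1 f) => [->|[_ []->]]; rewrite ?z1.
have p2 f : 0 <= winding W2 f.
  by case: (winding_values s2 c2 f) => [->|[_ []->]]; rewrite ?z2.
have aux V (U : seq oedge) : simple_loop V -> {subset V <= W} ->
    (forall f, 0 <= winding V f) -> (forall f, 0 <= winding U f) ->
    (forall f, winding W f = winding V f + winding U f) ->
    {in V, forall u, winding V (rface u) = 0} ->
    {in V, forall u, enext u \in V}.
  move=> sV subV pV pU sp zV u hu; have [cV _ aV] := sV.
  have nu : enext u \in W by apply/nW/subV.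
  have b0 : winding V (rface (enext u)) = 0.
    have /eqP := wW _ nu; rewrite sp paddr_eq0; [|exact: pV|exact: pU].
    by case/andP=> /eqP.
  have l1 : winding V (lface (enext u)) = 1.
    by rewrite lface_next (simple_jump sV hu) zV.
  apply: contraTT isT => nV.
  have nrV : erev (enext u) \notin V.
    apply: contraL nu => /subV h; rewrite -[enext u]erevK; exact: aW.
  by have := winding_foreign cV nV nrV; rewrite l1 b0.
split; split=> //.
- by move=> u hu; rewrite c1.
- apply: (aux _ W2) => //.
  by move=> u hu; rewrite c1.
- by move=> u hu; rewrite c2.
- apply: (aux _ W1) => //.
    by move=> f; rewrite split_w addrC.
  by move=> u hu; rewrite c2.
Qed.

(** * Words in the free group on half-diagonals *)

Notation hletter := (bool * oedge)%type.
Definition linv (l : hletter) : hletter := (~~ l.1, l.2).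
Definition winv (w : seq hletter) : seq hletter := rev (map linv w).
Definition noback (k l : hletter) : bool := l != linv k.
Definition reduced (w : seq hletter) : bool := sorted noback w.
Definition push (l : hletter) (w : seq hletter) : seq hletter :=
  if w is k :: w' then if k == linv l then w' else l :: w else [:: l].
Definition act (w s : seq hletter) : seq hletter := foldr push s w.
(* Equality in the free group, which acts on reduced words by left
   multiplication. *)
Definition homotopic (w1 w2 : seq hletter) : Prop :=
  forall s, reduced s -> act w1 s = act w2 s.

Lemma linvK : involutive linv.
Proof. by case=> b x; rewrite /linv /= negbK. Qed.
Lemma winvK : involutive winv.
Proof. by move=> w; rewrite /winv map_rev revK mapK //; exact: linvK. Qed.
Lemma winv_cat v w : winv (v ++ w) = winv w ++ winv v.
Proof. by rewrite /winv map_cat rev_cat. Qed.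
Lemma mem_winv l w : (l \in winv w) = (linv l \in w).
Proof.
rewrite /winv mem_rev -[in LHS](linvK l) mem_map //; exact: can_inj linvK.
Qed.

Lemma push_reduced l w : reduced w -> reduced (push l w).
Proof.
case: w => //= k w; case: ifP => [_ /path_sorted //|h hw].
by rewrite /reduced /= /noback h.
Qed.
Lemma act_reduced w s : reduced s -> reduced (act w s).
Proof. by move=> hs; elim: w => //= l w; exact: push_reduced. Qed.
(** Every letter acts bijectively on reduced words; this replaces a proof of confluence. *)
Lemma pushK l w : reduced w -> push (linv l) (push l w) = w.
Proof.
case: w => [|k w] hw /=; first by rewrite linvK eqxx.
case: eqP => [e|_] /=; last by rewrite linvK eqxx.
case: w hw => [|j w] /=; rewrite ?e //.
by rewrite {1}/noback /= linvK => /andP[/negbTE->].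
Qed.
Lemma act_cat v w s : act (v ++ w) s = act v (act w s).
Proof. exact: foldr_cat. Qed.

Lemma homotopic_refl w : homotopic w w. Proof. by []. Qed.
Lemma homotopic_sym v w : homotopic v w -> homotopic w v.
Proof. by move=> h s /h. Qed.
Lemma homotopic_trans v u w : homotopic u v -> homotopic v w -> homotopic u w.
Proof. by move=> h1 h2 s hs; rewrite h1 ?h2. Qed.
Lemma homotopic_cat v v' w w' :
  homotopic v v' -> homotopic w w' -> homotopic (v ++ w) (v' ++ w').
Proof.
by move=> h1 h2 s hs; rewrite !act_cat h2 // h1 //; exact: act_reduced.
Qed.
Lemma homotopic_catl v w w' : homotopic w w' -> homotopic (v ++ w) (v ++ w').
Proof. exact: homotopic_cat. Qed.
Lemma homotopic_catr w v v' : homotopic v v' -> homotopic (v ++ w) (v' ++ w).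
Proof. by move=> h; exact: homotopic_cat. Qed.
Lemma homotopic_drop u v w : homotopic v [::] -> homotopic (u ++ v ++ w) (u ++ w).
Proof. by move=> h; apply: homotopic_catl; apply: homotopic_catr h. Qed.
Lemma homotopic_winvl w : homotopic (winv w ++ w) [::].
Proof.
elim: w => [//|l w IH]; rewrite -cat1s winv_cat -catA.
apply: homotopic_trans IH; apply: homotopic_catl => s hs /=.
by rewrite pushK //; exact: act_reduced.
Qed.
Lemma homotopic_winvr w : homotopic (w ++ winv w) [::].
Proof. by rewrite -{1}[w]winvK; exact: homotopic_winvl. Qed.
Lemma homotopic_inv v w : homotopic v w -> homotopic (winv v) (winv w).
Proof.
move=> h; have h1 : homotopic (winv v ++ w ++ winv w) (winv v).
  by rewrite -[X in homotopic _ X]cats0; apply/homotopic_catl/homotopic_winvr.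
apply: homotopic_trans (homotopic_sym h1) _.
have h2 : homotopic (winv v ++ w) [::].
  apply: homotopic_trans (homotopic_winvl v).
  by apply/homotopic_catl/homotopic_sym.
by rewrite catA; exact: (homotopic_catr _ h2).
Qed.

Lemma act_id w : reduced w -> act w [::] = w.
Proof.
elim: w => //= l w IH h; rewrite IH; last exact: path_sorted h.
by case: w h {IH} => //= k w /andP[/negbTE->].
Qed.
Lemma homotopic_eq v w : homotopic v w -> reduced w -> act v [::] = w.
Proof. by move=> h hw; rewrite h // act_id. Qed.
(** Cancellation only deletes letters, so a letter of the normal form occurs in every word that
    represents it. *)
Lemma act_subseq w : subseq (act w [::]) w.
Proof.
elim: w => // l w IH.
change (subseq (push l (act w [::])) (l :: w)).
have : subseq (push l (act w [::])) (l :: act w [::]).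
  case: (act w [::]) => [|k v]; first exact: subseq_refl.
  rewrite [push _ _]/=; case: ifP => _; first exact: (suffix_subseq [:: l; k] v).
  exact: subseq_refl.
by move=> h; apply: (subseq_trans h); rewrite /= eqxx.
Qed.

(** The exponent sum of a generator, a homomorphism to the integers: an invariant that detects
    letters which no cancellation can remove. *)
Definition exponent (g : oedge) (w : seq hletter) : int :=
  (count_mem (true, g) w)%:Z - (count_mem (false, g) w)%:Z.
Lemma exponent_cat g v w : exponent g (v ++ w) = exponent g v + exponent g w.
Proof. by rewrite /exponent !count_cat !PoszD; ring. Qed.
Lemma exponent_cons g l w : exponent g (l :: w) = exponent g [:: l] + exponent g w.
Proof. by rewrite -cat1s exponent_cat. Qed.
Lemma exponent_push g l w : exponent g (push l w) = exponent g (l :: w).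
Proof.
case: w => //= k w; case: eqP => // ->.
rewrite [RHS]exponent_cons [X in _ + X]exponent_cons /exponent /linv.
by case: l => [[] x] /=; rewrite !xpair_eqE /=; lia.
Qed.
Lemma exponent_act g w : exponent g (act w [::]) = exponent g w.
Proof.
elim: w => //= l w IH; rewrite exponent_push.
by rewrite exponent_cons IH -exponent_cons.
Qed.
Lemma exponent_homotopic g v w : homotopic v w -> exponent g v = exponent g w.
Proof. by move=> h; rewrite -exponent_act h // exponent_act. Qed.
Lemma exponent_mem g w : exponent g w != 0 -> exists b, (b, g) \in w.
Proof.
move=> h; case: (boolP ((true, g) \in w)) => h1; first by exists true.
case: (boolP ((false, g) \in w)) => h2; first by exists false.
by move: h; rewrite /exponent (count_memPn h1) (count_memPn h2).
Qed.

(* The left side of a path: [(b, x)] is the half-diagonal from the base of [x]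
   to its left face, run outwards when [b] holds. *)
Definition lside (W : seq oedge) : seq hletter :=
  flatten [seq [:: (true, x); (false, enext x)] | x <- W].
Lemma lside_cat V W : lside (V ++ W) = lside V ++ lside W.
Proof. by rewrite /lside map_cat flatten_cat. Qed.
Lemma lside_cons x W : lside (x :: W) = lside [:: x] ++ lside W.
Proof. by []. Qed.
Lemma eprev_eq (x y : oedge) : (eprev x == y) = (x == enext y).
Proof. by apply/eqP/eqP=> [<-|->]; rewrite ?eprevK ?enextK. Qed.
Lemma mem_lside b x W :
  ((b, x) \in lside W) = if b then x \in W else eprev x \in W.
Proof.
elim: W => [|y W IH]; first by rewrite !in_nil if_same.
rewrite lside_cons mem_cat {}IH !inE !xpair_eqE.
by case: b => /=; rewrite ?orbF // eprev_eq.
Qed.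
Lemma exponent_lside g W : exponent g (lside W) =
  (count_mem g W)%:Z - (count_mem (eprev g) W)%:Z.
Proof.
elim: W => [//|y W IH]; rewrite lside_cons exponent_cat {}IH /exponent /=.
rewrite !xpair_eqE /= [y == eprev g]eq_sym eprev_eq [g == _]eq_sym !PoszD; ring.
Qed.

Lemma lside_face x : homotopic
  (lside [:: x; enext x; enext (enext x); enext (enext (enext x))]) [::].
Proof.
move=> s hs; rewrite /act /= enext4.
have ft y t : reduced t -> push (false, y) (push (true, y) t) = t.
  exact: (pushK (true, y)).
have tf y t : reduced t -> push (true, y) (push (false, y) t) = t.
  exact: (pushK (false, y)).
by rewrite !ft ?tf //; exact: push_reduced.
Qed.

Lemma orbit_uniq x :
  uniq [:: x; enext x; enext (enext x); enext (enext (enext x))].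
Proof.
case: x => [[a b] d]; apply: (@map_uniq _ _ snd).
by case: d => [[] []].
Qed.

(** Induction on the length. The loop reads x0 X1 x1 X2 x2 X3 x3 Y, where the xi run around one
    face. Cutting at each corner of that face shows that X1, X2, X3 and Y are good loops, hence
    trivial, and one turn around a face remains. *)
Lemma good_lside W : good_loop W -> homotopic (lside W) [::].
Proof.
have [n] := ubnP (size W); elim: n W => // n IH [//|x0 W] /ltnSE /= hn gW.
have /and5P[] := orbit_uniq x0; rewrite !inE !negb_or.
set x1 := enext x0; set x2 := enext x1; set x3 := enext x2.
move=> /and3P[n01 n02 n03] /andP[n12 n13] n23 _ _.
have next V y : good_loop V -> y \in V -> enext y \in V by case=> _ _; apply.
have m1 : x1 \in W.
  have := next _ x0 gW (mem_head _ _); rewrite inE => /orP[/eqP h|//].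
  by rewrite /x1 h eqxx in n01.
case/splitPr: m1 gW hn => X1 Y gW hn.
have [g1 {}gW] := good_split gW.
have m2 : x2 \in Y.
  have := next _ x1 gW; rewrite !inE eqxx orbT => /(_ isT).
  by rewrite -/x2 eq_sym (negbTE n02) eq_sym (negbTE n12).
case/splitPr: m2 gW hn => X2 {}Y gW hn.
have [g2 {}gW] : good_loop X2 /\ good_loop (x1 :: x2 :: Y ++ [:: x0]).
  by apply: good_split; have := @good_rot [:: x0] _ gW; rewrite /= -catA.
have m3 : x3 \in Y.
  have := next _ x2 gW; rewrite !inE eqxx orbT => /(_ isT).
  rewrite -/x3 eq_sym (negbTE n13) eq_sym (negbTE n23) mem_cat inE.
  by rewrite [x3 == _]eq_sym (negbTE n03) orbF.
case/splitPr: m3 gW hn => X3 {}Y gW hn.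
have [g3 {}gW] : good_loop X3 /\ good_loop (x2 :: x3 :: Y ++ [:: x0; x1]).
  by apply: good_split; have := @good_rot [:: x1] _ gW; rewrite /= -!catA.
have [g4 _] : good_loop Y /\ good_loop (x3 :: enext x3 :: [:: x1; x2]).
  apply: good_split; have := @good_rot [:: x2] _ gW; rewrite /= -!catA /=.
  by rewrite /x3 /x2 /x1 enext4.
rewrite !size_cat /= !size_cat /= !size_cat /= in hn.
have h1 : homotopic (lside X1) [::] by apply: IH => //; lia.
have h2 : homotopic (lside X2) [::] by apply: IH => //; lia.
have h3 : homotopic (lside X3) [::] by apply: IH => //; lia.
have h4 : homotopic (lside Y) [::] by apply: IH => //; lia.
have drop X Z w : homotopic (lside X) [::] -> homotopic (lside Z) w ->
    homotopic (lside (X ++ Z)) w.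
  by move=> hX hZ; rewrite lside_cat -[w]cat0s; exact: homotopic_cat.
have keep y Z V : homotopic (lside Z) (lside V) ->
    homotopic (lside (y :: Z)) (lside (y :: V)).
  by move=> h; exact: (homotopic_catl (lside [:: y]) h).
apply: homotopic_trans (lside_face x0); rewrite -/x1 -/x2 -/x3.
by do 3![apply/keep/drop => //]; apply/keep.
Qed.

(** * Tiling substitutions *)

Definition near_edges (M : nat) (p : int * int) : seq oedge :=
  [seq ((p.1 + ij.1%:Z - M%:Z, p.2 + ij.2%:Z - M%:Z), d)
     | ij <- [seq (i, j) | i <- iota 0 (M.*2.+1), j <- iota 0 (M.*2.+1)],
       d <- [:: (false, false); (true, false); (false, true); (true, true)]].

Lemma size_near_edges M p : size (near_edges M p) = (4 * M.*2.+1 ^ 2)%N.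
Proof. by rewrite size_allpairs size_allpairs !size_iota mulnC mulnn. Qed.

Lemma mem_near_edges M (p : int * int) (x : oedge) :
  `|x.1.1 - p.1| <= M%:Z -> `|x.1.2 - p.2| <= M%:Z -> x \in near_edges M p.
Proof.
case: x => [[a b] d] /= ha hb; apply/allpairsP.
exists ((absz (a - p.1 + M%:Z), absz (b - p.2 + M%:Z)), d); split.
- apply/allpairsP; exists (absz (a - p.1 + M%:Z), absz (b - p.2 + M%:Z)).
  by rewrite !mem_iota /= -!muln2; split=> //; lia.
- by case: d => [[] []].
- by rewrite /=; do 2 ?[congr pair]; lia.
Qed.

(** The winding number vanishes east of the loop and on rows that miss it. West of the loop, a face
    can be moved north to such a row without crossing an edge of the loop. *)
Lemma winding_support W : cycle esucc W -> exists M : nat, forall f : int * int,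
  winding W f != 0 -> `|f.1| <= M%:Z /\ `|f.2| <= M%:Z.
Proof.
move=> cW; have [M hM] := loop_bound W; exists M.+1 => -[i j] /=.
have right (f : int * int) : M%:Z <= f.1 -> winding W f = 0.
  move=> hf; rewrite /winding big1_seq // => x /= /hM xM; rewrite /weight.
  by case: ifP => //; lia.
have row (f : int * int) : M%:Z + 1 <= `|f.2| -> winding W f = 0.
  move=> hf; rewrite /winding big1_seq // => x /= /hM xM; rewrite /weight.
  by case: ifP => // _; case: ifP => _; lia.
have left (n : nat) (k l : int) : k <= - M%:Z - 1 -> M%:Z + 1 <= l + n%:Z -> winding W (k, l) = 0.
  elim: n k l => [|n IH] k l hk hl; first by apply: row => /=; lia.
  pose y : oedge := ((k, l + 1), (false, false)).
  have yW : y \notin W by apply/negP => /hM /=; lia.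
  have ryW : erev y \notin W by apply/negP => /hM /=; rewrite /dx /=; lia.
  have := winding_foreign cW yW ryW.
  have -> : lface y = (k, l + 1) by rewrite /y; osolve.
  have -> : rface y = (k, l) by rewrite /y; osolve.
  by move=> <-; apply: IH; lia.
move=> h; split; last first.
  by rewrite leNgt; apply: contra h => hj; rewrite row //=; lia.
rewrite leNgt; apply: contra h => hi; case: (leP 0 i) => hi0.
  by rewrite right //=; lia.
by rewrite (left (absz (M%:Z + 1 - j)%R)) //; lia.
Qed.

Definition origin : oedge := ((0, 0), (false, false)).
Definition efirst (P : oedge -> seq oedge) (g : oedge) := head origin (P g).
Definition elast (P : oedge -> seq oedge) (g : oedge) := last origin (P g).

(** Paths are oriented and reverse with their edge, so exactness over oriented edges means that each
    unoriented edge belongs to one path. [tiling_next] fixes the corners: the paths of consecutive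
    sides of a face join by a left turn. *)
Record tiling (P : oedge -> seq oedge) : Prop := Tiling {
  tiling_neq0 : forall g, P g != [::];
  tiling_path : forall g, sorted esucc (P g);
  tiling_rev : forall g, P (erev g) = rev (map erev (P g));
  tiling_next : forall g, efirst P (enext g) = enext (elast P g);
  tiling_cover : forall x, exists g, x \in P g;
  tiling_disj : forall x g h, x \in P g -> x \in P h -> g = h;
  tiling_uniq : forall g, uniq (P g) }.

Section Tiling.
Variables (P : oedge -> seq oedge) (tP : tiling P).

Lemma efirst_in g : efirst P g \in P g.
Proof.
by rewrite /efirst; case: (P g) (tiling_neq0 tP g) => //= x X _; rewrite inE eqxx.
Qed.
Lemma elast_in g : elast P g \in P g.
Proof.
by rewrite /elast; case: (P g) (tiling_neq0 tP g) => //= x X _; rewrite mem_last.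
Qed.
Lemma efirst_rev g : efirst P (erev g) = erev (elast P g).
Proof.
rewrite /efirst /elast (tiling_rev tP); case/lastP: (P g) (tiling_neq0 tP g) => //= X x _.
by rewrite map_rcons rev_rcons last_rcons.
Qed.
Lemma elast_rev g : elast P (erev g) = erev (efirst P g).
Proof. by rewrite -[g in RHS]erevK efirst_rev erevK. Qed.
Lemma mem_tiling_rev x g : (x \in P (erev g)) = (erev x \in P g).
Proof.
rewrite (tiling_rev tP) mem_rev -[in LHS](erevK x) mem_map //; exact: erev_inj.
Qed.

Lemma tiling_succ g h : esucc g h -> esucc (elast P g) (efirst P h).
Proof.
case/orP=> /eqP->; first by rewrite (tiling_next tP) /esucc eqxx.
rewrite -esucc_rev -efirst_rev -elast_rev -(eright_rev g) (tiling_next tP).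
by rewrite /esucc eqxx.
Qed.

Lemma efirst_rotr g : efirst P (g.1, rotr g.2) = ((efirst P g).1, rotr (efirst P g).2).
Proof. by rewrite -!enext_rev (tiling_next tP) elast_rev. Qed.
Lemma efirst_rotl g : efirst P (swivel g) = swivel (efirst P g).
Proof.
have h := efirst_rotr (swivel g).
have e1 : (g.1, rotr (rotl g.2)) = g by case: g {h} => [p [[] []]].
rewrite /swivel /= e1 in h.
rewrite h /swivel /=; case: (efirst P _) => [p [[] []]] //.
Qed.

Lemma eprev_efirst g : eprev (efirst P g) = elast P (eprev g).
Proof. by rewrite -[g in LHS]eprevK (tiling_next tP) enextK. Qed.

Definition face_loop (g : oedge) : seq oedge :=
  P g ++ P (enext g) ++ P (enext (enext g)) ++ P (enext (enext (enext g))).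

Lemma mem_face_loop g x :
  reflect (exists2 h, lface h = lface g & x \in P h) (x \in face_loop g).
Proof.
rewrite /face_loop !mem_cat; apply: (iffP idP).
  case/or4P=> h; [exists g | exists (enext g) | exists (enext (enext g))
    | exists (enext (enext (enext g)))]; rewrite ?lface_next //.
by case=> h /esym/lfaceP[] -> ->; rewrite ?orbT.
Qed.

Lemma face_loop_simple g : simple_loop (face_loop g).
Proof.
have E h : exists x X, [/\ P h = x :: X, path esucc x X, efirst P h = x & elast P h = last x X].
  have := tiling_neq0 tP h; have := tiling_path tP h; rewrite /efirst /elast.
  by case: (P h) => // x X hp _; exists x, X.
split.
- rewrite /face_loop; have := enext4 g.
  set g2 := enext g; set g3 := enext g2; set g4 := enext g3 => e4.
  have := tiling_next tP g; have := tiling_next tP g2; have := tiling_next tP g3.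
  have := tiling_next tP g4; rewrite e4 -/g2 -/g3 -/g4.
  have [x1 [X1 [-> p1 -> ->]]] := E g; have [x2 [X2 [-> p2 -> ->]]] := E g2.
  have [x3 [X3 [-> p3 -> ->]]] := E g3; have [x4 [X4 [-> p4 -> ->]]] := E g4.
  move=> j4 j3 j2 j1; rewrite /= !rcons_cat /= !rcons_cat /= !rcons_cat /=.
  rewrite cat_path /= p1 cat_path /= p2 cat_path /= p3 rcons_path p4.
  by rewrite /esucc -j1 -j2 -j3 -j4 !eqxx.
- rewrite /face_loop.
  have D h k : h != k -> ~~ has (mem (P h)) (P k).
    move=> hk; apply/hasP => -[x xk xh]; case/eqP: hk; exact: (tiling_disj tP xh xk).
  have /and5P[] := orbit_uniq g; rewrite !inE !negb_or.
  move=> /and3P[? ? ?] /andP[? ?] ? _ _.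
  by rewrite !cat_uniq !has_cat !negb_or !(tiling_uniq tP) /= !D.
- move=> x /mem_face_loop[h hg xh]; apply/mem_face_loop => -[k kg].
  rewrite -(erevK k) mem_tiling_rev erevK => xk.
  have := tiling_disj tP xh xk => e; have := rface_neq h.
  by rewrite hg -kg e rface_rev eqxx.
Qed.

Lemma foreign_notin q x f : x \in P f -> lface f != lface q -> x \notin face_loop q.
Proof.
move=> xf hf; apply/mem_face_loop => -[h hq xh].
by move: hf; rewrite (tiling_disj tP xf xh) hq eqxx.
Qed.

(** Such an edge is not a side of the face of [q], so its path shares no edge with the loop around
    that face, in either orientation. *)
Definition foreign q f := (lface f != lface q) && (rface f != lface q).

Lemma foreign_step q f h x y : foreign q f -> foreign q h -> x \in P f -> y \in P h ->
  esucc x y -> winding (face_loop q) (lface y) = winding (face_loop q) (lface x).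
Proof.
move=> /andP[f1 f2] /andP[h1 h2] xf yh.
have [cW _ _] := face_loop_simple q.
have same z k : z \in P k -> lface k != lface q -> rface k != lface q ->
    winding (face_loop q) (lface z) = winding (face_loop q) (rface z).
  move=> zk k1 k2; apply: winding_foreign => //; first exact: foreign_notin zk k1.
  apply: (@foreign_notin q _ (erev k)) => //.
  by rewrite mem_tiling_rev erevK.
by case/esuccP=> [->//|e]; rewrite (same _ h) // e -(same _ f).
Qed.

Lemma foreign_const q f x : foreign q f -> x \in P f ->
  winding (face_loop q) (lface x) = winding (face_loop q) (lface (efirst P f)).
Proof.
move=> hf; suff H y Y : path esucc y Y -> {subset y :: Y <= P f} ->
    {in y :: Y, forall z,
       winding (face_loop q) (lface z) = winding (face_loop q) (lface y)}.
  rewrite /efirst; case E : (P f) (tiling_path tP f) => [|y Y] //= hp.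
  by apply: H => //; rewrite E.
elim/last_ind: Y => [|Y z IH]; first by move=> _ _ z; rewrite inE => /eqP->.
rewrite rcons_path => /andP[hp hz] sub.
have sub' u : u \in y :: Y -> u \in P f.
  by move=> hu; apply: sub; rewrite -rcons_cons mem_rcons inE hu orbT.
move=> u; rewrite -rcons_cons mem_rcons inE.
case/orP=> [/eqP->|]; last exact: IH.
rewrite (foreign_step hf hf _ _ hz).
- by apply: IH => //; exact: mem_last.
- by apply: sub'; exact: mem_last.
- by apply: sub; rewrite -rcons_cons mem_rcons inE eqxx.
Qed.

(** The zigzag from [f] that turns alternately left and right, first left if [l] holds: an infinite
    admissible path that runs diagonally. *)
Definition stair (l : bool) (f : oedge) (m : nat) : oedge :=
  let d := f.2 in let d' := if l then rotl d else rotr d in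
  let k := (m./2)%:Z in
  let p := (f.1.1 + k * (dx d + dx d'), f.1.2 + k * (dy d + dy d')) in
  if odd m then ((p.1 + dx d, p.2 + dy d), d') else (p, d).

Lemma stair0 l f : stair l f 0 = f.
Proof. by case: f => [[a b] d]; rewrite /stair /= !mul0r !addr0. Qed.

Lemma stair_succ l f m : esucc (stair l f m) (stair l f m.+1).
Proof.
rewrite /esucc /stair /= uphalf_half; case: (odd m); rewrite /= ?add0n ?add1n.
  by apply/orP; case: l; [right|left]; apply/eqP; oedges;
    rewrite /enext /eright /tip /rotl /rotr /dx /dy /=; do ?[apply: pairE => //]; lia.
by apply/orP; case: l; [left|right].
Qed.

Lemma stair_inj l f : injective (stair l f).
Proof.
move=> m n; pose d := f.2; pose d' := if l then rotl d else rotr d.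
(* The coordinate along the diagonal of the zigzag; it grows by 1 with each edge. *)
pose phi (x : oedge) := x.1.1 * (dx d + dx d') + x.1.2 * (dy d + dy d').
have H k : phi (stair l f k) = phi f + k%:Z.
  have -> : k%:Z = (odd k)%:Z + 2 * (k./2)%:Z.
    by rewrite -[in LHS](odd_double_half k) -muln2 PoszD PoszM mulrC.
  rewrite /phi /stair /d' /d; move: (k./2) (odd k) => {}k.
  case: f @d @d' phi => [[u v] [[] []]] _ _ _; case: l => -[];
    rewrite /rotl /rotr /dx /dy /=; lia.
by move/(congr1 phi); rewrite !H => /addrI [].
Qed.

Lemma stair_foreign q f : foreign q f -> exists l, forall m, foreign q (stair l f m).
Proof.
case: f => [[u v] d] hf; pose beta (a : int * int) := a.1 * dx (rotl d) + a.2 * dy (rotl d).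
(* [beta] measures the position to the left of [f]; the zigzag is sent to the side away from the
   face of [q]. *)
exists (beta (lface q) < beta (lface ((u, v), d))) => -[|m]; first by rewrite stair0.
move: hf; rewrite /foreign; move: (lface q) => [q1 q2]; rewrite /beta /stair.
rewrite /= uphalf_half; move: (m./2) (odd m) => k b; case: ltP; case: d {beta} => [[] []];
  case: b; rewrite ?add0n ?add1n /eprev /enext /eright /rface /lface /erev /tip /rotl
    /rotr /opp /dx /dy /= !xpair_eqE /=; lia.
Qed.

(* The image of an infinite staircase of foreign edges leaves every bounded set,
   and the winding number is constant along it. *)
Lemma foreign_zero q f x : foreign q f -> x \in P f ->
  winding (face_loop q) (lface x) = 0.
Proof.
move=> hf xf; rewrite (foreign_const hf xf).
have [l hl] := stair_foreign hf; set v := winding _ _.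
have const m : winding (face_loop q) (lface (efirst P (stair l f m))) = v.
  elim: m => [|m <-]; first by rewrite stair0.
  rewrite -(foreign_const (hl m) (elast_in _)).
  apply: (foreign_step (hl m) (hl m.+1)); [exact: elast_in | exact: efirst_in |].
  exact/tiling_succ/stair_succ.
apply: contraTeq isT => v0; have [cW _ _] := face_loop_simple q.
have [M hM] := winding_support cW; pose B := near_edges M.+1 (0, 0).
have := @uniq_leq_size _ [seq efirst P (stair l f m) | m <- iota 0 (size B).+1] B.
rewrite size_map size_iota ltnn; apply.
  rewrite map_inj_uniq ?iota_uniq // => m n e; apply: (@stair_inj l f).
  by apply: (tiling_disj tP (efirst_in _)); rewrite e; exact: efirst_in.
move=> y /mapP[m _ ->]; move: v0; rewrite -(const m) => /hM.
case: (efirst P _) => [[i j] [[] []]]; rewrite /lface /= => -[h1 h2];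
  apply: mem_near_edges => /=; lia.
Qed.

(** The edge to the right of [g] at its base is foreign, and the left face of the first edge of its
    path is the right face of [efirst P g]; this gives winding number 0 on the right of the loop. If
    [enext x] were off the loop, it would lie on the path of a reversed side, against that value 0,
    or on a foreign path, against [foreign_zero], since the winding number on its left is 1. *)
Lemma face_loop_good g : good_loop (face_loop g).
Proof.
have sW := face_loop_simple g; have [cW uW aW] := sW.
have fW : efirst P g \in face_loop g.
  by apply/mem_face_loop; exists g => //; exact: efirst_in.
have wW : {in face_loop g, forall x, winding (face_loop g) (rface x) = 0}.
  move=> x xW; rewrite (simple_const sW xW fW).
  have e y : rface y = lface (y.1, rotr y.2) by oedges; osolve.
  rewrite e -efirst_rotr.
  apply: (@foreign_zero g (g.1, rotr g.2)) (efirst_in _).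
  rewrite /foreign -e rface_neq /=; apply/eqP; move: g {sW cW uW aW fW xW}.
  by move=> g; oedges; case; osolve.
split=> // x xW; apply: contraTT isT => nW.
have l1 : winding (face_loop g) (lface (enext x)) = 1.
  by rewrite lface_next simple_jump // wW.
have [f hf] := tiling_cover tP (enext x).
have f1 : lface f != lface g.
  by apply: contra nW => /eqP f1; apply/mem_face_loop; exists f.
have [f2|f2] := eqVneq (rface f) (lface g).
  have rW : erev (enext x) \in face_loop g.
    apply/mem_face_loop; exists (erev f); first by rewrite lface_rev.
    by rewrite mem_tiling_rev erevK.
  by have := wW _ rW; rewrite rface_rev l1.
by have := @foreign_zero g f _ _ hf; rewrite /foreign f1 f2 l1 => /(_ isT).
Qed.

(** Each face of the fine grid lies over a single face of the coarse grid. *)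
Lemma tiling_face x y g : x \in P g -> lface y = lface x ->
  exists2 h, lface h = lface g & y \in P h.
Proof.
move=> xg xy; apply/mem_face_loop; apply: good_orbit xy; first exact: face_loop_good.
by apply/mem_face_loop; exists g.
Qed.

Lemma lside_face_loop g : homotopic (lside (face_loop g)) [::].
Proof. exact/good_lside/face_loop_good. Qed.

Lemma uniq_split (x : oedge) X Y : uniq (X ++ x :: Y) -> x \notin X ++ Y.
Proof. by rewrite -cat1s uniq_catCA /= => /andP[]. Qed.

Lemma homotopic_mem l v w :
  homotopic v w -> l \notin w -> l \notin act v [::].
Proof. by move=> h; apply: contra; rewrite h // => /(mem_subseq (act_subseq _)). Qed.

(* If both [x] and [eprev x] lie on the path, the part of the path between them
   closes up to a loop whose left side cancels, and [x] cancels with it. *)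
Lemma boundary_mem b x g : (b, x) \in act (lside (P g)) [::] ->
  (x \in P g) (+) (eprev x \in P g).
Proof.
move=> h; have := mem_subseq (act_subseq _) h; rewrite mem_lside => hb.
case: (boolP (x \in P g)) (boolP (eprev x \in P g)) => [xg|xg] [yg|yg] //.
  2: by case: b hb {h} => hb; [rewrite hb in xg | rewrite hb in yg].
apply: contraLR h => _; move: yg {hb}; have := eprevK x.
have := mem_lside b x; move: (eprev x) => y memx exy yg.
have nyx : y != x.
  by apply/eqP => e; have /andP[] := orbit_uniq y; rewrite exy e inE eqxx.
have nxn : x != enext x by have /andP[] := orbit_uniq x; rewrite !inE !negb_or => /andP[].
have gd := face_loop_good g; have := tiling_uniq tP g.
have mem V : x \notin V -> y \notin V -> (b, x) \notin lside V.
  by move=> h1 h2; rewrite memx; case: (b).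
rewrite /face_loop in gd; move: (P (enext g) ++ _) gd => R.
case/splitPr: yg xg => X Z; rewrite mem_cat inE eq_sym (negbTE nyx) /=.
case/orP=> /splitPr[].
- move=> X1 Y gd uV.
  have := uniq_split uV; rewrite !mem_cat !inE !negb_or => /andP[/and3P[y1 _ y2] y3].
  move: uV; rewrite -catA /= => /uniq_split.
  rewrite !mem_cat !inE !negb_or => /and4P[x1 x2 _ x3].
  have gY : good_loop (x :: Y ++ [:: y]).
    apply: (@good_rot [:: y] (x :: Y)); rewrite -exy.
    have [] // := @good_split y (Z ++ R ++ X1) Y.
    have := @good_rot (X1 ++ x :: Y) (y :: Z ++ R).
    by rewrite exy /= -!catA /= in gd *; apply.
  apply: (@homotopic_mem _ _ (lside (X1 ++ Z))); last first.
    by apply: mem; rewrite mem_cat negb_or ?x1 ?y1.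
  have -> : X1 ++ x :: Y ++ y :: Z = X1 ++ (x :: Y ++ [:: y]) ++ Z.
    by rewrite /= -catA.
  rewrite (lside_cat X1) (lside_cat (x :: _)) (lside_cat X1 Z).
  by apply: homotopic_drop; exact: good_lside.
- move=> Y Z1 gd uV.
  have := uniq_split uV; rewrite !mem_cat !inE !negb_or => /and4P[y1 y2 _ y3].
  move: uV; rewrite -cat_cons catA => /uniq_split.
  rewrite !mem_cat !inE !negb_or => /andP[/and3P[x1 _ x2] x3].
  have [gY _] : good_loop Y /\ good_loop (y :: enext y :: Z1 ++ R ++ X).
    apply: good_split; rewrite exy.
    by move: gd; rewrite -catA /= -catA => /good_rot; rewrite /= -catA /= -catA.
  apply: (@homotopic_mem _ _ (lside X ++ [:: (true, y); (false, enext x)] ++ lside Z1)).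
    rewrite -catA /= (lside_cat X); apply: homotopic_catl; rewrite lside_cons (lside_cat Y).
    apply: (@homotopic_trans (lside [:: y] ++ lside (x :: Z1))).
      by apply: homotopic_drop; exact: good_lside.
    move=> s hs; rewrite /= exy (pushK (true, x)) //.
    by apply: push_reduced; apply: act_reduced.
  rewrite !mem_cat !inE !xpair_eqE /= [x == y]eq_sym (negbTE nyx) (negbTE nxn) !andbF /=.
  by rewrite negb_or !mem.
Qed.

(** Converse of [boundary_mem]: if exactly one of the two edges is on the path, the generator has
    exponent 1 or -1 and survives every cancellation. *)
Lemma boundary_exponent x g w : homotopic w (lside (P g)) ->
  (x \in P g) (+) (eprev x \in P g) -> exists b, (b, x) \in w.
Proof.
move=> h hx; apply: exponent_mem; rewrite (exponent_homotopic _ h) exponent_lside.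
by rewrite !count_uniq_mem ?(tiling_uniq tP) //; case: (x \in _) hx => /= [/negbTE->|->].
Qed.

End Tiling.

(** * Composition and iteration of tilings *)

Definition refine (P : oedge -> seq oedge) (X : seq oedge) := flatten (map P X).

Lemma refine_cons P x X : refine P (x :: X) = P x ++ refine P X.
Proof. by []. Qed.
Lemma refine_cat P X Y : refine P (X ++ Y) = refine P X ++ refine P Y.
Proof. by rewrite /refine map_cat flatten_cat. Qed.
Lemma mem_refine P X y : reflect (exists2 x, x \in X & y \in P x) (y \in refine P X).
Proof. exact: flatten_mapP. Qed.

Section Refine.
Variables (P : oedge -> seq oedge) (tP : tiling P).

Lemma refine_path x X : path esucc x X ->
  [/\ sorted esucc (refine P (x :: X)), head origin (refine P (x :: X)) = efirst P x,
      last origin (refine P (x :: X)) = elast P (last x X) & refine P (x :: X) != [::]].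
Proof.
elim: X x => [|y X IH] x /=.
  rewrite refine_cons cats0 => _; split=> //; [exact: tiling_path | exact: tiling_neq0].
case/andP=> xy /IH[]; rewrite (refine_cons P x); move: (refine P (y :: X)) => R.
have := tiling_succ tP xy; move: (tiling_path tP x) (tiling_neq0 tP x).
rewrite /efirst /elast => + + + + hh hl; rewrite -hh -hl {hh hl}.
case: (P x) => // a A; case: R => // b B /= pa _ j pb _.
by rewrite last_cat cat_path /= pa j pb.
Qed.

Lemma refine_rev X : refine P (rev (map erev X)) = rev (map erev (refine P X)).
Proof.
elim: X => //= x X IH; rewrite rev_cons -cats1 refine_cat refine_cons cats0 IH.
by rewrite refine_cons map_cat rev_cat -(tiling_rev tP).
Qed.

Lemma refine_uniq X : uniq X -> uniq (refine P X).
Proof.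
elim: X => //= x X IH /andP[xX /IH h]; rewrite refine_cons cat_uniq h (tiling_uniq tP) andbT.
apply/hasP => -[y /mem_refine[z zX yz] yx].
by rewrite (tiling_disj tP yx yz) zX in xX.
Qed.

Lemma tiling_refine Q : tiling Q -> tiling (fun g => refine P (Q g)).
Proof.
move=> tQ; have E h : exists2 X, Q h = efirst Q h :: X &
    path esucc (efirst Q h) X /\ elast Q h = last (efirst Q h) X.
  have := tiling_neq0 tQ h; have := tiling_path tQ h; rewrite /efirst /elast.
  by case: (Q h) => //= x X hp _; exists X.
have F h : efirst (fun g => refine P (Q g)) h = efirst P (efirst Q h).
  by have [X e [p _]] := E h; rewrite {1}/efirst e; have [_ ->] := refine_path p.
have L h : elast (fun g => refine P (Q g)) h = elast P (elast Q h).
  by have [X e [p ->]] := E h; rewrite {1}/elast e; have [_ _ ->] := refine_path p.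
split.
- by move=> g; have [X -> [p _]] := E g; have [] := refine_path p.
- by move=> g; have [X -> [p _]] := E g; have [] := refine_path p.
- by move=> g; rewrite (tiling_rev tQ) refine_rev.
- by move=> g; rewrite F L (tiling_next tQ) (tiling_next tP).
- move=> x; have [y xy] := tiling_cover tP x; have [z yz] := tiling_cover tQ y.
  by exists z; apply/mem_refine; exists y.
- move=> x g h /mem_refine[y yg xy] /mem_refine[z zh xz].
  by apply: (tiling_disj tQ yg); rewrite (tiling_disj tP xy xz).
- by move=> g; apply/refine_uniq/tiling_uniq.
Qed.
End Refine.

Definition iterate (P : oedge -> seq oedge) (n : nat) (g : oedge) : seq oedge :=
  iter n (refine P) [:: g].

Lemma iterateS P n g : iterate P n.+1 g = refine P (iterate P n g).
Proof. by []. Qed.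

Lemma iterate_add P m n g : iterate P (m + n) g = refine (iterate P m) (iterate P n g).
Proof.
elim: m => [|m IH]; first by rewrite add0n /refine flatten_map1 map_id.
rewrite addSn iterateS IH; elim: (iterate P n g) => // x X IHX.
by rewrite !refine_cons refine_cat IHX.
Qed.

Lemma tiling_iterate P n : tiling P -> tiling (iterate P n).
Proof.
move=> tP; elim: n => [|n IH]; last exact: (tiling_refine tP IH).
split=> //; first by move=> x; exists x; rewrite inE.
by move=> x g h; rewrite !inE => /eqP<- /eqP<-.
Qed.

Lemma size_iterate P N n g : (forall h, size (P h) = N) -> size (iterate P n g) = (N ^ n)%N.
Proof.
move=> hN; elim: n => // n IH; rewrite iterateS size_flatten /shape -map_comp.
rewrite (eq_map (g := fun=> N)) ?expnSr -?IH; last by move=> x /=; rewrite hN.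
by elim: (iterate P n g) => //= x X ->; rewrite mulSn.
Qed.

(** * Filled faces *)

Definition rotp (s : dir) (p : int * int) : int * int :=
  (p.1 * dx s - p.2 * dy s, p.1 * dy s + p.2 * dx s).
Definition dadd (s d : dir) : dir :=
  match s with
  | (false, false) => d | (true, false) => rotl d
  | (false, true) => opp d | (true, true) => rotr d
  end.
Definition motion (s : dir) (b : int * int) (x : oedge) : oedge :=
  (((rotp s x.1).1 + b.1, (rotp s x.1).2 + b.2), dadd s x.2).

Lemma motion_next s b x : motion s b (enext x) = enext (motion s b x).
Proof.
by case: s => [[] []]; oedges; rewrite /motion /rotp /dadd /=; osolve.
Qed.
Lemma motion_right s b x : motion s b (eright x) = eright (motion s b x).
Proof.
by case: s => [[] []]; oedges; rewrite /motion /rotp /dadd /=; osolve.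
Qed.
Lemma motion_transitive (x y : oedge) : even_vertex x.1 = even_vertex y.1 ->
  exists s b, even_vertex b /\ y = motion s b x.
Proof.
case: x y => [p d] [q d'] /= e.
have [s hs] : exists s, dadd s d = d'.
  by case: d {e} => [[] []]; case: d' => [[] []];
    solve [by exists (false, false) | by exists (false, true)
          | by exists (true, false) | by exists (true, true)].
exists s, (q.1 - (rotp s p).1, q.2 - (rotp s p).2); split; last first.
  by rewrite /motion /= hs; congr pair; case: q e => q1 q2 e; rewrite /=; congr pair; ring.
by move: e; case: s {hs} => [[] []]; rewrite /even_vertex /rotp /dx /dy /=; lia.
Qed.

(** The paths of edges with the same parity are congruent. The induced motion differs from the given
    one in general, since [P] dilates translations. *)
Definition equivariant (P : oedge -> seq oedge) : Prop :=
  forall s b, even_vertex b -> exists s' b', even_vertex b' /\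
    forall g, P (motion s b g) = map (motion s' b') (P g).

Lemma equivariant_iterate P n : equivariant P -> equivariant (iterate P n).
Proof.
move=> eP s b hb; elim: n => [|n [s1 [b1 [h1 IH]]]]; first by exists s, b.
have [s2 [b2 [h2 e]]] := eP s1 b1 h1; exists s2, b2; split=> // g.
rewrite !iterateS IH; elim: (iterate P n g) => // x X IHX.
by rewrite /= !refine_cons map_cat e IHX.
Qed.

Definition face_in (X : seq oedge) (x : oedge) : bool :=
  [&& x \in X, enext x \in X, enext (enext x) \in X
    & enext (enext (enext x)) \in X].

Lemma good_face_in W X x : good_loop W -> {subset W <= X} -> x \in W -> face_in X x.
Proof.
by move=> [_ _ nW] sub xW; rewrite /face_in !sub //; repeat apply: (nW) => //.
Qed.

Ltac norm_cat := rewrite /=; repeat (rewrite -catA /=).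

Lemma good_rot_eq W1 W2 W : good_loop W -> W = W1 ++ W2 -> good_loop (W2 ++ W1).
Proof. by move=> gW e; apply: good_rot; rewrite -e. Qed.

Section Pure.
Variables (P : oedge -> seq oedge) (tP : tiling P).

(** The path turns right after [x] but also runs through the left continuation of [x], so the loop
    around the face can be cut at the tip of [x]. Whichever visit comes first, one of the two good
    pieces avoids [R] and lies on [P g] alone. *)
Lemma revisit_pure g x A B : P g = A ++ x :: eright x :: B -> enext x \in P g ->
  exists z, face_in (P g) z.
Proof.
move=> e; have := face_loop_good tP g; rewrite /face_loop; move: (P (enext g) ++ _) => R.
rewrite e mem_cat !inE => gd.
have n1 : enext x != x by have /andP[] := orbit_uniq x; rewrite !inE eq_sym negb_or => /andP[].
have n2 : enext x != eright x by apply/eqP => -[]; case: (x.2) => [[] []].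
rewrite (negbTE n1) (negbTE n2) /=; case/orP=> [hA|hB].
- case/splitPr: hA e gd => A1 A2 _ gd.
  have [_ g2] : good_loop (eright x :: B ++ R ++ A1) /\ good_loop (x :: enext x :: A2).
    apply: good_split.
    have := @good_rot_eq (A1 ++ enext x :: A2) (x :: eright x :: B ++ R) _ gd.
    by norm_cat; apply.
  exists x; apply: (good_face_in g2); last by rewrite inE eqxx.
  move=> z; rewrite mem_cat mem_cat !inE => /or3P[->|->|->]; by rewrite ?orbT.
- case/splitPr: hB e gd => B1 B2 _ gd.
  have [g1 _] : good_loop (eright x :: B1) /\ good_loop (x :: enext x :: B2 ++ R ++ A).
    apply: good_split.
    have := @good_rot_eq A (x :: eright x :: B1 ++ enext x :: B2 ++ R) _ gd.
    by norm_cat; apply.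
  exists (eright x); apply: (good_face_in g1); last by rewrite inE eqxx.
  move=> z; rewrite !mem_cat !inE mem_cat => /orP[->|->]; by rewrite ?orbT.
Qed.

End Pure.

Section PureExists.
Variables (P : oedge -> seq oedge) (tP : tiling P).

(** Three left turns in succession would run around a whole face. *)
Lemma four_turns g : (4 <= size (P g))%N -> (forall x, ~~ face_in (P g) x) ->
  exists A x B, P g = A ++ x :: eright x :: B.
Proof.
have := tiling_path tP g; case: (P g) => [|x0 [|x1 [|x2 [|x3 X]]]] //=.
case/and4P=> /orP[] /eqP-> + + + _ np; last by exists [::], x0, (x2 :: x3 :: X).
case/orP=> /eqP e2; last by exists [:: x0], (enext x0), (x3 :: X); rewrite e2.
case/orP=> /eqP e3; last by exists [:: x0; enext x0], x2, X; rewrite e3.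
by have := np x0; rewrite /face_in e3 e2 !inE !eqxx !orbT.
Qed.

Lemma tip_parity (x : oedge) : even_vertex (tip x) = ~~ even_vertex x.1.
Proof. by oedges; rewrite /even_vertex /tip /dx /dy /=; lia. Qed.

(** Two successive turns start at edges of opposite parities. Reversal changes a right turn into a
    left turn whose first edge has a base of the same parity. *)
Lemma left_turn b : (forall g, 3 <= size (P g))%N ->
  exists g h A B, even_vertex h.1 = b /\ P g = A ++ h :: enext h :: B.
Proof.
move=> sP; have [A [h [k [B [hb e hk]]]]] : exists A h k B,
    [/\ even_vertex h.1 = b, P origin = A ++ h :: k :: B & esucc h k].
  have := tiling_path tP origin; have := sP origin.
  case: (P origin) => [|x0 [|x1 [|x2 X]]] //= _ /and3P[h1 h2 _].
  have [e|e] := eqVneq (even_vertex x0.1) b; first by exists [::], x0, x1, (x2 :: X).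
  exists [:: x0], x1, x2, X; split=> //.
  by rewrite (esucc_tip h1) tip_parity; case: b e; case: (even_vertex _).
case/orP: hk => /eqP ek; first by exists origin, h, A, B; rewrite -ek.
exists (erev origin), (erev k), (rev (map erev B)), (rev (map erev A)); split.
  by rewrite ek /= /erev /= tip_parity /= tip_parity negbK.
rewrite (tiling_rev tP) e map_cat rev_cat /= !rev_cons ek eright_rev.
by rewrite -!cats1 -!catA.
Qed.

Hypothesis eP : equivariant P.

(** The sides [e] and [f] are joined by a left turn, and some [P g] contains a congruent left turn.
    The second-level tile of that [g] contains congruent copies of [P e] and [P f], so the contact
    of the two paths becomes a contact of one tile with itself. *)
Lemma adjacent_pure e f x A B : (forall g, 3 <= size (P g))%N ->
  P e = A ++ x :: eright x :: B -> enext x \in P f -> f = enext e \/ e = enext f ->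
  exists g z, face_in (refine P (P g)) z.
Proof.
move=> sP ee xf ef.
pose u := if f == enext e then e else f.
have [g [h [A' [B' [hb eg]]]]] := left_turn (even_vertex u.1) sP.
have [s [b [bb hu]]] := motion_transitive (esym hb).
have [s' [b' [_ hP]]] := eP s bb.
pose m := motion s' b'.
have pe : exists A1 B1, refine P (P g) = A1 ++ m x :: eright (m x) :: B1.
  have [E1 E2] : exists A2 B2, P g = A2 ++ motion s b e :: B2.
    rewrite eg hu; move: ef; rewrite /u; case: eqP => [_ _|nf [//|e1]].
      by exists A', (enext (motion s b e) :: B').
    by exists (A' ++ [:: motion s b f]), B'; rewrite -motion_next -e1 -catA.
  case: E2 => B2 ->; exists (refine P E1 ++ map m A), (map m B ++ refine P B2).
  rewrite refine_cat refine_cons hP ee map_cat /= -motion_right.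
  by norm_cat.
have pf : enext (m x) \in refine P (P g).
  rewrite -motion_next; apply/mem_refine; exists (motion s b f); last first.
    by rewrite hP; apply: map_f.
  rewrite eg hu mem_cat !inE -motion_next; apply/orP; right.
  move: ef; rewrite /u; case: (f =P enext e) => [-> _|_ _]; by rewrite eqxx ?orbT.
have [A1 [B1 e1]] := pe.
exists g; exact: (revisit_pure (tiling_refine tP tP) e1 pf).
Qed.

(** If no face is filled, the left continuation of a right turn in [P e] can only lie on the path of
    the side opposite to [e]. Two neighbouring sides yield two such contacts. The first cuts a good
    loop out of the loop around the face; this loop contains [y] but not [enext y], a
    contradiction. *)
Lemma pure_exists : (forall g, 4 <= size (P g))%N ->
  exists g z, face_in (P g) z \/ face_in (refine P (P g)) z.
Proof.
move=> sP; have sP3 g : (3 <= size (P g))%N by exact: ltnW.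
apply: contrapT => hn.
have np g z : ~~ face_in (P g) z by apply/negP => h; apply: hn; exists g, z; left.
have np2 : ~ exists g z, face_in (refine P (P g)) z.
  by case=> g [z h]; apply: hn; exists g, z; right.
have opp e : exists A x B, P e = A ++ x :: B /\ enext x \in P (enext (enext e)).
  have [A [x [B ee]]] := four_turns (sP e) (np e).
  exists A, x, (eright x :: B); split=> //.
  have xe : x \in P e by rewrite ee mem_cat inE eqxx orbT.
  have [f fe xf] := tiling_face tP xe (lface_next x).
  case/esym/lfaceP: fe xf => -> // xf.
  - by have [z hz] := revisit_pure tP ee xf; have := np e z; rewrite hz.
  - by exfalso; apply: np2; apply: (adjacent_pure sP3 ee xf); left.
  - by exfalso; apply: np2; apply: (adjacent_pure sP3 ee xf); right; rewrite enext4.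
have [A [x [B [ee xe]]]] := opp origin.
have [A' [y [B' [ee' ye]]]] := opp (enext origin).
have := face_loop_good tP origin; rewrite /face_loop.
have [C [D hC]] : exists C D, P (enext (enext origin)) = C ++ enext x :: D.
  by case/splitPr: xe => C D; exists C, D.
rewrite ee hC => gd.
have [g1 _] : good_loop (B ++ P (enext origin) ++ C) /\
    good_loop (x :: enext x :: D ++ P (enext (enext (enext origin))) ++ A).
  apply: good_split; have := @good_rot_eq A (x :: B ++ P (enext origin) ++ C ++
    enext x :: D ++ P (enext (enext (enext origin)))) _ gd.
  by norm_cat; apply.
have [_ _ nW] := g1.
have /nW : y \in B ++ P (enext origin) ++ C.
  by rewrite ee' !mem_cat !inE eqxx ?orbT.
have dj h : enext y \in P h -> h = enext (enext (enext origin)).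
  by move=> hy; exact: (tiling_disj tP hy ye).
have /and5P[] := orbit_uniq origin; rewrite !inE !negb_or.
move=> /and3P[_ _ n3] /andP[_ n2] n1 _ _.
have inE3 : enext y \in P (enext (enext origin)) -> False.
  by move=> /dj e; rewrite e eqxx in n1.
rewrite !mem_cat => /or3P[hy|/dj e|hy].
- have /dj e : enext y \in P origin by rewrite ee mem_cat inE hy !orbT.
  by rewrite {1}e eqxx in n3.
- by rewrite {1}e eqxx in n2.
- by apply: inE3; rewrite hC mem_cat hy.
Qed.
End PureExists.

Lemma face_in_map s b X z : face_in X z -> face_in (map (motion s b) X) (motion s b z).
Proof. by case/and4P=> *; rewrite /face_in -!motion_next !map_f. Qed.
Lemma face_in_sub (X Y : seq oedge) z : {subset X <= Y} -> face_in X z -> face_in Y z.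
Proof. by move=> h /and4P[*]; apply/and4P; split; apply: h. Qed.
Lemma face_in_mem X z y : face_in X z -> lface y = lface z -> y \in X.
Proof. by case/and4P=> ? ? ? ? /esym/lfaceP[]->. Qed.

Lemma pow_gap (a C : nat) : (0 < a)%N -> ~ (forall i, a ^ i <= C * (a - 1) ^ i)%N.
Proof.
case: a => [|[|b]] // _ h.
  by have := h 1%N; rewrite muln0.
rewrite subn1 /= in h.
(* Bernoulli's inequality for the powers of 1 + 1/(b+1), cleared of denominators. With the exponent
   chosen below, its linear factor exceeds (b+1) C. *)
have bern i : (b.+1 ^ i * (b.+1 + i) <= b.+1 * b.+2 ^ i)%N.
  elim: i => [|i IH]; first by rewrite !expn0 mul1n muln1 addn0.
  rewrite !expnS; move: (b.+1 ^ i)%N (b.+2 ^ i)%N IH => p q IH.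
  have h1 : (p * (b.+1 * (b.+1 + i.+1)) <= p * (b.+2 * (b.+1 + i)))%N.
    by rewrite leq_mul2l; apply/orP; right; nia.
  have h2 := leq_mul (leqnn b.+2) IH; nia.
pose i := (b.+1 * C)%N.
have := leq_trans (bern i) (leq_mul (leqnn b.+1) (h i)).
rewrite mulnA mulnC leq_pmul2r ?expn_gt0 // /i; lia.
Qed.

(** If at every vertex of the box all four edges had the same status, that status would propagate
    from [x] to [y] along a horizontal and a vertical segment. *)
Lemma frontier (V : pred oedge) (x y : oedge) (M : nat) :
  (forall z, V (erev z) = V z) -> `|y.1.1 - x.1.1| <= M%:Z ->
  `|y.1.2 - x.1.2| <= M%:Z -> V x -> ~~ V y ->
  exists z : oedge, [/\ `|z.1.1 - x.1.1| <= M%:Z, `|z.1.2 - x.1.2| <= M%:Z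
    & V z != V (swivel z)].
Proof.
move=> Vrev h1 h2 Vx nVy; apply: contrapT => hn.
pose box (p : int * int) := (`|p.1 - x.1.1| <= M%:Z) && (`|p.2 - x.1.2| <= M%:Z).
have sw z : box z.1 -> V (swivel z) = V z.
  case/andP=> z1 z2; apply/eqP; rewrite eq_sym; apply: contrapT => /negP h.
  by apply: hn; exists z.
pose st p := V (p, (false, false)).
have dirs z : box z.1 -> V z = st z.1.
  move=> hz; have s0 := sw (z.1, (false, false)) hz.
  have s1 := sw (z.1, (true, false)) hz; have s2 := sw (z.1, (false, true)) hz.
  by rewrite /swivel /rotl /= in s0 s1 s2; case: z hz s0 s1 s2 => [p [[] []]] /= hz s0 s1 s2;
    rewrite /st ?s2 ?s1 ?s0.
have step p d : box p -> box (tip (p, d)) -> st (tip (p, d)) = st p.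
  move=> b1 b2; rewrite -(dirs (p, d)) // -Vrev dirs //.
pose adv (p : int * int) d (n : nat) : int * int := (p.1 + n%:Z * dx d, p.2 + n%:Z * dy d).
have walk d n p : box p -> box (adv p d n) -> st (adv p d n) = st p.
  elim: n => [|n IH] b1 b2; first by rewrite /adv !mul0r !addr0 -surjective_pairing.
  have b3 : box (adv p d n).
    move: b1 b2; rewrite /box /adv; case: d {IH} => [[] []]; rewrite /dx /dy /=; lia.
  have e : adv p d n.+1 = tip (adv p d n, d).
    rewrite /adv /tip /=; congr pair; lia.
  by rewrite -IH // e step // -e.
have bx : box x.1 by rewrite /box !subrr normr0 /=.
have by1 : box y.1 by rewrite /box h1 h2.
have bm : box (y.1.1, x.1.2) by rewrite /box /= h1 subrr normr0 /=.
have e1 : st (y.1.1, x.1.2) = st x.1.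
  have [d hd] : exists d, (y.1.1, x.1.2) = adv x.1 d (absz (y.1.1 - x.1.1)).
    exists (false, y.1.1 < x.1.1); rewrite /adv /dx /dy /=; case: ltP => h; congr pair; lia.
  by rewrite hd walk // -hd.
have e2 : st y.1 = st (y.1.1, x.1.2).
  have [d hd] : exists d, y.1 = adv (y.1.1, x.1.2) d (absz (y.1.2 - x.1.2)).
    exists (true, y.1.2 < x.1.2); rewrite /adv /dx /dy /= [LHS]surjective_pairing.
    case: ltP => h; congr pair; lia.
  by rewrite {1}hd walk // -hd.
by move: nVy; rewrite dirs // e2 e1 -dirs // Vx.
Qed.

Section Counting.
Variables (P : oedge -> seq oedge) (tP : tiling P) (eP : equivariant P).
Variables (N : nat) (sizeP : forall g, size (P g) = N) (N2 : (2 <= N)%N).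

Lemma pure_level : exists k, forall h, exists z, face_in (iterate P k h) z.
Proof.
have [j [g [z hz]]] : exists j g z, face_in (iterate P j g) z.
  (* Two levels are taken as one step, so that every path has at least four edges. *)
  have [|g [z []]] := pure_exists (tiling_iterate 2 tP) (equivariant_iterate 2 eP).
  - by move=> g; rewrite (size_iterate _ _ sizeP) (@leq_sqr 2 N).
  - by exists 2, g, z.
  - by rewrite -iterate_add; exists (2 + 2)%N, g, z.
exists j.+1 => h.
(* Successive edges of [P h] have bases of opposite parities, so one of them is congruent to [g]. *)
have [h' hP par] : exists2 h', h' \in P h & even_vertex g.1 = even_vertex h'.1.
  have := tiling_path tP h; have := N2; rewrite -(sizeP h).
  case: (P h) => [|x0 [|x1 X]] //= _ /andP[/esucc_tip h1 _].
  have [e|e] := eqVneq (even_vertex g.1) (even_vertex x0.1).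
    by exists x0; rewrite ?inE ?eqxx.
  exists x1; rewrite ?inE ?eqxx ?orbT // h1 tip_parity.
  by move: e; do 2!case: (even_vertex _).
have [s [b [bb e0]]] := motion_transitive par; rewrite e0 {e0 par} in hP.
have [s' [b' [_ e]]] := equivariant_iterate j eP s bb.
exists (motion s' b' z); have := face_in_map s' b' hz; rewrite -e.
apply: face_in_sub => y hy; rewrite -addn1 iterate_add; apply/mem_refine.
by exists (motion s b g) => //; rewrite /iterate /= /refine /= cats0.
Qed.

Definition impure (Q : oedge -> seq oedge) g : nat :=
  count (fun y => ~~ face_in (Q g) y) (Q g).

Lemma impure_add k j g K : (forall h, impure (iterate P k) h <= K)%N ->
  (impure (iterate P (k + j)) g <= K * impure (iterate P j) g)%N.
Proof.
move=> hK; rewrite /impure iterate_add; set V := refine _ _.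
set Y := iterate P j g.
have VE x y : x \in Y -> y \in iterate P k x -> y \in V.
  by move=> hx hy; apply/mem_refine; exists x.
suff H X : {subset X <= Y} -> (count (fun y => ~~ face_in V y) (refine (iterate P k) X)
    <= K * count (fun y => ~~ face_in Y y) X)%N by exact: H.
elim: X => [|x X IH] sub; first by rewrite muln0.
have xY : x \in Y by apply: sub; rewrite inE eqxx.
have {}IH := IH (fun y hy => sub y (@mem_behead _ (x :: X) y hy)).
rewrite refine_cons count_cat /= mulnDr leq_add //.
case: (boolP (face_in Y x)) => hx /=.
  rewrite muln0 leqn0; apply/eqP; rewrite (@eq_in_count _ _ pred0) ?count_pred0 //.
  move=> y hy /=; apply/negbTE; rewrite negbK.
  have H z : lface z = lface y -> z \in V.
    move=> hz; have [w hw zw] := tiling_face (tiling_iterate k tP) hy hz.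
    by apply: VE zw; exact: face_in_mem hw.
  by rewrite /face_in !H ?lface_next.
rewrite muln1; apply: leq_trans (hK x); apply: sub_count => y.
by apply: contra; apply: face_in_sub => z; exact: VE.
Qed.

(* The descendants of an edge of a filled face lie on filled faces, and every
   edge has a descendant on a filled face after [k] steps. *)
Lemma impure_decay : exists k, forall i g,
  (impure (iterate P (k * i)) g <= (N ^ k - 1) ^ i)%N.
Proof.
have [k hk] := pure_level; exists k => i g; elim: i => [|i IH].
  by rewrite muln0 expn0 (leq_trans (count_size _ _)).
rewrite mulnS expnS; apply: leq_trans (@impure_add k (k * i) g (N ^ k - 1) _) _; last by rewrite leq_mul2l IH orbT.
move=> h; rewrite -(size_iterate k h sizeP) leq_subRL; last first.
  by rewrite (size_iterate k h sizeP) expn_gt0 (leq_trans _ N2).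
have [z hz] := hk h; rewrite -(count_predC (face_in (iterate P k h))) leq_add2r.
by rewrite -has_count; apply/hasP; exists z => //; case/and4P: hz.
Qed.

Definition covers (Q : oedge -> seq oedge) g (x : oedge) : bool :=
  (x \in Q g) || (erev x \in Q g).

Lemma interior_vertex (M : nat) g : exists j x, x \in iterate P j g /\
  forall y : oedge, `|y.1.1 - x.1.1| <= M%:Z -> `|y.1.2 - x.1.2| <= M%:Z ->
    covers (iterate P j) g y.
Proof.
apply: contrapT => hn; have [k hk] := impure_decay.
(* The radius is [M.+1] because the edge found below may be [eprev z], whose base is one step away
   from that of [z]. *)
pose C := size (near_edges M.+1 (0, 0)).
suff H : forall i, ((N ^ k) ^ i <= 2 * C * (N ^ k - 1) ^ i)%N.
  by apply: (@pow_gap (N ^ k) (2 * C) _ H); rewrite expn_gt0 (leq_trans _ N2).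
move=> i; rewrite -expnM; set j := (k * i)%N; have tQ := tiling_iterate j tP.
pose bad h := [seq y <- iterate P j h | ~~ face_in (iterate P j h) y].
pose L := bad g ++ bad (erev g).
have sL : (size L <= 2 * (N ^ k - 1) ^ i)%N.
  by rewrite size_cat !size_filter mul2n -addnn leq_add // hk.
have sub (x : oedge) : x \in iterate P j g ->
    x \in flatten [seq near_edges M.+1 w.1 | w <- L].
  move=> xg.
  have [y [y1 y2 ny]] : exists y : oedge, [/\ `|y.1.1 - x.1.1| <= M%:Z,
      `|y.1.2 - x.1.2| <= M%:Z & ~~ covers (iterate P j) g y].
    apply: contrapT => hy; apply: hn; exists j, x; split=> // y y1 y2.
    by apply: contrapT => /negP c; apply: hy; exists y.
  have crev z : covers (iterate P j) g (erev z) = covers (iterate P j) g z.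
    by rewrite /covers erevK orbC.
  have cx : covers (iterate P j) g x by rewrite /covers xg.
  have [z [z1 z2 hz]] := @frontier (covers (iterate P j) g) x y M crev y1 y2 cx ny.
  have [w [wL w1 w2]] : exists w : oedge, [/\ w \in L, `|x.1.1 - w.1.1| <= M.+1%:Z
      & `|x.1.2 - w.1.2| <= M.+1%:Z].
    have badP u v : covers (iterate P j) g u -> ~~ covers (iterate P j) g v ->
        lface u = lface v -> u \in L.
      rewrite /covers negb_or -!(mem_tiling_rev tQ) mem_cat !mem_filter.
      move=> /orP[] hu /andP[nv nv'] e; apply/orP; [left|right]; rewrite hu andbT.
        by apply: contra nv => /face_in_mem; apply; rewrite e.
      by apply: contra nv' => /face_in_mem; apply; rewrite e.
    case: (boolP (covers _ _ z)) hz => hc1; case: (boolP (covers _ _ (swivel z))) => // hc2 _.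
      exists z; split; [|lia|lia]; apply: (badP _ (eprev z)) => //.
        by rewrite crev.
      by rewrite lface_prev.
    exists (eprev z); split.
    - by apply: (badP _ z); rewrite ?crev ?lface_prev.
    - move: z1; case: z {hc1 hc2 z2} => [[a b] [[] []]];
        rewrite /eprev /swivel /erev /tip /dx /rotl /=; lia.
    - move: z2; case: z {hc1 hc2 z1} => [[a b] [[] []]];
        rewrite /eprev /swivel /erev /tip /dy /rotl /=; lia.
  apply/flatten_mapP; exists w => //; exact: mem_near_edges.
have := uniq_leq_size (tiling_uniq tQ g) sub.
rewrite (size_iterate _ _ sizeP) size_flatten /shape -map_comp => /leq_trans; apply.
have -> : sumn [seq (size \o (fun w : oedge => near_edges M.+1 w.1)) w | w <- L] = (size L * C)%N.
  rewrite (eq_map (g := fun=> C)); last first.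
    by move=> w; rewrite /comp size_near_edges /C size_near_edges.
  by elim: (L) => //= w X ->; rewrite mulSn.
by rewrite mulnAC leq_mul2r sL orbT.
Qed.
End Counting.

(** * The substitution on edges defined by a folding rule *)

Fixpoint trace (g : oedge) (w : seq symbol) : seq oedge :=
  match w with
  | [::] => [::]
  | (A | B) :: w' => g :: trace (tip g, g.2) w'
  | Plus :: w' => trace (g.1, rotr g.2) w'
  | Minus :: w' => trace (g.1, rotl g.2) w'
  end.

(** Position and heading after the drawing, encoded as the edge that would be drawn next. *)
Fixpoint trace_end (g : oedge) (w : seq symbol) : oedge :=
  match w with
  | [::] => g
  | (A | B) :: w' => trace_end (tip g, g.2) w'
  | Plus :: w' => trace_end (g.1, rotr g.2) w'
  | Minus :: w' => trace_end (g.1, rotl g.2) w'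
  end.

Definition onward (x : oedge) : oedge := (tip x, x.2).
Definition backward (x : oedge) : oedge := (x.1, opp x.2).

Lemma trace_cat g u v : trace g (u ++ v) = trace g u ++ trace (trace_end g u) v.
Proof. by elim: u g => [|[] u IH] g //=; rewrite IH. Qed.
Lemma trace_end_cat g u v : trace_end g (u ++ v) = trace_end (trace_end g u) v.
Proof. by elim: u g => [|[] u IH] g //=; rewrite IH. Qed.

(** Drawn from the final state turned around, the reversed complementary word retraces the path.
    This is the geometric meaning of [sigma B]. *)
Lemma trace_rev g w :
  trace (backward (trace_end g w)) (rev (map tilde w)) = rev (map erev (trace g w))
  /\ trace_end (backward (trace_end g w)) (rev (map tilde w)) = backward g.
Proof.
elim: w g => [|x w IH] g //=.
rewrite rev_cons -cats1 trace_cat trace_end_cat.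
have o d : rotl (opp (rotr d)) = opp d by case: d => [[] []].
have o' d : rotr (opp (rotl d)) = opp d by case: d => [[] []].
have e : tip (tip g, opp g.2) = g.1 by oedges; osolve.
case: x => /=; [have [-> ->] := IH (tip g, g.2) | have [-> ->] := IH (tip g, g.2)
  | have [-> ->] := IH (g.1, rotr g.2) | have [-> ->] := IH (g.1, rotl g.2)];
  by rewrite /= /backward ?e ?o ?o' ?cats0 // rev_cons -cats1.
Qed.

Lemma trace_motion s b g w : trace (motion s b g) w = map (motion s b) (trace g w).
Proof.
have e1 x : onward (motion s b x) = motion s b (onward x).
  by case: s => [[] []]; oedges; rewrite /onward /motion /rotp /dadd /=; osolve.
have e2 x : ((motion s b x).1, rotl (motion s b x).2) = motion s b (x.1, rotl x.2).
  by case: s {e1} => [[] []]; case: x => [p [[] []]].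
have e3 x : ((motion s b x).1, rotr (motion s b x).2) = motion s b (x.1, rotr x.2).
  by case: s {e1 e2} => [[] []]; case: x => [p [[] []]].
by elim: w g => [|[] w IH] g //=; rewrite -IH ?e2 ?e3 // -e1.
Qed.

Lemma folding_ind (Q : seq symbol -> Prop) :
  (forall X, is_forward X -> Q [:: X]) ->
  (forall X s w, is_forward X -> ~~ is_forward s -> is_A (head B w) = ~~ is_A X ->
     folding_word w -> Q w -> Q [:: X, s & w]) ->
  forall w, folding_word w -> Q w.
Proof.
move=> h1 hS w; have [n] := ubnP (size w); elim: n w => // n IH.
case=> [//|X [|s w]] /= hn; first by case: X => // _; exact/h1.
have hw : folding_word w -> Q w by apply: IH; exact: ltnW.
case: X; case: w hw {hn} => [|[] w] //= hw /andP[hs fw]; apply: hS => //; exact: hw.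
Qed.

Lemma folding_trace w : folding_word w -> forall g, exists X,
  [/\ trace g w = g :: X, path esucc g X & trace_end g w = onward (last g X)].
Proof.
move: w; apply: folding_ind => [[] // _ g|X s w hX hs _ _ IH g]; try by exists [::].
have [h h0 e] : exists2 h, esucc g h &
    trace g [:: X, s & w] = g :: trace h w /\ trace_end g [:: X, s & w] = trace_end h w.
  by case: s hs => //; [exists (eright g) | exists (enext g)];
    rewrite /esucc ?eqxx ?orbT //; case: X hX.
have [-> ->] := e; have [Y [-> hp ->]] := IH h.
by exists (h :: Y) => /=; rewrite h0.
Qed.

Lemma size_trace g w : size (trace g w) = count is_forward w.
Proof. by elim: w g => [|[] w IH] g //=; rewrite IH. Qed.

Lemma draw_trace (K : pzRingType) (F : int * int -> K * K) (D : dir -> K * K) :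
  (forall p d, F (tip (p, d)) = F p + D d) ->
  (forall d, D (rotl d) = turn_left (D d)) -> (forall d, D (rotr d) = turn_right (D d)) ->
  forall g w, draw_from (F g.1) (D g.2) w = [seq F (tip x) | x <- trace g w].
Proof.
move=> hF hl hr g w; elim: w g => [|x w IH] //= g.
have t : F (tip g) = F g.1 + D g.2 by rewrite -hF -surjective_pairing.
by case: x => /=; rewrite -?hl -?hr -?t ?(IH (tip g, g.2)) ?(IH (g.1, rotr g.2)) ?(IH (g.1, rotl g.2)).
Qed.

Lemma even_cmul (c b : int * int) : even_vertex b -> even_vertex (cmul c b).
Proof.
rewrite /even_vertex /cmul /=; case: c b => u v [b1 b2] /= h.
have -> : u * b1 - v * b2 + (u * b2 + v * b1) = (u + v) * (b1 + b2) - 2 * (v * b2).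
  by ring.
by apply: rpredB; [exact: dvdz_mull | exact: dvdz_mulr].
Qed.

Lemma motion_rev s b x : motion s b (erev x) = erev (motion s b x).
Proof.
by case: s => [[] []]; oedges; rewrite /motion /rotp /dadd /=; osolve.
Qed.

Lemma motion_origin d (q : int * int) : motion d q origin = (q, d).
Proof.
case: q => u v; rewrite /motion /rotp /= !mul0r subr0 !add0r.
by case: d => [[] []].
Qed.

Section Substitution.
Variables (sigma : symbol -> seq symbol) (sigma_folding : folding_rule sigma)
  (sigma_filling : plane_filling sigma).

Definition base_path : seq oedge := trace origin (sigma A).
Definition base_end : int * int := tip (last origin base_path).
(* A path whose first letter is B starts at an odd vertex. *)
Definition shift : int * int := if is_A (head B (sigma A)) then (0, 0) else (1, 0).
Definition dilate (p : int * int) : int * int :=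
  ((cmul base_end p).1 + shift.1, (cmul base_end p).2 + shift.2).
(** With the heading of [g], the path runs from [dilate] of the base to [dilate] of the tip. An edge
    with odd base gets the path of its reversal run backwards, which is the drawing of [sigma B]. *)
Definition sub_edge (g : oedge) : seq oedge :=
  if even_vertex g.1 then trace (dilate g.1, g.2) (sigma A)
  else rev (map erev (trace (dilate (tip g), opp g.2) (sigma A))).

Lemma folding_A : folding_word (sigma A). Proof. by case: sigma_folding. Qed.

Lemma base_pathE : exists X, base_path = origin :: X /\ path esucc origin X.
Proof. by have [X [e p _]] := folding_trace folding_A origin; exists X. Qed.

Lemma trace_dilate p d :
  trace (dilate p, d) (sigma A) = map (motion d (dilate p)) base_path.
Proof.
by rewrite -trace_motion motion_origin.
Qed.

Lemma sub_edge_even g : even_vertex g.1 ->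
  sub_edge g = map (motion g.2 (dilate g.1)) base_path.
Proof. by move=> h; rewrite /sub_edge h trace_dilate. Qed.

Lemma sub_edge_rev g : sub_edge (erev g) = rev (map erev (sub_edge g)).
Proof.
rewrite /sub_edge [even_vertex (erev g).1]tip_parity.
have e : (dilate (tip (erev g)), opp (erev g).2) = (dilate g.1, g.2).
  by congr (dilate _, _); [exact: (congr1 fst (erevK g)) | exact: (congr1 snd (erevK g))].
case: (even_vertex g.1) => /=; first by rewrite e.
by rewrite map_rev revK (mapK erevK).
Qed.

Lemma tip_motion s b x : tip (motion s b x) =
  ((rotp s (tip x)).1 + b.1, (rotp s (tip x)).2 + b.2).
Proof. by case: s => [[] []]; oedges; rewrite /motion /rotp /dadd /=; osolve. Qed.

Lemma dilate_tip g : dilate (tip g) =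
  ((rotp g.2 base_end).1 + (dilate g.1).1, (rotp g.2 base_end).2 + (dilate g.1).2).
Proof.
rewrite /dilate /rotp /tip /cmul /=; congr pair; ring.
Qed.

Lemma efirst_even g : even_vertex g.1 -> efirst sub_edge g = (dilate g.1, g.2).
Proof.
move=> h; rewrite /efirst sub_edge_even //; have [X [-> _]] := base_pathE.
by rewrite [head _ _]/= motion_origin.
Qed.

Lemma elast_even g : even_vertex g.1 ->
  elast sub_edge g = motion g.2 (dilate g.1) (last origin base_path).
Proof.
move=> h; rewrite /elast sub_edge_even //; have [X [-> _]] := base_pathE.
by rewrite /= last_map.
Qed.

(** If [g] has an even base, [g] and [erev (enext g)] are even edges with a common tip, and their
    paths are quarter-turn rotations of each other about its image. If the base is odd, the same
    holds for [erev g] and [enext g] with a common base. *)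
Lemma sub_edge_next g : efirst sub_edge (enext g) = enext (elast sub_edge g).
Proof.
have Frev h : efirst sub_edge (erev h) = erev (elast sub_edge h).
  rewrite /efirst /elast sub_edge_rev.
  have : sub_edge h != [::].
    rewrite /sub_edge; have [X [e _]] := base_pathE.
    by rewrite !trace_dilate e; case: ifP => //= _; rewrite rev_cons; case: (rev _).
  case/lastP: (sub_edge h) => // Y y _.
  by rewrite map_rcons rev_rcons last_rcons.
have Lrev h : elast sub_edge (erev h) = erev (efirst sub_edge h).
  by rewrite -[h in RHS]erevK Frev erevK.
case: (boolP (even_vertex g.1)) => hg.
  have hn : even_vertex (erev (enext g)).1 by rewrite tip_parity tip_parity negbK.
  rewrite -[enext g]erevK Frev !elast_even //; set l := last _ _.
  rewrite [LHS]/erev [RHS]/enext; apply: pairE.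
    rewrite !tip_motion -[tip l]/base_end -!dilate_tip; congr dilate.
    exact: (congr1 fst (erevK (enext g))).
  have turns (d e : dir) : opp (dadd (opp (rotl d)) e) = rotl (dadd d e).
    by case: d e => [[] []] [[] []].
  exact: turns.
have hr : even_vertex (erev g).1 by rewrite tip_parity.
rewrite -[g in RHS]erevK Lrev (efirst_even hr) enext_rev efirst_even ?tip_parity //.
have turns (d : dir) : rotl d = rotr (opp d) by case: d => [[] []].
by apply: pairE => //; exact: turns.
Qed.

Lemma equivariant_sub_edge : equivariant sub_edge.
Proof.
move=> s b hb.
(* The translation is dilated, and the last term compensates for the rotation of [shift] by [s]. *)
pose b' : int * int := ((cmul base_end b).1 + (shift.1 - (rotp s shift).1),
  (cmul base_end b).2 + (shift.2 - (rotp s shift).2)).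
exists s, b'; split.
  have := even_cmul base_end hb; rewrite /b' /even_vertex; case: (cmul _ _) => u v /=.
  rewrite /shift; case: ifP => _; case: s {b'} => [[] []]; rewrite /rotp /dx /dy /=; lia.
have ev g : even_vertex (motion s b g).1 = even_vertex g.1.
  move: hb; case: g b {b'} => [[x y] d] [b1 b2]; rewrite /even_vertex /motion /rotp /=.
  by case: s => [[] []]; rewrite /dx /dy /=; lia.
have even_case g : even_vertex g.1 -> sub_edge (motion s b g) = map (motion s b') (sub_edge g).
  move=> hg; rewrite !sub_edge_even ?ev // -!trace_dilate -trace_motion; congr trace.
  rewrite [RHS]/motion; apply: pairE => //=.
  by rewrite /b' /dilate /motion /rotp /cmul /=; congr pair; ring.
move=> g; case: (boolP (even_vertex g.1)) => hg; first exact: even_case.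
have mrev h : motion s b (erev h) = erev (motion s b h) by exact: motion_rev.
rewrite -[g]erevK mrev sub_edge_rev even_case ?tip_parity // [in RHS]sub_edge_rev.
rewrite [RHS]map_rev -!map_comp; congr (rev _); apply: eq_map => h /=.
by rewrite motion_rev.
Qed.
End Substitution.

(** * The tiling obtained from the plane-filling hypothesis *)

Definition uedge (x : oedge) : (int * int) * (int * int) :=
  if even_vertex x.1 then (x.1, tip x) else (tip x, x.1).

Lemma oedge_eq (x y : oedge) : x.1 = y.1 -> tip x = tip y -> x = y.
Proof.
case: x y => [[a b] d] [[a' b'] d'] /= [<- <-] [h1 h2]; congr pair.
by move: h1 h2; case: d d' => [[] []] [[] []]; rewrite /dx /dy /=; lia || by [].
Qed.

Lemma uedgeP (x y : oedge) : ((y.1, tip y) = uedge x \/ (tip y, y.1) = uedge x) <->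
  (y = x \/ y = erev x).
Proof.
have e z : tip (erev z) = z.1 by exact: (congr1 fst (erevK z)).
rewrite /uedge; split.
  case: ifP => _ -[] h; have h1 := congr1 fst h; have h2 := congr1 snd h;
    rewrite [LHS]/= [RHS]/= in h1; rewrite [LHS]/= [RHS]/= in h2;
    [left|right|right|left]; apply: oedge_eq; by rewrite ?e.
by case=> ->; rewrite /= ?e; case: ifP => _; auto.
Qed.

Lemma grid_uedge x : grid_edge (uedge x).
Proof.
rewrite /grid_edge /uedge; have := tip_parity x; case: ifP => /= hx ht; rewrite ?ht ?hx /=.
all: clear hx ht; oedges; rewrite /tip /dx /dy /=; lia.
Qed.

Lemma grid_edgeP e : grid_edge e ->
  exists g : oedge, even_vertex g.1 /\ e = (g.1, tip g).
Proof.
case: e => [[a b] [a' b']] /and3P[/= h1 _ h2].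
have [d hd] : exists d, a' = a + dx d /\ b' = b + dy d.
  have [h|[h|[h|h]]] : (a' = a + 1 /\ b' = b) \/ (a' = a - 1 /\ b' = b) \/
    (a' = a /\ b' = b + 1) \/ (a' = a /\ b' = b - 1) by lia.
  - by exists (false, false); rewrite /dx /dy /=; lia.
  - by exists (false, true); rewrite /dx /dy /=; lia.
  - by exists (true, false); rewrite /dx /dy /=; lia.
  - by exists (true, true); rewrite /dx /dy /=; lia.
by exists ((a, b), d); split=> //; rewrite /tip /=; case: hd => -> ->.
Qed.

Lemma path_vertices x X k : path esucc x X -> (k < size (x :: X))%N ->
  nth (0, 0) (x.1 :: map tip (x :: X)) k = (nth origin (x :: X) k).1.
Proof.
elim: X x k => [|y X IH] x [|k] //= /andP[/esucc_tip h hp] hk.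
by rewrite -h; exact: IH.
Qed.

Section Filling.
Variables (sigma : symbol -> seq symbol) (sigma_folding : folding_rule sigma)
  (sigma_filling : plane_filling sigma).
Local Notation P := (sub_edge sigma).
Local Notation N := (size (base_path sigma)).

Lemma size_sub_edge g : size (P g) = N.
Proof.
by rewrite /sub_edge; case: ifP => _; rewrite ?size_rev ?size_map !trace_dilate size_map.
Qed.

Lemma size_base_path : (2 <= N)%N.
Proof. by rewrite size_trace; case: sigma_filling. Qed.

Lemma draw_base : draw 0 (east int) (sigma A) = (0, 0) :: map tip (base_path sigma).
Proof.
rewrite /draw; congr cons.
by apply: (@draw_trace int id (fun d => (dx d, dy d)) _ _ _ origin) => // -[[] []].
Qed.

Lemma endpoint_base : endpoint 0 (east int) (sigma A) = base_end sigma.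
Proof.
have := draw_base; rewrite /draw /endpoint => -[->].
have [X [e _]] := base_pathE sigma_folding; rewrite /base_end e.
by rewrite /= last_map.
Qed.

Lemma traversesP g k x : even_vertex g.1 ->
  traverses (path_copy (base_end sigma) (draw 0 (east int) (sigma A)) (g.1, tip g)) k (uedge x)
  <-> (k < N)%N /\
      let y := motion g.2 (cmul (base_end sigma) g.1) (nth origin (base_path sigma) k) in
      (y = x \/ y = erev x).
Proof.
move=> hg; rewrite draw_base /traverses /path_copy size_map [size (_ :: _)]/= size_map ltnS.
set F := fun z : int * int => _; set V := (_ :: _).
have nm j : (j <= N)%N -> nth 0 (map F V) j = F (nth 0 V j).
  by move=> hj; rewrite (nth_map 0) //= size_map ltnS.
have [hk|hk] := ltnP k N; last by split=> -[].
rewrite -uedgeP; set m := motion _ _.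
have phi (u z : int * int) (q : oedge) : u + cmul (tip q - q.1) z =
    ((rotp q.2 z).1 + u.1, (rotp q.2 z).2 + u.2).
  case: u z q => [u v] [z1 z2] [[a b] d]; rewrite /cmul /tip /rotp /=.
  by apply: pairE => /=; ring.
rewrite !nm //; last exact: ltnW.
rewrite /F !phi.
have [X [e hp]] := base_pathE sigma_folding.
have -> : nth 0 V k = (nth origin (base_path sigma) k).1.
  by rewrite /V e; apply: (@path_vertices origin X k hp); rewrite -e.
have -> : nth 0 V k.+1 = tip (nth origin (base_path sigma) k).
  by rewrite [LHS]/= (nth_map origin).
by rewrite -tip_motion; split=> [[_ //]|//].
Qed.

Definition translate (b : int * int) (x : oedge) : oedge :=
  ((x.1.1 + b.1, x.1.2 + b.2), x.2).

Lemma translate_rev b x : translate b (erev x) = erev (translate b x).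
Proof. by oedges; rewrite /translate /=; osolve. Qed.
Lemma translateK b : cancel (translate (- b.1, - b.2)) (translate b).
Proof. by move=> [[u v] d]; rewrite /translate /= !subrK. Qed.

Lemma sub_edge_nth g k : even_vertex g.1 -> (k < N)%N -> nth origin (P g) k =
  translate (shift sigma) (motion g.2 (cmul (base_end sigma) g.1) (nth origin (base_path sigma) k)).
Proof.
move=> hg hk; rewrite sub_edge_even // (nth_map origin) //.
by rewrite /motion /translate /dilate /= !addrA.
Qed.

Lemma sub_edge_unique x : exists! gk : oedge * nat, [/\ even_vertex gk.1.1, (gk.2 < N)%N
  & nth origin (P gk.1) gk.2 = x \/ nth origin (P gk.1) gk.2 = erev x].
Proof.
(* The copies in the hypothesis start at [c u]; they are the paths of [sub_edge] moved back by
   [shift]. *)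
pose b := shift sigma; pose x' := translate (- b.1, - b.2) x.
have key g k : even_vertex g.1 -> (k < N)%N ->
    (nth origin (P g) k = x \/ nth origin (P g) k = erev x) <->
    traverses (path_copy (base_end sigma) (draw 0 (east int) (sigma A)) (g.1, tip g)) k (uedge x').
  move=> hg hk; rewrite traversesP // sub_edge_nth //=.
  set y := motion _ _ _; have e z : translate (shift sigma) y = z <-> y = translate (- b.1, - b.2) z.
    split=> [<-|->]; last by rewrite translateK.
    by case: (y) => [[u v] d]; rewrite /translate /= !addrK.
  by rewrite !e translate_rev; split=> [|[]//].
case: sigma_filling => _ /(_ 1%N isT); rewrite /= /subst_iter /= cats0 endpoint_base.
move=> /(_ _ (grid_uedge x')) [[f k] [[/= gf tr] un]].
have [g [hg ef]] := grid_edgeP gf; rewrite ef in tr.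
have hk : (k < N)%N by move: tr => /(traversesP _ _ hg) [].
exists (g, k); split=> /=; first by split=> //; apply/key.
move=> [h l] /= [hh hl nx]; have := un ((h.1, tip h), l).
have gh : grid_edge (h.1, tip h).
  by have := grid_uedge h; rewrite /uedge hh.
move=> /(_ (conj gh (iffLR (key _ _ hh hl) nx))); rewrite ef => e.
have -> : l = k by exact: (esym (congr1 snd e)).
congr pair; apply: oedge_eq; first exact: (congr1 (fun z => z.1.1) e).
exact: (congr1 (fun z => z.1.2) e).
Qed.

Lemma sub_edge_rev_mem x g : (x \in P (erev g)) = (erev x \in P g).
Proof.
rewrite (sub_edge_rev sigma) mem_rev -[in LHS](erevK x) mem_map //; exact: erev_inj.
Qed.

Lemma sub_edge_at x g : x \in P g -> exists2 hk : oedge * nat,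
  [/\ even_vertex hk.1.1, (hk.2 < N)%N
    & nth origin (P hk.1) hk.2 = x \/ nth origin (P hk.1) hk.2 = erev x] &
  (hk.1 = g /\ nth origin (P hk.1) hk.2 = x) \/
  (hk.1 = erev g /\ nth origin (P hk.1) hk.2 = erev x).
Proof.
move=> xg; case: (boolP (even_vertex g.1)) => hg.
  exists (g, index x (P g)) => /=; rewrite nth_index //; last by left.
  by split=> //; [rewrite -(size_sub_edge g) index_mem | left].
have xr : erev x \in P (erev g) by rewrite sub_edge_rev_mem erevK.
exists (erev g, index (erev x) (P (erev g))) => /=; rewrite nth_index //; last by right.
by split=> //; [rewrite tip_parity | rewrite -(size_sub_edge (erev g)) index_mem | right].
Qed.

Lemma tiling_sub_edge : tiling P.
Proof.
have [X [eX hX]] := base_pathE sigma_folding.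
have even_path p d : sorted esucc (map (motion d p) (base_path sigma)).
  rewrite -trace_motion; have [Y [-> hY _]] := folding_trace (folding_A sigma_folding) (motion d p origin).
  by [].
have unx x g h k l : [/\ even_vertex g.1, (k < N)%N & nth origin (P g) k = x \/ nth origin (P g) k = erev x] ->
   [/\ even_vertex h.1, (l < N)%N & nth origin (P h) l = x \/ nth origin (P h) l = erev x] ->
   g = h /\ k = l.
  move=> h1 h2; have [gk [_ un]] := sub_edge_unique x.
  by have := un (g, k) h1; have := un (h, l) h2; move=> -> [-> ->].
split.
- by move=> g; rewrite -size_eq0 size_sub_edge -lt0n (leq_trans _ size_base_path).
- have ev g : even_vertex g.1 -> sorted esucc (P g) by move=> hg; rewrite sub_edge_even.
  move=> g; case: (boolP (even_vertex g.1)) => hg; first exact: ev.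
  rewrite -[g]erevK sub_edge_rev rev_sorted sorted_map.
  have : sorted esucc (P (erev g)) by apply: ev; rewrite tip_parity.
  by apply: sub_sorted => y z /=; rewrite esucc_rev.
- exact: sub_edge_rev.
- exact: sub_edge_next.
- move=> x; have [[g k] [[/= hg hk nx] _]] := sub_edge_unique x.
  have : nth origin (P g) k \in P g by rewrite mem_nth // size_sub_edge.
  case: nx => ->; first by exists g.
  by exists (erev g); rewrite sub_edge_rev_mem.
- move=> x g h /sub_edge_at[[g1 k] /= hg1 eg] /sub_edge_at[[h1 l] /= hh1 eh].
  have [e1 e2] := unx x _ _ _ _ hg1 hh1; subst h1 l.
  case: eg eh => -[eg ex] [] [eh ex'].
  + by rewrite -eg -eh.
  + by have := erev_neq x; rewrite -ex' ex eqxx.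
  + by have := erev_neq x; rewrite -ex ex' eqxx.
  + by apply: erev_inj; rewrite -eg -eh.
- have ev g : even_vertex g.1 -> uniq (P g).
    move=> hg; apply/(uniqP origin) => i j; rewrite !inE size_sub_edge => hi hj e.
    by have [] := unx (nth origin (P g) i) g g i j (And3 hg hi (or_introl erefl))
      (And3 hg hj (or_introl (esym e))).
  move=> g; case: (boolP (even_vertex g.1)) => hg; first exact: ev.
  rewrite -[g]erevK sub_edge_rev rev_uniq map_inj_uniq; last exact: erev_inj.
  by apply: ev; rewrite tip_parity.
Qed.
End Filling.

(** * Drawing the iterates of sigma *)

Section SubstitutionWords.
Variables (sigma : symbol -> seq symbol) (sigma_folding : folding_rule sigma)
  (sigma_filling : plane_filling sigma).
Local Notation P := (sub_edge sigma).
Local Notation dil := (dilate sigma).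
Let tP : tiling P := tiling_sub_edge sigma_folding sigma_filling.

Lemma efirst_base g : (efirst P g).1 = dil g.1.
Proof.
case: (boolP (even_vertex g.1)) => hg; first by rewrite (efirst_even sigma_folding).
rewrite -[g in LHS]erevK (efirst_rev tP) (elast_even sigma_folding) ?tip_parity //.
transitivity (tip (motion (erev g).2 (dil (erev g).1) (last origin (base_path sigma)))) => //.
rewrite tip_motion -[tip (last _ _)]/(base_end sigma) -dilate_tip; congr dil.
exact: (congr1 fst (erevK g)).
Qed.

Lemma efirst_at x p : x.1 = dil p -> exists d, x = efirst P (p, d).
Proof.
move=> hx; pose g : oedge := (p, (false, false)).
have H i : efirst P (iter i swivel g) = iter i swivel (efirst P g).
  by elim: i => //= i <-; rewrite (efirst_rotl tP).
have B i : (iter i swivel g).1 = p by elim: i.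
have [i hi] : exists i, iter i swivel (efirst P g) = x.
  have := efirst_base g; rewrite -hx; case: (efirst P g) x {hx} => [q e] [r d] /= ->.
  by case: e => [[] []]; case: d => [[] []];
    solve [by exists 0%N | by exists 1%N | by exists 2%N | by exists 3%N].
by exists (iter i swivel g).2; rewrite -hi -H -[in RHS](B i) -surjective_pairing.
Qed.

(** If c = 0, the paths of all east edges with even base start with the same edge. If |c| = 1,
    [dilate] is onto, so the second edge of [P origin] is also the first edge of some path. Either
    way an edge is used twice. *)
Lemma base_norm : 2 <= (base_end sigma).1 ^+ 2 + (base_end sigma).2 ^+ 2.
Proof.
rewrite leNgt; apply/negP => small.
have [c0|c1] : base_end sigma = 0 \/ (base_end sigma).1 ^+ 2 + (base_end sigma).2 ^+ 2 = 1.
  have h1 := sqr_ge0 (base_end sigma).1; have h2 := sqr_ge0 (base_end sigma).2.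
  have [h|h] : (base_end sigma).1 ^+ 2 + (base_end sigma).2 ^+ 2 = 0 \/
    (base_end sigma).1 ^+ 2 + (base_end sigma).2 ^+ 2 = 1 by lia.
    left; move/eqP: h; rewrite paddr_eq0 // !sqrf_eq0 => /andP[/eqP h3 /eqP h4].
    by rewrite [LHS]surjective_pairing h3 h4.
  by right.
- have e q : even_vertex q -> efirst P (q, (false, false)) = (shift sigma, (false, false)).
    move=> hq; rewrite (efirst_even sigma_folding) //= /dilate c0 /cmul /= !mul0r subr0 !add0r.
    by case: (shift sigma).
  have := efirst_in tP ((2, 0), (false, false)); rewrite e // -(e (0, 0)) // => h.
  by have := tiling_disj tP h (efirst_in tP _).
pose h : oedge := nth origin (P origin) 1.
have s2 : (1 < size (P origin))%N by rewrite size_sub_edge; exact: size_base_path.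
pose c := base_end sigma; pose w : int * int := (h.1.1 - (shift sigma).1, h.1.2 - (shift sigma).2).
have hp : h.1 = dil (cmul (c.1, - c.2) w).
  rewrite /dilate /w /c; move: c1; case: (h.1) => x y.
  move: (base_end sigma) (shift sigma) => [u v] [t1 t2]; rewrite /cmul /= => c1.
  apply: pairE.
    transitivity ((u ^+ 2 + v ^+ 2) * (x - t1) + t1); last by ring.
    by rewrite c1 mul1r subrK.
  transitivity ((u ^+ 2 + v ^+ 2) * (y - t2) + t2); last by ring.
  by rewrite c1 mul1r subrK.
have [d hd] := efirst_at hp.
have hin : h \in P origin by exact: mem_nth.
have e := tiling_disj tP hin; rewrite hd in e.
have := e _ (efirst_in tP _) => /esym e0.
have := tiling_uniq tP origin; move: hd; rewrite /h e0 /efirst.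
by case: (P origin) s2 => [|x0 [|x1 X]] //= _ ->; rewrite inE eqxx.
Qed.

Lemma efirst_iterate n g : (efirst (iterate P n) g).1 = iter n dil g.1.
Proof.
elim: n => // n IH; rewrite /= -IH -efirst_base; congr fst.
have tn := tiling_iterate n tP.
rewrite /efirst iterateS; have := tiling_path tn g; have := tiling_neq0 tn g.
by case: (iterate P n g) => // x X _ /(refine_path tP)[_ -> _ _].
Qed.

Lemma elast_iterate n g : tip (elast (iterate P n) g) = iter n dil (tip g).
Proof.
by rewrite -(efirst_iterate n (erev g)) (efirst_rev (tiling_iterate n tP)).
Qed.

Section Words.
Variables (T : symbol -> seq symbol) (Q : oedge -> seq oedge) (tQ : tiling Q).
Hypothesis T_plus : T Plus = [:: Plus].
Hypothesis T_minus : T Minus = [:: Minus].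
Hypothesis T_forward : forall X g, is_forward X -> is_A X = even_vertex g.1 ->
  trace (efirst Q g) (T X) = Q g /\ trace_end (efirst Q g) (T X) = onward (elast Q g).

Lemma efirst_right g : efirst Q (eright g) = eright (elast Q g).
Proof.
have := tiling_next tQ (erev (eright g)); rewrite eright_rev !(efirst_rev tQ) (elast_rev tQ).
move/(congr1 erev); rewrite erevK => ->; move: (efirst Q _) => x.
by rewrite enext_rev; oedges; osolve.
Qed.

(** [T] copies turn symbols, and a turn acts between the last edge of one path and the first edge of
    the next as it does between the two edges refined. *)
Lemma trace_flatten w : folding_word w ->
  forall g, is_A (head B w) = even_vertex g.1 ->
  trace (efirst Q g) (flatten (map T w)) = refine Q (trace g w) /\
  trace_end (efirst Q g) (flatten (map T w)) = onward (elast Q (last g (trace g w))).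
Proof.
move: w; apply: folding_ind => [X fX g hg|X s w fX fs hw fw IH g hg].
  by rewrite /= cats0; have [-> ->] := T_forward fX hg; case: X fX {hg} => //= _; rewrite /refine /= cats0.
have hX : is_A X = even_vertex g.1 by case: X fX hg {hw}.
have [e1 e2] := T_forward fX hX; clear hg.
have [h [hh ht he]] : exists h, [/\ esucc g h, trace g [:: X, s & w] = g :: trace h w
   & efirst Q h = if s is Minus then enext (elast Q g) else eright (elast Q g)].
  case: s fs => // _; [exists (eright g)|exists (enext g)];
    rewrite /esucc eqxx ?orbT; split=> //; try by case: X fX {hw hX e1 e2}.
    exact: efirst_right.
  exact: tiling_next.
have [IH1 IH2] := IH h (etrans hw (etrans (congr1 negb hX) (etrans (esym (tip_parity g)) (congr1 _ (esym (esucc_tip hh)))))).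
have st : T s = [:: s] by case: s fs {ht he}.
rewrite ht [map _ _]/= [flatten _]/= st trace_cat trace_end_cat e1 e2.
have -> : trace (onward (elast Q g)) ([:: s] ++ flatten (map T w)) = trace (efirst Q h) (flatten (map T w)).
  by rewrite he; case: s fs {st ht he}.
have -> : trace_end (onward (elast Q g)) ([:: s] ++ flatten (map T w)) = trace_end (efirst Q h) (flatten (map T w)).
  by rewrite he; case: s fs {st ht he}.
by rewrite IH1 IH2; have [Y [-> _ _]] := folding_trace fw h.
Qed.
End Words.

Lemma subst_rev n X : subst_iter sigma n (tilde X) = rev (map tilde (subst_iter sigma n X)).
Proof.
have [_ eB eP eM] := sigma_folding.
have tildeK : involutive tilde by case.
have e1 Y : sigma (tilde Y) = rev (map tilde (sigma Y)).
  by case: Y; rewrite /= ?eB ?eP ?eM // map_rev revK (mapK tildeK).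
elim: n => // n; rewrite /subst_iter !iterS -!/(subst_iter sigma n _) => ->.
elim: (subst_iter _ _ _) => // x w IH.
rewrite [map tilde _]/= rev_cons -cats1 map_cat flatten_cat IH.
by rewrite [map sigma (x :: w)]/= [flatten (_ :: _)]/= map_cat rev_cat /= cats0 e1.
Qed.

Lemma subst_iterS n X : subst_iter sigma n.+1 X =
  flatten (map (subst_iter sigma n) (sigma X)).
Proof.
elim: n => [|n IH].
  by rewrite /subst_iter /= cats0; elim: (sigma X) => //= x w {1}->.
transitivity (flatten (map sigma (subst_iter sigma n.+1 X))) => //; rewrite IH.
elim: (sigma X) => // x w IHw; rewrite [map (subst_iter _ n) _]/= [flatten (_ :: _)]/=.
by rewrite map_cat flatten_cat IHw.
Qed.

Lemma trace_subst n : forall X g, is_forward X -> is_A X = even_vertex g.1 ->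
  trace (efirst (iterate P n) g) (subst_iter sigma n X) = iterate P n g /\
  trace_end (efirst (iterate P n) g) (subst_iter sigma n X) = onward (elast (iterate P n) g).
Proof.
have tI m := tiling_iterate m tP.
have [_ _ eP eM] := sigma_folding.
have caseB m g : (forall g, even_vertex g.1 ->
   trace (efirst (iterate P m) g) (subst_iter sigma m A) = iterate P m g /\
   trace_end (efirst (iterate P m) g) (subst_iter sigma m A) = onward (elast (iterate P m) g)) ->
   ~~ even_vertex g.1 ->
   trace (efirst (iterate P m) g) (subst_iter sigma m B) = iterate P m g /\
   trace_end (efirst (iterate P m) g) (subst_iter sigma m B) = onward (elast (iterate P m) g).
  move=> HA hg; have [] := HA (erev g); first by rewrite tip_parity.
  have := trace_rev (efirst (iterate P m) (erev g)) (subst_iter sigma m A).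
  move=> + e1 e2; rewrite e1 e2 -(subst_rev m A).
  rewrite -(tiling_rev (tI m)) erevK.
  have -> : backward (onward (elast (iterate P m) (erev g))) = efirst (iterate P m) g.
    by rewrite (elast_rev (tI m)) -[RHS]erevK.
  move=> [-> ->]; split=> //; rewrite (efirst_rev (tI m)).
  by rewrite /backward /erev /onward /=; case: (elast _ _) => [p [[] []]].
elim: n => [|n IH] X g.
  by case: X.
have HA (h : oedge) : even_vertex h.1 ->
   trace (efirst (iterate P n.+1) h) (subst_iter sigma n.+1 A) = iterate P n.+1 h /\
   trace_end (efirst (iterate P n.+1) h) (subst_iter sigma n.+1 A) = onward (elast (iterate P n.+1) h).
  move=> hh; pose k := efirst P h.
  have hk : is_A (head B (sigma A)) = even_vertex k.1.
    rewrite efirst_base /dilate; have := even_cmul (base_end sigma) hh.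
    rewrite /shift /even_vertex; case: (cmul _ _) => u v /=; case: ifP => _ /=; lia.
  have itn m : m = Plus \/ m = Minus -> subst_iter sigma n m = [:: m].
    by case=> ->; elim: n {IH} => // n IHn; rewrite /subst_iter /= -/(subst_iter sigma n _) IHn /= ?eP ?eM.
  have [] := trace_flatten (tI n) (itn _ (or_introl erefl)) (itn _ (or_intror erefl)) IH (folding_A sigma_folding) hk.
  rewrite -subst_iterS.
  have tk : trace k (sigma A) = P h.
    by rewrite /sub_edge hh /k (efirst_even sigma_folding).
  have [Z [e p]] : exists Z, P h = k :: Z /\ path esucc k Z.
    have := tiling_path tP h; have := tiling_neq0 tP h; rewrite /k /efirst.
    by case: (P h) => // x Y _; exists Y.
  have eI : iterate P n.+1 h = refine (iterate P n) (P h).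
    by rewrite -addn1 iterate_add /iterate /= /refine /= cats0.
  have [_ ef el _] := refine_path (tI n) p; rewrite -e -eI in ef el.
  rewrite -[head _ _]/(efirst _ _) in ef; rewrite -[last _ _]/(elast _ _) in el.
  by rewrite tk -eI -ef el e.
by case: X => // _ /= hg; [apply: HA | apply: caseB => //; rewrite -hg].
Qed.
End SubstitutionWords.

(** * The boundary rule as free reduction *)

Lemma backwardK : involutive backward.
Proof. by case=> [p [[] []]]. Qed.

(* A turn rotates the generator at a corner by [enext], at a centre by [swivel];
   the straight letter is two quarter turns away from turning back. *)
Definition pivot (b : bool) (x : option turn) (g : oedge) : oedge :=
  iter (match x with None => 0 | Some Rgt => 1 | Some Str => 2 | Some Lft => 3 end)
    (if b then enext else swivel) g.

(** With v, R, S, L read as 0, 1, 2, 3, the rewriting rule is addition modulo 4. *)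
Lemma pivot_rule b x y g : pivot b (reduce_rule x y) g = pivot b (Some y) (pivot b (Some x) g).
Proof.
have sw h : swivel (swivel (swivel (swivel h))) = h by case: h => [p [[] []]].
by case: b; case: x; case: y; rewrite /pivot /= ?enext4 ?sw.
Qed.

Lemma pivot_swap x g : pivot true (Some (swap_turn x)) (pivot true (Some x) g) = g.
Proof. by case: x; rewrite /pivot /= enext4. Qed.

Lemma pivot_neq x g : pivot true (Some x) g != g.
Proof.
have /andP[] := orbit_uniq g; rewrite !inE !negb_or => /and3P[h1 h2 h3] _.
by case: x; rewrite eq_sym.
Qed.

Lemma pivot_straight g : pivot false (Some Str) g = backward g.
Proof. by case: g => [p [[] []]]. Qed.

(** The half-diagonals run through by a list of turns, alternately outwards and inwards; v produces
    the inverse of the preceding letter. *)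
Fixpoint half_word (b : bool) (g : oedge) (s : seq (option turn)) : seq hletter :=
  (b, g) :: if s is x :: s' then half_word (~~ b) (pivot b x g) s' else [::].

(** At the centre of a square only S and v are allowed. Reduce preserves this, so that the entries
    dropped at the even positions are all S once no v is left. *)
Fixpoint centre_straight (b : bool) (s : seq (option turn)) : bool :=
  if s is x :: s' then
    (b || if x is Some y then (if y is Str then true else false) else true)
      && centre_straight (~~ b) s'
  else true.

Lemma half_word_head b g s : exists W, half_word b g s = (b, g) :: W.
Proof. by case: s => [|x s]; [exists [::] | exists (half_word (~~ b) (pivot b x g) s)]. Qed.

(** Besides homotopy, the clauses on subsequences and last letters are recorded in order to exclude
    a v at which the rewriting is stuck. *)
Definition step_spec (s r : seq (option turn)) : Prop :=
  [/\ r = s \/ (size r).+2 = size s,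
      forall b, centre_straight b s -> centre_straight b r &
      forall b g, [/\ homotopic (half_word b g r) (half_word b g s),
        subseq (half_word b g r) (half_word b g s) &
        forall l, last l (half_word b g r) = last l (half_word b g s)]].

Lemma step_spec_refl s : step_spec s s.
Proof. by split; [left | | move=> b g; split]. Qed.

Lemma reduce_step_spec s : step_spec s (reduce_step s).
Proof.
elim: s => [|[x|] s [IH1 IH2 IH3]]; try exact: step_spec_refl.
have tail : step_spec (Some x :: s) (Some x :: reduce_step s).
  split; first by case: IH1 => [->|/= <-]; [left|right].
    by move=> b /= /andP[-> /IH2].
  move=> b g; have [h1 h2 h3] := IH3 (~~ b) (pivot b (Some x) g); split.
  - by apply: (homotopic_catl [:: (b, g)]).
  - by rewrite /= eqxx.
  - by move=> l /=.
case: s IH1 IH2 IH3 tail => [|[y|] s] _ _ _ tail; [exact: tail | exact: tail | clear tail].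
case: s => [|[y|] s]; try exact: step_spec_refl.
split.
- by right.
- move=> b /= /and4P[h1 _ h3 h4]; rewrite negbK in h3 h4; rewrite h4 andbT.
  by case: b h1 h3 {h4} => //; case: x => //; case: y.
- move=> b g; rewrite /= pivot_rule negbK.
  have e : pivot (~~ b) None (pivot b (Some x) g) = pivot b (Some x) g by [].
  rewrite e; set g1 := pivot b (Some x) g; set W := half_word _ _ s.
  split=> //.
    apply: (homotopic_catl [:: (b, g)]) => t ht /=.
    have := @pushK (b, g1) (act W t); rewrite /linv /= => -> //; exact: act_reduced.
  by rewrite eqxx; exact: (suffix_subseq [:: (~~ b, g1); (b, g1)]).
  by move=> _; rewrite /W; have [V ->] := half_word_head (~~ b) (pivot b (Some y) g1) s.
Qed.

Definition reduct_spec (s r : seq (option turn)) : Prop :=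
  [/\ reduce_step r = r,
      forall b, centre_straight b s -> centre_straight b r,
      odd (size r) = odd (size s) &
      forall b g, [/\ homotopic (half_word b g r) (half_word b g s),
        subseq (half_word b g r) (half_word b g s) &
        forall l, last l (half_word b g r) = last l (half_word b g s)]].

Lemma reduce_spec s : reduct_spec s (reduce s).
Proof.
rewrite /reduce; suff H n : (size s <= n)%N -> reduct_spec s (iter n reduce_step s).
  exact: H.
elim: n s => [|n IH] s.
  by rewrite leqn0 => /eqP/size0nil->; split=> // b g; split.
move=> hs; rewrite iterSr; have [h1 h2 h3] := reduce_step_spec s.
case: h1 => [e|sz].
  have fix_s m : iter m reduce_step s = s by elim: m => //= m ->.
  by rewrite e fix_s; split=> // b g; split.
have [|i1 i2 i3 i4] := IH (reduce_step s); first by rewrite -ltnS -sz in hs; exact: ltnW.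
split=> //; first by move=> b /h2/i2.
  by rewrite i3 -sz /= negbK.
move=> b g; have [j1 j2 j3] := i4 b g; have [k1 k2 k3] := h3 b g; split.
- exact: homotopic_trans j1 k1.
- exact: subseq_trans j2 k2.
- by move=> l; rewrite j3.
Qed.

(** The rewriting stops at a v that is first, last or followed by another v. In the second case the
    word contains the inverse of its last letter, in the third a letter occurs twice. *)
Lemma reduced_list s b g : reduce_step s = s -> uniq (half_word b g s) ->
  (forall r, s <> None :: r) -> linv (last (b, g) (half_word b g s)) \notin half_word b g s ->
  all isSome s.
Proof.
elim: s b g => //= x s IH b g fx /andP[n1 u] hd hl.
case: x fx n1 u hd hl => [x|] fx n1 u hd hl /=; last by case: (hd s).
clear hd.
case: s IH fx n1 u hl => [|[y|] s] IH fx n1 u hl //.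
  apply: (IH (~~ b) (pivot b (Some x) g)) => //; first by case: fx.
  move: hl; rewrite inE negb_or => /andP[_]; apply: contra.
  by have [W ->] := half_word_head (~~ b) (pivot b (Some x) g) (Some y :: s).
exfalso; case: s IH fx n1 u hl => [|[y|] s] IH fx n1 u hl.
- by move: hl; rewrite /= negbK /linv /= !inE eqxx !orbT.
- by move: fx => /(congr1 size) /= h; have := leqnSn (size s); lia.
- have [W e] := half_word_head (~~ b) (pivot b (Some x) g) s.
  by move: u; rewrite /= negbK e !inE eqxx !orbT.
Qed.

Fixpoint bword (g : oedge) (ts : seq turn) : seq hletter :=
  if ts is x :: ts' then let h := pivot true (Some x) g in
    [:: (true, g), (false, h) & bword (backward h) ts'] else [::].
(** The half-diagonal on which the curve would leave its last centre. *)
Fixpoint bend (g : oedge) (ts : seq turn) : oedge :=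
  if ts is x :: ts' then bend (backward (pivot true (Some x) g)) ts' else g.

Lemma bword_cat g u v : bword g (u ++ v) = bword g u ++ bword (bend g u) v.
Proof. by elim: u g => //= x u IH g; rewrite IH. Qed.
Lemma bend_cat g u v : bend g (u ++ v) = bend (bend g u) v.
Proof. by elim: u g => //= x u IH g; rewrite IH. Qed.

Lemma bword_reduced g ts : reduced (bword g ts).
Proof.
rewrite /reduced; elim: ts g => //= x ts IH g.
have h1 : noback (true, g) (false, pivot true (Some x) g).
  by rewrite /noback /linv xpair_eqE /= pivot_neq.
rewrite h1 /=; have := IH (backward (pivot true (Some x) g)).
case: ts {IH} => //= y ts ->; rewrite andbT /noback /linv xpair_eqE /=.
by apply/eqP => e; have := congr1 snd e; case: (pivot true _ g) => [p [[] []]].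
Qed.

Lemma bword_invert g ts :
  bword (backward (bend g ts)) (invert ts) = winv (bword g ts) /\
  bend (backward (bend g ts)) (invert ts) = backward g.
Proof.
elim: ts g => [|x ts IH] g; first by [].
rewrite /invert [map _ _]/= rev_cons -cats1 bword_cat bend_cat.
have [] := IH (backward (pivot true (Some x) g)); rewrite -/(invert ts) /= => -> ->.
rewrite backwardK /= pivot_swap; split=> //.
set h := pivot _ _ _; set W := bword _ _.
by rewrite -[[:: _, _ & W]]/([:: (true, g); (false, h)] ++ W) winv_cat.
Qed.

Lemma half_word_bword g s : all isSome s -> centre_straight true s -> odd (size s) ->
  half_word true g s = bword g (turns (odd_entries s)).
Proof.
have [n] := ubnP (size s); elim: n s g => // n IH [|x [|y s]] g //= hs.
  by case: x.
case: x y hs => [x|] [y|] //= hs /= as1 /andP[] hy cs; rewrite negbK => os.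
case: y hy => // _; rewrite -IH ?pivot_straight //; lia.
Qed.

(** The two conditions on letters missing from [W] exclude a v at the beginning and at the end. *)
Lemma reduce_turns s g W : centre_straight true s -> odd (size s) ->
  half_word true g s = W -> uniq W -> (false, g) \notin W ->
  linv (last (true, g) W) \notin W ->
  let ts := turns (odd_entries (reduce s)) in
  homotopic (bword g ts) W /\ backward (bend g ts) = (last (true, g) W).2.
Proof.
move=> cs os eW uW fW lW; have [r1 r2 r3 /(_ true g)[r4 r5 r6]] := reduce_spec s.
rewrite eW in r4 r5 r6.
have a : all isSome (reduce s).
  apply: (reduced_list r1); first exact: subseq_uniq r5 uW.
    move=> r er; case/negP: fW; apply: (mem_subseq r5); rewrite er /=.
    by have [V ->] := half_word_head false g r; rewrite !inE eqxx orbT.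
  by apply: contra lW; rewrite r6; exact: (mem_subseq r5).
have cr := r2 _ cs; rewrite -r3 in os.
move=> ts; have e := half_word_bword g a cr os; rewrite -/ts in e.
rewrite e in r4 r6; split=> //; rewrite -r6.
have E h u us : backward (bend h (u :: us)) = (last (true, g) (bword h (u :: us))).2.
  elim: us h u => [|v us IHu] h u; first by rewrite /= backwardK.
  exact: (IHu (backward (pivot true (Some u) h)) v).
case: {r4 r6} ts e => [|u us] e; last exact: E.
by have [V h] := half_word_head true g (reduce s); rewrite h in e.
Qed.

Lemma uniq_lside V : uniq V -> uniq (lside V).
Proof.
elim: V => //= x V IH /andP[xV /IH u]; rewrite -/(lside V) u andbT inE xpair_eqE /=.
by rewrite !mem_lside enextK xV.
Qed.

Lemma uniq_winv W : uniq W -> uniq (winv W).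
Proof. by move=> u; rewrite rev_uniq map_inj_uniq //; exact: can_inj linvK. Qed.

(** The R of a move passes from the base of the edge to its tip around the corner on its left. At a
    vertex, a right turn of the path lets the left side go straight on, and a left turn makes it
    turn back. *)
Lemma half_word_right w : folding_word w -> forall g,
  [/\ half_word true g (map right_code w) = lside (trace g w),
      odd (size (map right_code w)) & centre_straight true (map right_code w)].
Proof.
move: w; apply: folding_ind => [[] // _ g|X s w fX fs _ _ IH g]; try by [].
rewrite !size_map; have [e1 e2 e3] := IH (if s is Minus then enext g else eright g).
rewrite size_map in e2.
case: s fs e1 => // _ e1; case: X fX => //= _; rewrite ?e2 ?e3; split=> //.
all: congr [:: _, _ & _]; refine (etrans _ e1); congr half_word.
all: by rewrite pivot_straight; case: g {IH e1} => [[a b] [[] []]].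
Qed.

Lemma half_word_left w : folding_word w -> forall g,
  [/\ half_word true (g.1, rotr g.2) (map left_code w) = winv (lside (rev (map erev (trace g w)))),
      odd (size (map left_code w)) & centre_straight true (map left_code w)].
Proof.
have one h : winv (lside [:: erev h]) = [:: (true, (h.1, rotr h.2)); (false, erev h)].
  by rewrite /winv /lside /= enext_rev.
have step h V : winv (lside (rev (map erev (h :: V)))) =
    winv (lside [:: erev h]) ++ winv (lside (rev (map erev V))).
  by rewrite [map _ _]/= rev_cons -cats1 lside_cat winv_cat.
have piv (h : oedge) : pivot true (Some Lft) (h.1, rotr h.2) = erev h.
  by rewrite -enext_rev /pivot /= enext4.
move: w; apply: folding_ind => [X fX g|X s w fX fs _ _ IH g].
  by split; case: X fX => // _; rewrite [trace _ _]/= (one g) /= piv.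
rewrite !size_map; have [e1 e2 e3] := IH (if s is Minus then enext g else eright g).
rewrite size_map in e2.
have -> : trace g [:: X, s & w] = g :: trace (if s is Minus then enext g else eright g) w.
  by case: X fX => // _; case: s fs {e1}.
rewrite step one -e1.
have turns (d : dir) : rotr (rotr d) = opp d /\ rotr (rotl d) = opp (opp d).
  by case: d => [[] []].
case: s fs {e1} => // _; case: X fX => //= _; rewrite ?e2 ?e3 piv; split=> //.
all: congr [:: _, _ & half_word _ _ _].
all: have [t1 t2] := turns g.2.
all: by rewrite ?t1 ?t2 ?pivot_straight.
Qed.

Lemma survive l v w : homotopic w v -> reduced w -> l \in v -> linv l \notin v -> l \in w.
Proof.
move=> h r lv nl; have ew : w = act v [::] by rewrite -h // act_id.
case: l lv nl => b x lv nl.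
have [b' hb] : exists b, (b, x) \in w.
  apply: exponent_mem; rewrite (exponent_homotopic _ h) /exponent.
  have c1 : count_mem (b, x) v != 0%N by rewrite -lt0n -has_count has_pred1.
  have c2 := count_memPn nl; rewrite /linv /= in c2.
  by case: b c1 c2 {lv nl} => /= c1 ->; rewrite ?subr0 ?sub0r ?oppr_eq0.
have : (b', x) \in v by apply: (mem_subseq (act_subseq v)); rewrite -ew.
by case: b lv nl; case: b' hb => // hb lv; rewrite /linv /= => /negbTE->.
Qed.

Lemma subseq_head (T : eqType) (a l : T) w v :
  subseq (a :: w) (l :: v) -> l \in a :: w -> l \notin v -> a = l.
Proof.
rewrite [subseq _ _]/=; case: eqP => // _ /mem_subseq sub hl.
by rewrite sub.
Qed.

Lemma reduce_step_join u x y r :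
  reduce_step (map Some (rcons u x) ++ None :: Some y :: r) = map Some u ++ reduce_rule x y :: r.
Proof.
elim: u => // a u IH; rewrite [map Some (a :: u)]/= [RHS]/= -IH.
by case: u {IH}.
Qed.

Lemma reduce_step_some z : reduce_step (map Some z) = map Some z.
Proof. by elim: z => // a [|b z] //= ->. Qed.

(* The reduction around [v] stops inside both words, or exhausts one of them. *)
Lemma reduce_join n u v g h : (size u <= n)%N -> bend g u = backward h ->
  [\/ exists z, [/\ iter n reduce_step (map Some u ++ None :: map Some v) = map Some z,
        homotopic (bword g z) (bword g u ++ bword h v) & bend g z = bend h v],
      exists v', homotopic (bword (backward g) v') (bword g u ++ bword h v) |
      exists u' x, homotopic (bword g (rcons u' x)) (bword g u ++ bword h v) /\
        bend g (rcons u' x) = backward (bend h v)].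
Proof.
elim: n u v g h => [|n IH] u v g h.
  case: u => // _ /= e; apply: Or32; exists v.
  by rewrite -[h]backwardK -e.
case/lastP: u => [_ /= e|u x hs e].
  by apply: Or32; exists v; rewrite -[h]backwardK -e.
case: v => [|y v]; first by apply: Or33; exists u, x; rewrite cats0 e.
rewrite iterSr reduce_step_join.
move: e; rewrite -cats1 bend_cat /= => /(can_inj backwardK) eh.
have hm : homotopic (bword g (u ++ [:: x]) ++ bword h (y :: v))
    (bword g u ++ [:: (true, bend g u); (false, pivot true (Some y) h)] ++
      bword (backward (pivot true (Some y) h)) v).
  rewrite bword_cat -catA; apply: homotopic_catl => s hs' /=; rewrite eh.
  by have := @pushK (true, h) (push (false, pivot true (Some y) h) (act (bword (backward (pivot true (Some y) h)) v) s));
    rewrite /linv /= => -> //; apply/push_reduced/act_reduced.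
have er := pivot_rule true x y (bend g u); rewrite eh in er.
case E : (reduce_rule x y) er => [z|] er.
  apply: Or31; exists (u ++ z :: v); split.
  - by rewrite map_cat /= -map_cons -map_cat; elim: n {IH hs} => //= n ->; exact: reduce_step_some.
  - apply: homotopic_trans (homotopic_sym hm); rewrite bword_cat /= er.
    exact: homotopic_refl.
  - by rewrite bend_cat /= er.
rewrite size_rcons in hs.
have e2 : bend g u = backward (backward (pivot true (Some y) h)) by rewrite backwardK -er.
have hm2 : homotopic (bword g u ++ bword (backward (pivot true (Some y) h)) v)
    (bword g (u ++ [:: x]) ++ bword h (y :: v)).
  apply: homotopic_sym; apply: homotopic_trans hm _; apply: homotopic_catl => s hs' /=.
  rewrite -er; have := @pushK (false, bend g u) (act (bword (backward (bend g u)) v) s).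
  by rewrite /linv /= => -> //; exact: act_reduced.
case: (IH u v g _ hs e2) => [[z [h1 h2 h3]]|[v' h1]|[u' [x' [h1 h2]]]].
- by apply: Or31; exists z; split=> //; exact: homotopic_trans h2 hm2.
- by apply: Or32; exists v'; exact: homotopic_trans h1 hm2.
- by apply: Or33; exists u', x'; split=> //; exact: homotopic_trans h1 hm2.
Qed.

(** [h] is the half-diagonal of arrival at the last centre, while [bend] points onwards out of it;
    hence [backward]. *)
Definition arc (g : oedge) (ts : seq turn) (h : oedge) (W : seq hletter) : Prop :=
  homotopic (bword g ts) W /\ bend g ts = backward h.

Lemma arc_invert g ts h W : arc g ts h W -> arc h (invert ts) g (winv W).
Proof.
move=> [h1 h2]; have [] := bword_invert g ts; rewrite h2 backwardK => e1 e2.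
by split=> //; rewrite e1; exact: homotopic_inv.
Qed.

Lemma invertK : involutive invert.
Proof.
move=> ts; rewrite /invert map_rev revK mapK //; by case.
Qed.

Lemma last_lside l V : V != [::] -> last l (lside V) = (false, enext (last origin V)).
Proof.
by case/lastP: V => // V x _; rewrite last_rcons -cats1 lside_cat last_cat.
Qed.

Section BoundaryRule.
Variables (sigma : symbol -> seq symbol) (sigma_folding : folding_rule sigma)
  (sigma_filling : plane_filling sigma).
Local Notation P := (sub_edge sigma).
Local Notation wA := (sigma A).
Let tP : tiling P := tiling_sub_edge sigma_folding sigma_filling.

Lemma eprev_neq (x : oedge) : eprev x != x.
Proof.
have /andP[] := orbit_uniq x; rewrite !inE !negb_or => /and3P[_ _ h] _.
by rewrite eprev_next3 eq_sym.
Qed.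
Lemma enext_neq (x : oedge) : enext x != x.
Proof. by rewrite -{2}[x]enextK eq_sym eprev_neq. Qed.

Lemma notin_tiling x g h : x \in P g -> h != g -> x \notin P h.
Proof. by move=> xg; apply: contra => xh; rewrite (tiling_disj tP xg xh). Qed.

Definition rule_R (b : bool) : seq turn := if b then turns_R wA else turns_r wA.
Definition rule_L (b : bool) : seq turn := if b then turns_L wA else turns_l wA.
Definition rule_S (b : bool) : seq turn := if b then turns_S wA else turns_s wA.

Lemma trace_efirst g : even_vertex g.1 -> trace (efirst P g) wA = P g.
Proof. by move=> hg; rewrite /sub_edge hg (efirst_even sigma_folding). Qed.

Lemma arc_turns_R g : even_vertex g.1 ->
  arc (efirst P g) (turns_R wA) (efirst P (enext g)) (lside (P g)).
Proof.
move=> hg; have [e1 e2 e3] := half_word_right (folding_A sigma_folding) (efirst P g).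
rewrite trace_efirst // in e1.
have lst : last (true, efirst P g) (lside (P g)) = (false, efirst P (enext g)).
  by rewrite last_lside ?(tiling_neq0 tP) // (tiling_next tP).
have [] := reduce_turns e3 e2 e1.
- exact/uniq_lside/tiling_uniq.
- rewrite mem_lside (eprev_efirst tP); apply: notin_tiling (elast_in tP _) _.
  by rewrite eq_sym eprev_neq.
- rewrite lst mem_lside; apply: notin_tiling (efirst_in tP _) _.
  by rewrite eq_sym enext_neq.
- by move=> h1 h2; split=> //; rewrite -[LHS]backwardK h2 lst.
Qed.

Lemma arc_turns_L g : even_vertex g.1 ->
  arc (efirst P (enext (erev g))) (turns_L wA) (efirst P (erev g)) (winv (lside (P (erev g)))).
Proof.
move=> hg; have [e1 e2 e3] := half_word_left (folding_A sigma_folding) (efirst P g).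
rewrite trace_efirst // -(tiling_rev tP) in e1.
have ef : ((efirst P g).1, rotr (efirst P g).2) = efirst P (enext (erev g)).
  by rewrite enext_rev (efirst_rotr tP).
rewrite ef in e1.
set h := erev g in e1 *.
have lst : last (true, efirst P (enext h)) (winv (lside (P h))) = (false, efirst P h).
  rewrite /efirst; case: (P h) (tiling_neq0 tP h) => // x X _.
  by rewrite /lside /winv [flatten _]/= [map linv _]/= rev_cons last_rcons.
have [] := reduce_turns e3 e2 e1.
- exact/uniq_winv/uniq_lside/tiling_uniq.
- rewrite mem_winv mem_lside; apply: notin_tiling (efirst_in tP _) _.
  by rewrite eq_sym enext_neq.
- rewrite lst mem_winv linvK mem_lside (eprev_efirst tP); apply: notin_tiling (elast_in tP _) _.
  by rewrite eq_sym eprev_neq.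
- by move=> h1 h2; split=> //; rewrite -[LHS]backwardK h2 lst.
Qed.

Lemma arc_R g : arc (efirst P g) (rule_R (even_vertex g.1)) (efirst P (enext g)) (lside (P g)).
Proof.
rewrite /rule_R; case: ifP => hg; first exact: arc_turns_R.
have := @arc_turns_L (erev g); rewrite tip_parity hg erevK => /(_ isT) /arc_invert.
by rewrite winvK.
Qed.

Lemma arc_L g :
  arc (efirst P g) (rule_L (even_vertex g.1)) (efirst P (eprev g)) (winv (lside (P (eprev g)))).
Proof.
have := arc_invert (arc_R (eprev g)); rewrite eprevK.
have -> : even_vertex (eprev g).1 = ~~ even_vertex g.1 by rewrite tip_parity.
rewrite /rule_R /rule_L /turns_r /turns_l; case: (even_vertex _) => //=.
by rewrite invertK.
Qed.

(** The first and the last letter of the product occur without their inverses and survive. If the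
    reduction exhausted one of the factors, the curve would begin or end on the opposite
    half-diagonal instead. *)
Lemma arc_S g : arc (efirst P g) (rule_S (even_vertex g.1)) (efirst P (enext (enext g)))
  (lside (P g) ++ lside (P (enext g))).
Proof.
have a1 := arc_R g; have := arc_R (enext g); rewrite [even_vertex _.1]tip_parity.
set b := even_vertex g.1 in a1 *; set u := rule_R b in a1; set v := rule_R (~~ b) => a2.
have -> : rule_S b = turns (reduce (map Some u ++ None :: map Some v)).
  by rewrite /rule_S /u /v /rule_R /turns_S /turns_s; case: (b).
case: a1 a2 => h1 e1 [h2 e2].
set L := lside (P g) ++ _; have hL : homotopic (bword (efirst P g) u ++ bword (efirst P (enext g)) v) L.
  exact: homotopic_cat.
have /and5P[] := orbit_uniq g; rewrite !inE !negb_or => /and3P[n1 n2 n3] /andP[m2 m3] k3 _ _.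
have first_in : (true, efirst P g) \in L by rewrite mem_cat mem_lside (efirst_in tP).
have first_not : linv (true, efirst P g) \notin L.
  rewrite mem_cat negb_or !mem_lside (eprev_efirst tP).
  by rewrite !(notin_tiling (elast_in tP _)) // eprev_next3.
have last_in : (false, efirst P (enext (enext g))) \in L.
  by rewrite mem_cat orbC mem_lside (tiling_next tP) enextK (elast_in tP).
have last_not : linv (false, efirst P (enext (enext g))) \notin L.
  rewrite mem_cat negb_or !mem_lside.
  by rewrite !(notin_tiling (efirst_in tP _)).
have uL : uniq L.
  rewrite /L -lside_cat; apply: uniq_lside; rewrite cat_uniq !(tiling_uniq tP) andbT /=.
  by apply/hasP => -[x xn xg]; move: n1; rewrite (tiling_disj tP xn xg) eqxx.
have back_neq x : backward x != x.
  by apply/eqP => /(congr1 snd); case: x => [p [[] []]].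
rewrite /reduce; set s := _ ++ _.
have hs : (size u <= size s)%N by rewrite size_cat size_map leq_addr.
case: (reduce_join v hs e1) => [[z [-> z2 z3]]|[v' hv]|[u' [x [hu eu]]]].
- have -> : turns (map Some z) = z by rewrite /turns; elim: (z) => //= a l ->.
  split; first exact: homotopic_trans z2 hL.
  by rewrite z3.
- have hv' := homotopic_trans hv hL.
  have r := bword_reduced (backward (efirst P g)) v'.
  have fi := survive hv' r first_in first_not.
  have sub : subseq (bword (backward (efirst P g)) v') L.
    by rewrite -(homotopic_eq (homotopic_sym hv') r); exact: act_subseq.
  have [L' eL] : exists L', L = (true, efirst P g) :: L'.
    rewrite /L /efirst; case: (P g) (tiling_neq0 tP g) => // x0 X _.
    by exists ((false, enext x0) :: lside X ++ lside (P (enext g))).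
  move: uL; rewrite eL => /andP[nL _].
  case: v' {hv hv' r} fi sub => [|y v'] //= fi; rewrite eL => sub.
  have := subseq_head sub fi nL; case=> /esym e.
  by have := back_neq (efirst P g); rewrite -e eqxx.
- have hu' := homotopic_trans hu hL.
  have r := bword_reduced (efirst P g) (rcons u' x).
  have la := survive hu' r last_in last_not.
  have sub : subseq (bword (efirst P g) (rcons u' x)) L.
    by rewrite -(homotopic_eq (homotopic_sym hu') r); exact: act_subseq.
  have [L' eL] : exists L', rev L = (false, efirst P (enext (enext g))) :: L'.
    rewrite /L (tiling_next tP) /elast; case/lastP: (P (enext g)) (tiling_neq0 tP (enext g)) => // X x0 _.
    by rewrite last_rcons -cats1 lside_cat catA rev_cat; exists ((true, x0) :: rev (lside (P g) ++ lside X)).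
  have := uL; rewrite -rev_uniq eL => /andP[nL _].
  rewrite -subseq_rev eL -cats1 bword_cat rev_cat in sub.
  rewrite -mem_rev -cats1 bword_cat rev_cat in la.
  have := subseq_head sub la nL; case=> e.
  move: eu; rewrite e2 -cats1 bend_cat /= e backwardK => e3.
  by have := back_neq (efirst P (enext (enext g))); rewrite e3 eqxx.
Qed.
End BoundaryRule.

(** * The boundary rule as an endomorphism of the free group *)

Section BoundaryWords.
Variables (sigma : symbol -> seq symbol) (sigma_folding : folding_rule sigma)
  (sigma_filling : plane_filling sigma).
Local Notation P := (sub_edge sigma).
Local Notation wA := (sigma A).
Local Notation tau := (boundary_rule wA).
Let tP : tiling P := tiling_sub_edge sigma_folding sigma_filling.

(* A potential for [g |-> lside (P g)], rooted at the east edge of each face. *)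
Definition psi (g : oedge) : seq hletter :=
  match g.2 with
  | (false, false) => [::]
  | (true, true) => lside (P g)
  | (false, true) => lside (P g) ++ lside (P (enext g))
  | (true, false) => lside (P g) ++ lside (P (enext g)) ++ lside (P (enext (enext g)))
  end.

(** The left sides of the four paths around a face multiply to the identity. This is needed for the
    east edge only, which closes the cycle. *)
Lemma psi_next g : homotopic (lside (P g)) (psi g ++ winv (psi (enext g))).
Proof.
have cancel U V : homotopic U ((U ++ V) ++ winv V).
  rewrite -[X in homotopic X _]cats0 -catA; apply: homotopic_catl.
  exact/homotopic_sym/homotopic_winvr.
case: g => [p [[] []]]; rewrite /psi /=.
- by rewrite cats0; exact: homotopic_refl.
- exact: cancel.
- exact: cancel.
- have := lside_face_loop tP (p, (false, false)); rewrite /face_loop !lside_cat => h.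
  set U := lside _; set V := _ ++ _.
  have c := cancel U V; apply: (homotopic_trans c).
  exact: (homotopic_catr _ h).
Qed.

(** The endomorphism that sends the generator of [g] to [psi g]. On left sides of paths it acts as
    [refine P]. *)
Definition psi_word (w : seq hletter) : seq hletter :=
  flatten [seq if l.1 then psi l.2 else winv (psi l.2) | l <- w].

Lemma psi_word_cat u v : psi_word (u ++ v) = psi_word u ++ psi_word v.
Proof. by rewrite /psi_word map_cat flatten_cat. Qed.
Lemma psi_word_inv w : psi_word (winv w) = winv (psi_word w).
Proof.
elim: w => // l w IH; rewrite [winv (l :: w)]/winv [map _ _]/= rev_cons -cats1 psi_word_cat.
rewrite -/(winv w) IH (psi_word_cat [:: l] w) winv_cat; congr cat.
by case: l => [[] x]; rewrite /psi_word /= !cats0 ?winvK.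
Qed.
Lemma psi_word_act w : homotopic (psi_word w) (psi_word (act w [::])).
Proof.
elim: w => // l w IH; rewrite (psi_word_cat [:: l] w).
apply: homotopic_trans (homotopic_catl (psi_word [:: l]) IH) _.
change (act (l :: w) [::]) with (push l (act w [::])); case: (act w [::]) => [|k v]; first by rewrite -psi_word_cat; exact: homotopic_refl.
rewrite [push _ _]/=; case: eqP => [->|_]; last first.
  by rewrite -psi_word_cat; exact: homotopic_refl.
have -> : psi_word [:: l] ++ psi_word (linv l :: v) =
    [::] ++ (psi_word [:: l] ++ winv (psi_word [:: l])) ++ psi_word v.
  by rewrite -psi_word_inv (psi_word_cat [:: linv l] v) catA.
apply: homotopic_drop; exact: homotopic_winvr.
Qed.

Lemma psi_word_homotopic v w : homotopic v w -> homotopic (psi_word v) (psi_word w).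
Proof.
move=> h; apply: homotopic_trans (psi_word_act v) _.
by rewrite h //; apply/homotopic_sym/psi_word_act.
Qed.

Lemma psi_word_lside V : homotopic (psi_word (lside V)) (lside (refine P V)).
Proof.
elim: V => // x V IH; rewrite lside_cons psi_word_cat refine_cons lside_cat.
apply: homotopic_cat IH; rewrite /psi_word /= cats0.
exact/homotopic_sym/psi_next.
Qed.

(** The case of a letter is the parity of the centre at which it starts, and selects the branch of
    tau. *)
Fixpoint cased (g : oedge) (w : seq bletter) : bool :=
  if w is x :: w' then
    (x.1 == even_vertex g.1) && cased (backward (pivot true (Some x.2) g)) w'
  else true.

Definition bturns (w : seq bletter) : seq turn := map snd w.

Lemma cased_cat g u v : cased g (u ++ v) = cased g u && cased (bend g (bturns u)) v.
Proof. by elim: u g => //= x u IH g; rewrite IH andbA. Qed.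

Lemma with_case_turns b ts : bturns (with_case b ts) = ts.
Proof. by elim: ts b => //= -[] ts IH b; rewrite /bturns /= -/(bturns _) IH. Qed.

Lemma with_case_cased g ts : cased g (with_case (even_vertex g.1) ts).
Proof.
elim: ts g => //= x ts IH g.
have e : with_case (even_vertex g.1) (x :: ts) = (even_vertex g.1, x) ::
    with_case (even_vertex (backward (pivot true (Some x) g)).1) ts.
  by case: x => /=; rewrite /pivot /= !tip_parity ?negbK.
by rewrite -/(with_case _ (x :: ts)) e /= eqxx IH.
Qed.

Lemma last_case w : folding_word w -> forall g, is_A (head B w) = even_vertex g.1 ->
  is_A (last B w) = even_vertex (last g (trace g w)).1.
Proof.
move: w; apply: folding_ind => [[] // _ g|X s w fX fs hw fw IH g hg]; try by [].
have {}hg : is_A X = even_vertex g.1 by case: X fX hg {hw}.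
have [h [hh ht]] : exists h, esucc g h /\ trace g [:: X, s & w] = g :: trace h w.
  by case: s fs => // _; [exists (eright g)|exists (enext g)];
    rewrite /esucc eqxx ?orbT; split=> //; case: X fX {hg hw}.
have [Y [e _ _]] := folding_trace fw h.
have := IH h; rewrite hw hg (esucc_tip hh) tip_parity ht e => /(_ erefl) /= <-.
by case: w fw {IH hw ht e}.
Qed.

Lemma first_case g : even_vertex (efirst P g).1 =
  if even_vertex g.1 then is_A (head B wA) else ~~ is_A (last B wA).
Proof.
have ev h : even_vertex h.1 -> even_vertex (efirst P h).1 = is_A (head B wA).
  move=> hh; rewrite (efirst_base sigma_folding sigma_filling) /dilate.
  have := even_cmul (base_end sigma) hh.
  rewrite /shift /even_vertex; case: (cmul _ _) => u v /=; case: ifP => _ /=; lia.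
case: ifP => hg; first exact: ev.
have hr : even_vertex (erev g).1 by rewrite tip_parity hg.
rewrite -[g in LHS]erevK (efirst_rev tP) [LHS]tip_parity; congr negb.
rewrite (last_case (folding_A sigma_folding) (esym (ev _ hr))).
rewrite trace_efirst //; congr even_vertex; congr fst; rewrite /elast.
by case: (P (erev g)) (tiling_neq0 tP (erev g)).
Qed.

Lemma tau_letter g x : bturns (tau (even_vertex g.1, x)) =
    (match x with Rgt => rule_R sigma | Lft => rule_L sigma | Str => rule_S sigma end)
      (even_vertex g.1) /\
  cased (efirst P g) (tau (even_vertex g.1, x)).
Proof.
have fc := first_case g; rewrite /rule_R /rule_L /rule_S.
by case: ifP fc => _ fc; case: x; rewrite /= with_case_turns -fc with_case_cased.
Qed.

(** A letter spells the half-diagonal of [g] outwards and that of the pivoted edge inwards. Its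
    image under tau spells the images of these two under [psi_word]. *)
Lemma arc_tau g x : arc (efirst P g) (bturns (tau (even_vertex g.1, x)))
  (efirst P (pivot true (Some x) g)) (psi g ++ winv (psi (pivot true (Some x) g))).
Proof.
have [-> _] := tau_letter g x; have p := psi_next; case: x.
- have [h1 h2] := arc_L sigma_folding sigma_filling g.
  rewrite /pivot /= -eprev_next3; split=> //; apply: homotopic_trans h1 _.
  have := homotopic_inv (p (eprev g)); rewrite eprevK winv_cat winvK => h.
  exact: h.
- have [h1 h2] := arc_R sigma_folding sigma_filling g.
  by split=> //; exact: homotopic_trans h1 (p g).
- have [h1 h2] := arc_S sigma_folding sigma_filling g.
  split=> //; apply: homotopic_trans h1 _.
  apply: homotopic_trans (homotopic_cat (p g) (p (enext g))) _.
  rewrite -catA; apply: homotopic_catl; rewrite catA -[X in homotopic _ X]cat0s.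
  apply: homotopic_catr; exact: homotopic_winvl.
Qed.

Lemma efirst_backward g : efirst P (backward g) = backward (efirst P g).
Proof.
have e h : backward h = swivel (swivel h) by case: h => [p [[] []]].
by rewrite !e !(efirst_rotl tP).
Qed.

Lemma tau_word w g : cased g w ->
  let w' := flatten (map tau w) in
  [/\ cased (efirst P g) w', bend (efirst P g) (bturns w') = efirst P (bend g (bturns w))
    & homotopic (bword (efirst P g) (bturns w')) (psi_word (bword g (bturns w)))].
Proof.
elim: w g => [|[b x] w IH] g; first by [].
rewrite [cased _ _]/= => /andP[/eqP -> cw].
have [h1 h2] := arc_tau g x; have [_ c1] := tau_letter g x.
have [/= i1 i2 i3] := IH _ cw; rewrite efirst_backward in i1 i2 i3.
rewrite /= cased_cat /bturns map_cat -!/(bturns _) bend_cat bword_cat h2; split=> //.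
  by rewrite c1.
rewrite /psi_word /= -!/(psi_word _).
rewrite catA; exact: homotopic_cat.
Qed.

Lemma boundary_word_iter n g x W : cased g [:: x] ->
  homotopic (bword g [:: x.2]) W ->
  let w := subst_iter tau n x in
  homotopic (bword (efirst (iterate P n) g) (bturns w)) (iter n psi_word W).
Proof.
move=> cx hx /=; suff [] : cased (efirst (iterate P n) g) (subst_iter tau n x) /\
  homotopic (bword (efirst (iterate P n) g) (bturns (subst_iter tau n x))) (iter n psi_word W).
  by [].
elim: n => // n [c1 h1].
have -> : efirst (iterate P n.+1) g = efirst P (efirst (iterate P n) g).
  have tn := tiling_iterate n tP.
  rewrite /efirst iterateS; have := tiling_path tn g; have := tiling_neq0 tn g.
  by case: (iterate P n g) => // y Y _ /(refine_path tP)[_ -> _ _].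
have [t1 _ t3] := tau_word c1; split=> //.
by apply: homotopic_trans t3 _; exact: psi_word_homotopic.
Qed.

Lemma iter_psi_lside n V W : homotopic W (lside V) ->
  homotopic (iter n psi_word W) (lside (iter n (refine P) V)).
Proof.
move=> h; elim: n => // n IH; apply: homotopic_trans (psi_word_homotopic IH) _.
exact: psi_word_lside.
Qed.

Lemma boundary_word_R n : homotopic
  (bword (efirst (iterate P n) origin) (bturns (subst_iter tau n (true, Rgt))))
  (lside (iterate P n origin)).
Proof.
apply: homotopic_trans (iter_psi_lside n (homotopic_refl (lside [:: origin]))).
exact: boundary_word_iter.
Qed.

Lemma boundary_word_L n : homotopic
  (bword (efirst (iterate P n) (enext (erev origin))) (bturns (subst_iter tau n (true, Lft))))
  (winv (lside (iterate P n (erev origin)))).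
Proof.
apply: (homotopic_trans (u := _) (v := iter n psi_word (winv (lside [:: erev origin])))).
  by apply: boundary_word_iter.
have -> U : iter n psi_word (winv U) = winv (iter n psi_word U).
  by elim: n => //= n ->; rewrite psi_word_inv.
by apply: homotopic_inv; apply: iter_psi_lside.
Qed.
End BoundaryWords.

(** * Limits of hierarchies of grid points *)

Section Plane.
Variable R : realType.
Implicit Types x y z : R * R.

Definition nrm (x : R * R) : R := Num.sqrt (x.1 ^+ 2 + x.2 ^+ 2).

Lemma nrm_ge0 x : 0 <= nrm x. Proof. exact: sqrtr_ge0. Qed.
Lemma nrm_sq x : nrm x ^+ 2 = x.1 ^+ 2 + x.2 ^+ 2.
Proof. by rewrite sqr_sqrtr // addr_ge0 ?sqr_ge0. Qed.
Lemma nrm_le x a : 0 <= a -> x.1 ^+ 2 + x.2 ^+ 2 <= a ^+ 2 -> nrm x <= a.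
Proof. by move=> a0 h; rewrite -(@ler_pXn2r _ 2) ?nnegrE ?nrm_ge0 // nrm_sq. Qed.
Lemma nrm_fst x : `|x.1| <= nrm x.
Proof. by rewrite -sqrtr_sqr ler_wsqrtr // lerDl sqr_ge0. Qed.
Lemma nrm_snd x : `|x.2| <= nrm x.
Proof. by rewrite -sqrtr_sqr ler_wsqrtr // lerDr sqr_ge0. Qed.
Lemma nrm_coord x : nrm x <= `|x.1| + `|x.2|.
Proof.
apply: nrm_le; first by rewrite addr_ge0.
rewrite -(real_normK (num_real x.1)) -(real_normK (num_real x.2)) sqrrD.
by rewrite -addrA lerD2l lerDr mulrn_wge0 // mulr_ge0.
Qed.
Lemma nrm_cmul x y : nrm (cmul x y) = nrm x * nrm y.
Proof.
rewrite /nrm -sqrtrM ?addr_ge0 ?sqr_ge0 //; congr Num.sqrt; rewrite /cmul /=; ring.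
Qed.
Lemma nrmN x : nrm (- x) = nrm x.
Proof. by rewrite /nrm /= !sqrrN. Qed.
Lemma nrmD x y : nrm (x + y) <= nrm x + nrm y.
Proof.
apply: nrm_le; first by rewrite addr_ge0 ?nrm_ge0.
rewrite [leRHS]sqrrD !nrm_sq /=.
suff : x.1 * y.1 + x.2 * y.2 <= nrm x * nrm y by lra.
apply: le_trans (ler_norm _) _.
rewrite -(@ler_pXn2r _ 2) ?nnegrE ?mulr_ge0 ?nrm_ge0 // exprMn !nrm_sq real_normK ?num_real //.
have := sqr_ge0 (x.1 * y.2 - x.2 * y.1); nra.
Qed.
Lemma nrmB x y : nrm (x - y) = nrm (y - x).
Proof. by rewrite -nrmN opprB. Qed.
Lemma nrm_triangle y x z : nrm (x - z) <= nrm (x - y) + nrm (y - z).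
Proof. by apply: le_trans (nrmD _ _); rewrite addrA subrK. Qed.
Lemma nrm0 : nrm 0 = 0.
Proof. by rewrite /nrm /= !expr0n /= addr0 sqrtr0. Qed.
Lemma euclidean_distE x y : euclidean_dist x y = nrm (x - y).
Proof. by []. Qed.

Lemma nbhs_nrm x (U : set (R * R)) :
  nbhs x U <-> exists2 e : R, 0 < e & forall y, nrm (y - x) < e -> U y.
Proof.
split=> [/nbhs_ballP[e /= e0 h]|[e e0 h]].
  exists e => // y hy; apply: h; split; rewrite /ball /= distrC.
    exact: le_lt_trans (nrm_fst (y - x)) hy.
  exact: le_lt_trans (nrm_snd (y - x)) hy.
apply/nbhs_ballP; exists (e / 2) => /=; first by rewrite divr_gt0.
move=> y [h1 h2]; apply: h; apply: le_lt_trans (nrm_coord _) _.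
rewrite [e]splitr; apply: ltrD; rewrite distrC; [exact: h1 | exact: h2].
Qed.

Lemma compact_nrm (T : set (R * R)) M :
  closed T -> (forall x, T x -> nrm x <= M) -> compact T.
Proof.
move=> cT bT; apply: (@subclosed_compact _ _ (`[- M, M] `*` `[- M, M])) => //.
  by apply: compact_setX; exact: segment_compact.
move=> x /bT h; split; rewrite /= in_itv /= -ler_norml.
  exact: le_trans (nrm_fst x) h.
exact: le_trans (nrm_snd x) h.
Qed.

Definition emb (p : int * int) : R * R := (p.1%:~R, p.2%:~R).

Lemma emb_cmul p q : emb (cmul p q) = cmul (emb p) (emb q).
Proof. by rewrite /emb /cmul /=; congr pair; rewrite !(intrB, intrD, intrM). Qed.
Lemma nrm_emb p : nrm (emb p) <= (`|p.1| + `|p.2|)%:~R.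
Proof. by apply: le_trans (nrm_coord _) _; rewrite intrD !intr_norm. Qed.

Lemma nested_point (u r : nat -> R) : (forall k, 0 <= r k) ->
  (forall k, `|u k.+1 - u k| <= r k - r k.+1) ->
  exists l, forall k, `|u k - l| <= r k.
Proof.
move=> r0 hu.
have lo i : forall k, u k - r k <= u (k + i)%N - r (k + i)%N.
  elim: i => [|i IH] k; first by rewrite addn0.
  apply: le_trans (IH k) _; rewrite addnS.
  by have := hu (k + i)%N; rewrite ler_norml => /andP[]; lra.
have up i : forall k, u (k + i)%N + r (k + i)%N <= u k + r k.
  elim: i => [|i IH] k; first by rewrite addn0.
  apply: le_trans (IH k); rewrite addnS.
  by have := hu (k + i)%N; rewrite ler_norml => /andP[]; lra.
have cross j k : u j - r j <= u k + r k.
  have h1 := lo k j; have h2 := up j k; have := r0 (j + k)%N.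
  by rewrite [(k + j)%N]addnC in h2; lra.
pose E := [set z | exists k, z = u k - r k].
have sE : has_sup E.
  split; first by exists (u 0%N - r 0%N), 0%N.
  by exists (u 0%N + r 0%N) => _ [k ->].
exists (sup E) => k; rewrite ler_norml; apply/andP; split.
  suff : sup E <= u k + r k by lra.
  by apply: ge_sup; [case: sE | move=> _ [j ->]].
suff : u k - r k <= sup E by lra.
by apply: ub_le_sup; [case: sE | exists k].
Qed.
End Plane.

(** * Limit sets of expanding similarities *)

Section Dilation.
Variables (R : realType) (c t : int * int).
Hypothesis c2 : 2 <= c.1 ^+ 2 + c.2 ^+ 2.
Implicit Types x y z : R * R.

Definition rdil (x : R * R) : R * R := cmul (emb R c) x + emb R t.
Definition lam : R := nrm (emb R c).

Lemma lam_sq : 2 <= lam ^+ 2.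
Proof.
rewrite nrm_sq /emb /= -!rmorphXn /= -rmorphD /=.
by rewrite -[2]/(2%:~R) ler_int.
Qed.
Lemma lam_gt1 : 1 < lam.
Proof. have := lam_sq; have := nrm_ge0 (emb R c); rewrite -/lam; nra. Qed.
Lemma lam_gt0 : 0 < lam. Proof. exact: lt_trans lam_gt1. Qed.
Lemma lamX_gt0 n : 0 < lam ^+ n. Proof. exact: exprn_gt0 lam_gt0. Qed.

Lemma rdilB x y : rdil x - rdil y = cmul (emb R c) (x - y).
Proof.
case: x y => x1 x2 [y1 y2]; rewrite /rdil /cmul /=; apply: pairE => /=; ring.
Qed.
Lemma nrm_rdil n x y : nrm (iter n rdil x - iter n rdil y) = lam ^+ n * nrm (x - y).
Proof.
elim: n => [|n IH]; first by rewrite mul1r.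
by rewrite !iterS rdilB nrm_cmul IH exprS mulrA.
Qed.
Lemma rdil_surj n x : exists y, iter n rdil y = x.
Proof.
elim: n x => [|n IH] x; first by exists x.
have c0 : lam ^+ 2 != 0 by rewrite gt_eqF // (lt_le_trans _ lam_sq).
have [y hy] : exists y, rdil y = x.
  exists (cmul (((emb R c).1) / lam ^+ 2, - (emb R c).2 / lam ^+ 2) (x - emb R t)).
  move: c0; rewrite nrm_sq /rdil; case: (emb R c) => u v; case: x => x1 x2.
  case: (emb R t) => t1 t2; rewrite /cmul /= => c0.
  by apply: pairE => /=; field.
have [z hz] := IH y; exists z; by rewrite iterS hz.
Qed.

Lemma near_down n x y C M : nrm (iter n.+1 rdil x - rdil y) <= C + M ->
  nrm (iter n rdil x - y) <= (C + M) / lam.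
Proof.
by rewrite iterS rdilB nrm_cmul -/lam => h; rewrite ler_pdivlMr ?lam_gt0 // mulrC.
Qed.

Section Limit.
Variables (S : nat -> int * int -> Prop) (C : R).
Hypothesis C0 : 0 <= C.
Hypothesis S_up : forall n p, S n p ->
  exists q, S n.+1 q /\ nrm (emb R q - rdil (emb R p)) <= C.
Hypothesis S_down : forall n q, S n.+1 q ->
  exists p, S n p /\ nrm (emb R q - rdil (emb R p)) <= C.

(** The fixed point of d |-> (C + d) / lam, that is, the sum of the errors C / lam^i over i >= 1. *)
Definition margin : R := C / (lam - 1).
Definition close n (x : R * R) (d : R) : Prop :=
  exists2 p, S n p & nrm (emb R p - iter n rdil x) <= d.
(** The term 1 is slack: by [limit_often], any bound that holds at arbitrarily deep levels yields
    this one at all levels. *)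
Definition limit_set : set (R * R) := [set x | forall n, close n x (margin + 1)].

Lemma margin_ge0 : 0 <= margin.
Proof. by rewrite divr_ge0 // subr_ge0 ltW // lam_gt1. Qed.
Lemma marginE : C + margin = lam * margin.
Proof.
have h : lam - 1 != 0 by rewrite subr_eq0 gt_eqF // lam_gt1.
by rewrite /margin; field.
Qed.

Lemma close_le n x d e : d <= e -> close n x d -> close n x e.
Proof. by move=> de [p hp h]; exists p => //; exact: le_trans h de. Qed.

(** Going up one level adds at most [C] and divides by [lam], which leaves [margin] fixed and
    contracts the excess [M]. *)
Lemma close_down k n x M : close (n + k) x (margin + M) -> close n x (margin + M / lam ^+ k).
Proof.
elim: k n x M => [|k IH] n x M; first by rewrite addn0 divr1.
rewrite -addSnnS => /IH[q qS hq]; have [p [pS hp]] := S_down qS; exists p => //.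
rewrite nrmB; have h : nrm (iter n.+1 rdil x - rdil (emb R p)) <= C + (margin + M / lam ^+ k).
  apply: le_trans (nrm_triangle (emb R q) _ _) _; rewrite addrC; apply: lerD => //.
  by rewrite nrmB.
apply: le_trans (near_down h) _; rewrite addrA marginE exprSr.
have l0 : lam != 0 by rewrite gt_eqF // lam_gt0.
have lk : lam ^+ k != 0 by rewrite gt_eqF // lamX_gt0.
rewrite le_eqVlt; apply/orP; left; apply/eqP; field.
by rewrite l0 lk.
Qed.

Lemma lam_large M : exists k, M <= lam ^+ k.
Proof.
have bern k : 1 + k%:R * (lam - 1) <= lam ^+ k.
  elim: k => [|k IH]; first by rewrite mul0r addr0.
  rewrite exprS -natr1.
  have h1 := lam_gt1; have k0 : 0 <= k%:R :> R by [].
  have := mulr_ge0 k0 (sqr_ge0 (lam - 1)).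
  have := ler_wpM2l (ltW lam_gt0) IH; rewrite expr2; nra.
have h : 0 < lam - 1 by rewrite subr_gt0 lam_gt1.
have [k hk] : exists k : nat, M / (lam - 1) <= k%:R.
  exists (Num.bound `|M / (lam - 1)|); apply: le_trans (ler_norm _) _.
  exact/ltW/archi_boundP.
exists k; apply: le_trans (bern k); rewrite ler_pdivrMr // in hk.
by apply: le_trans hk _; rewrite lerDr.
Qed.

Lemma limit_often x M : (forall n, exists2 m, (n <= m)%N & close m x M) -> limit_set x.
Proof.
move=> h n; have [k hk] := lam_large M.
have [m nm hm] := h (n + k)%N.
have nm' : (n <= m)%N by apply: leq_trans nm; exact: leq_addr.
have km : (k <= m - n)%N by rewrite leq_subRL.
rewrite -(subnKC nm') in hm.
have := @close_down (m - n) n x `|M|; move=> /(_ (close_le _ hm)) H.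
have {}H := H (le_trans (ler_norm M) (ler_wpDl margin_ge0 (lexx _))).
apply: close_le H; rewrite lerD2l ler_pdivrMr ?lamX_gt0 // mul1r.
case: (leP 0 M) => M0; last first.
  case: hm => p _ hp; have := le_trans (nrm_ge0 _) hp; lra.
rewrite ger0_norm //; apply: le_trans hk _.
by rewrite ler_eXn2l ?lam_gt1.
Qed.

(** Successors of [p] chosen level by level and pulled back by the dilations converge geometrically.
    The limit is taken in each coordinate separately, whence the factor 2. *)
Lemma limit_above n p : S n p ->
  exists2 x, limit_set x & nrm (emb R p - iter n rdil x) <= margin *+ 2.
Proof.
move=> hp.
have [f hf] : exists f : nat -> int * int -> int * int, forall m q, S m q ->
    S m.+1 (f m q) /\ nrm (emb R (f m q) - rdil (emb R q)) <= C.
  have [F hF] := @choice (nat * (int * int)) (int * int) (fun mq q' => S mq.1 mq.2 ->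
    S mq.1.+1 q' /\ nrm (emb R q' - rdil (emb R mq.2)) <= C) (fun mq =>
    match pselect (S mq.1 mq.2) with
    | left h => let: ex_intro q hq := S_up h in ex_intro _ q (fun _ => hq)
    | right h => ex_intro _ (0, 0) (fun h' => False_ind _ (h h'))
    end).
  by exists (fun m q => F (m, q)) => m q; exact: (hF (m, q)).
pose q := fix q k := if k is k'.+1 then f (n + k')%N (q k') else p.
have qS k : S (n + k)%N (q k).
  by elim: k => [|k IH]; rewrite ?addn0 // addnS; case: (hf _ _ IH).
have [X hX] := choice (fun k => rdil_surj (n + k) (emb R (q k))).
pose r k : R := margin / lam ^+ (n + k).
have r0 k : 0 <= r k by rewrite divr_ge0 ?margin_ge0 // ltW // lamX_gt0.
have step k : nrm (X k.+1 - X k) <= r k - r k.+1.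
  rewrite -(@ler_pM2l _ (lam ^+ (n + k.+1))) ?lamX_gt0 // -nrm_rdil hX addnS iterS hX.
  have [_ h] := hf _ _ (qS k); apply: le_trans h _.
  have l0 : lam != 0 by rewrite gt_eqF // lam_gt0.
  have lk : lam ^+ (n + k) != 0 by rewrite gt_eqF // lamX_gt0.
  rewrite /r addnS exprS le_eqVlt; apply/orP; left; apply/eqP.
  have := marginE; have -> : lam * lam ^+ (n + k) * (margin / lam ^+ (n + k) -
    margin / (lam * lam ^+ (n + k))) = lam * margin - margin.
    by field; rewrite l0 lk.
  by move=> <-; rewrite addrK.
have [l1 h1] : exists l, forall k, `|(X k).1 - l| <= r k.
  by apply: nested_point => // k; exact: le_trans (nrm_fst (X k.+1 - X k)) (step k).
have [l2 h2] : exists l, forall k, `|(X k).2 - l| <= r k.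
  by apply: nested_point => // k; exact: le_trans (nrm_snd (X k.+1 - X k)) (step k).
have near k : nrm (emb R (q k) - iter (n + k) rdil (l1, l2)) <= margin *+ 2.
  rewrite -hX nrm_rdil.
  have h : nrm (X k - (l1, l2)) <= r k *+ 2.
    by apply: le_trans (nrm_coord _) _; rewrite mulr2n; apply: lerD; [exact: h1 | exact: h2].
  apply: le_trans (ler_wpM2l (ltW (lamX_gt0 _)) h) _.
  by rewrite mulrnAr /r [_ * (margin / _)]mulrC divfK // gt_eqF // lamX_gt0.
exists (l1, l2); last by have := near 0%N; rewrite addn0.
apply: (@limit_often _ (margin *+ 2)) => m; exists (n + m)%N; first exact: leq_addl.
by exists (q m).
Qed.

Lemma limit_closed : closed limit_set.
Proof.
move=> x hx; apply: (@limit_often _ (margin + 2)) => n; exists n => //.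
have [|y [Ty hy]] := hx [set y | nrm (y - x) < (lam ^+ n)^-1].
  by apply/nbhs_nrm; exists (lam ^+ n)^-1 => //; rewrite invr_gt0 lamX_gt0.
have [p pS hp] := Ty n; exists p => //.
apply: le_trans (nrm_triangle (iter n rdil y) _ _) _.
have -> : margin + 2 = (margin + 1) + 1 by ring.
apply: lerD => //; rewrite nrm_rdil; apply: le_trans (ler_wpM2l (ltW (lamX_gt0 n)) (ltW hy)) _.
by rewrite divff // gt_eqF // lamX_gt0.
Qed.

Hypothesis S0 : exists p, S 0 p.
Hypothesis S0_bound : exists M, forall p, S 0 p -> nrm (emb R p) <= M.

Lemma S_nonempty n : exists p, S n p.
Proof.
elim: n => [|n [p /S_up[q [hq _]]]]; first exact: S0.
by exists q.
Qed.

Lemma limit_compact : compact limit_set.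
Proof.
have [M hM] := S0_bound; apply: (@compact_nrm _ _ (M + (margin + 1))); first exact: limit_closed.
move=> x /(_ 0%N)[p pS /= hp]; rewrite -[x]subr0.
apply: le_trans (nrm_triangle (emb R p) _ _) _; rewrite subr0 addrC; apply: lerD; first exact: hM.
by rewrite nrmB.
Qed.

(** At level n each set lies within [K] of the other; pulling back by the n-th dilation divides this
    by [lam ^+ n]. *)
Lemma limit_hausdorff (X : nat -> set (R * R)) (E : R) :
  (forall n y, X n y -> exists2 p, S n p & nrm (iter n rdil y - emb R p) <= E) ->
  (forall n p, S n p -> exists2 y, X n y & iter n rdil y = emb R p) ->
  hausdorff_limit X limit_set.
Proof.
move=> XS SX; split; first exact: limit_compact.
  by have [p /limit_above[x hx _]] := S0; exists x.
have E0 : 0 <= E.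
  have [p /SX[y Xy _]] := S0; have [q _ h] := XS _ _ Xy; exact: le_trans (nrm_ge0 _) h.
pose K := E + margin *+ 2 + 1.
have bound n : (hausdorff_dist (X n) limit_set <= (K / lam ^+ n)%:E)%E.
  rewrite /hausdorff_dist ge_max; apply/andP; split; apply: ge_ereal_sup.
    move=> _ [y Xy <-]; have [p pS hp] := XS n y Xy; have [x Tx hx] := limit_above pS.
    apply: (@le_trans _ _ (euclidean_dist y x)%:E); first by apply: ereal_inf_lbound; exists x.
    rewrite lee_fin euclidean_distE ler_pdivlMr ?lamX_gt0 // mulrC -nrm_rdil.
    apply: le_trans (nrm_triangle (emb R p) _ _) _.
    by apply: le_trans (lerD hp hx) _; rewrite /K lerDl.
  move=> _ [x Tx <-]; have [p pS hp] := Tx n; have [y Xy hy] := SX n p pS.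
  apply: (@le_trans _ _ (euclidean_dist y x)%:E); first by apply: ereal_inf_lbound; exists y.
  rewrite lee_fin euclidean_distE ler_pdivlMr ?lamX_gt0 // mulrC -nrm_rdil hy.
  by apply: le_trans hp _; rewrite /K; have := margin_ge0; lra.
have ge0 n : (0 <= hausdorff_dist (X n) limit_set)%E.
  rewrite /hausdorff_dist le_max; apply/orP; left.
  have [p /SX[y Xy _]] := S_nonempty n.
  apply: (@le_trans _ _ (ereal_inf [set (euclidean_dist y x)%:E | x in limit_set])).
    by apply: le_ereal_inf_tmp => _ [x _ <-]; rewrite lee_fin euclidean_distE nrm_ge0.
  by apply: ereal_sup_ubound; exists y.
apply: (@squeeze_cvge _ _ _ _ (fun=> 0%E) _ (fun n => (K / lam ^+ n)%:E)).
- by near=> n; rewrite ge0 bound.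
- exact: cvg_cst.
- apply: cvg_EFin; first by near=> n.
  apply/cvgrPdist_lt => e e0; have [k hk] := lam_large (K / e + 1); near=> n.
  have lk : K / e < lam ^+ n.
    suff : lam ^+ k <= lam ^+ n by move: hk; lra.
    by rewrite ler_eXn2l ?lam_gt1 //; near: n; exact: nbhs_infty_ge.
  have K0 : 0 <= K by rewrite /K; have := margin_ge0; lra.
  rewrite sub0r normrN /= ger0_norm ?divr_ge0 // ?ltW ?lamX_gt0 //.
  by rewrite ltr_pdivrMr ?lamX_gt0 // mulrC -ltr_pdivrMr.
Unshelve. all: by end_near.
Qed.
End Limit.
End Dilation.

(** * The limit set and its boundary *)

Section Limits.
Variables (R : realType) (sigma : symbol -> seq symbol)
  (sigma_folding : folding_rule sigma) (sigma_filling : plane_filling sigma).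
Local Notation P := (sub_edge sigma).
Local Notation I n := (iterate P n).
Local Notation c := (base_end sigma).
Local Notation f := (rdil (R := R) c (shift sigma)).
Local Notation lam := (lam R c).
Local Notation N := (size (base_path sigma)).
Let tP : tiling P := tiling_sub_edge sigma_folding sigma_filling.
Let tI n : tiling (I n) := tiling_iterate n tP.
Let c2 := base_norm sigma_folding sigma_filling.

Definition covered (n : nat) (p : int * int) : Prop :=
  exists2 x : oedge, covers (I n) origin x & x.1 = p.
Definition bordering (g : oedge) (n : nat) (p : int * int) : Prop :=
  exists2 x : oedge, (x \in I n g) (+) (eprev x \in I n g) & x.1 = p.
(** [N] bounds the distance of an edge of [P g] from the dilated base of [g]. The rest is the
    dilation of 2, a bound for the distance between two corners of a face, as needed in
    [bordering_down]. *)
Definition spread : R := N%:R + lam *+ 2.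

Lemma spread_ge0 : 0 <= spread.
Proof. by rewrite addr_ge0 // mulrn_wge0 // nrm_ge0. Qed.

Lemma emb_dilate p : emb R (dilate sigma p) = f (emb R p).
Proof. by rewrite /rdil -emb_cmul /dilate /emb /= !intrD. Qed.
Lemma emb_iterate n p : emb R (iter n (dilate sigma) p) = iter n f (emb R p).
Proof. by elim: n => // n IH; rewrite !iterS emb_dilate IH. Qed.

Lemma emb_near (p q : int * int) (M : int) :
  `|p.1 - q.1| <= M -> `|p.2 - q.2| <= M -> nrm (emb R p - emb R q) <= (M *+ 2)%:~R.
Proof.
move=> h1 h2; have -> : emb R p - emb R q = emb R (p.1 - q.1, p.2 - q.2).
  by rewrite /emb /= !intrB.
by apply: le_trans (nrm_emb _ _) _; rewrite ler_int mulr2n lerD.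
Qed.

Lemma near_emb (p q : int * int) (M : nat) : nrm (emb R p - emb R q) <= M%:R ->
  `|p.1 - q.1| <= M%:Z /\ `|p.2 - q.2| <= M%:Z.
Proof.
have -> : emb R p - emb R q = emb R (p.1 - q.1, p.2 - q.2) by rewrite /emb /= !intrB.
move=> h; rewrite -!(ler_int R) !intr_norm; split.
  exact: le_trans (nrm_fst (emb R _)) h.
exact: le_trans (nrm_snd (emb R _)) h.
Qed.

Lemma emb_tip (x : oedge) : nrm (emb R (tip x) - emb R x.1) <= 1.
Proof.
have -> : emb R (tip x) - emb R x.1 = emb R (dx x.2, dy x.2).
  by rewrite /emb /= !intrD; congr pair; rewrite addrAC subrr add0r.
apply: le_trans (nrm_emb _ _) _; rewrite -[1]/(1%:~R) ler_int.
by case: x => [p [[] []]].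
Qed.

Lemma path_near x X y : path esucc x X -> y \in x :: X ->
  nrm (emb R y.1 - emb R x.1) <= (size X)%:R.
Proof.
elim: X x => [|z X IH] x /=; first by rewrite inE => _ /eqP->; rewrite subrr nrm0.
case/andP=> /esucc_tip h hp; rewrite inE => /orP[/eqP->|/(IH _ hp) hy].
  by rewrite subrr nrm0.
apply: le_trans (nrm_triangle (emb R z.1) _ _) _; rewrite -natr1.
by apply: lerD => //; rewrite h emb_tip.
Qed.

Lemma sub_edge_near x g : x \in P g -> nrm (emb R x.1 - f (emb R g.1)) <= N%:R.
Proof.
rewrite -emb_dilate -(efirst_base sigma_folding sigma_filling) /efirst.
have := tiling_path tP g; have := size_sub_edge sigma g.
case: (P g) => // y Y <- /= hp /(path_near hp) h; apply: le_trans h _.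
by rewrite ler_nat.
Qed.

Definition reach : R := N%:R / (lam - 1).

Lemma reach_ge0 : 0 <= reach.
Proof. by rewrite divr_ge0 // subr_ge0 ltW // lam_gt1. Qed.

Lemma iterate_near n x g : x \in I n g ->
  nrm (emb R x.1 - iter n f (emb R g.1)) <= reach * lam ^+ n.
Proof.
have l1 : 0 < lam - 1 by rewrite subr_gt0 lam_gt1.
suff : x \in I n g -> nrm (emb R x.1 - iter n f (emb R g.1)) <= reach * (lam ^+ n - 1).
  move=> h /h{}h; apply: le_trans h _; rewrite ler_wpM2l ?reach_ge0 //; lra.
elim: n x => [|n IH] x; first by rewrite inE => /eqP->; rewrite subrr nrm0 expr0 subrr mulr0.
rewrite iterateS => /mem_refine[y /IH hy /sub_edge_near hx].
apply: le_trans (nrm_triangle (f (emb R y.1)) _ _) _.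
rewrite iterS rdilB nrm_cmul.
apply: le_trans (lerD hx (ler_wpM2l (nrm_ge0 _) hy)) _; rewrite -/lam.
have -> : N%:R = reach * (lam - 1) by rewrite /reach divfK // gt_eqF.
rewrite exprS le_eqVlt; apply/orP; left; apply/eqP; ring.
Qed.

Lemma covers_split n x : covers (I n) origin x = (x \in I n origin) || (x \in I n (erev origin)).
Proof. by rewrite /covers (mem_tiling_rev (tI n)). Qed.
Lemma covers_rev Q g x : covers Q g (erev x) = covers Q g x.
Proof. by rewrite /covers erevK orbC. Qed.

Lemma mem_child n x y g : y \in P x -> (y \in I n.+1 g) = (x \in I n g).
Proof.
move=> yx; rewrite iterateS; apply/mem_refine/idP => [[z zg yz]|xg]; last by exists x.
by rewrite (tiling_disj tP yx yz).
Qed.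

Lemma covers_child n x y : y \in P x -> covers (I n.+1) origin y = covers (I n) origin x.
Proof. by move=> yx; rewrite !covers_split !(mem_child _ _ yx). Qed.

Lemma covers_descend k n x y : y \in I k x ->
  covers (I (k + n)) origin y = covers (I n) origin x.
Proof.
elim: k y => [|k IH] y; first by rewrite inE => /eqP->.
by rewrite iterateS => /mem_refine[z /IH <- yz]; rewrite addSn (covers_child _ yz).
Qed.

Lemma efirst_near x : nrm (emb R (efirst P x).1 - f (emb R x.1)) <= spread.
Proof.
by rewrite (efirst_base sigma_folding sigma_filling) emb_dilate subrr nrm0 spread_ge0.
Qed.

Lemma covered_up n p : covered n p ->
  exists q, covered n.+1 q /\ nrm (emb R q - f (emb R p)) <= spread.
Proof.
move=> [x hx <-]; exists (efirst P x).1; split; last exact: efirst_near.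
by exists (efirst P x) => //; rewrite (covers_child _ (efirst_in tP x)).
Qed.

Lemma covered_down n q : covered n.+1 q ->
  exists p, covered n p /\ nrm (emb R q - f (emb R p)) <= spread.
Proof.
move=> [y hy <-]; have [x yx] := tiling_cover tP y.
exists x.1; split; first by exists x => //; rewrite -(covers_child _ yx).
by apply: le_trans (sub_edge_near yx) _; rewrite lerDl mulrn_wge0 // nrm_ge0.
Qed.

Lemma bordering_up g n p : bordering g n p ->
  exists q, bordering g n.+1 q /\ nrm (emb R q - f (emb R p)) <= spread.
Proof.
move=> [x hx <-]; exists (efirst P x).1; split; last exact: efirst_near.
exists (efirst P x) => //; rewrite (mem_child _ _ (efirst_in tP x)).
by rewrite (eprev_efirst tP) (mem_child _ _ (elast_in tP (eprev x))).
Qed.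

(** The parents of [y] and [eprev y] are sides of one face, and exactly one of them lies in the
    tile. Membership therefore changes at some corner of this face, not necessarily at the base of
    the parent of [y]. *)
Lemma bordering_down g n q : bordering g n.+1 q ->
  exists p, bordering g n p /\ nrm (emb R q - f (emb R p)) <= spread.
Proof.
move=> [y hy <-]; have [x yx] := tiling_cover tP y.
have [h hh ph] := tiling_face tP yx (lface_prev y).
rewrite (mem_child _ _ yx) (mem_child _ _ ph) in hy.
have [k hk kx] : exists2 k : oedge, (k \in I n g) (+) (eprev k \in I n g) & lface k = lface x.
  apply: contrapT => no; have st z : lface z = lface x -> (enext z \in I n g) = (z \in I n g).
    move=> hz; apply/esym/eqP; apply: contrapT => /eqP/negP hn; apply: no.
    exists (enext z); rewrite ?lface_next // enextK addbC.
    by move: hn; do 2!case: (_ \in _).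
  have : (h \in I n g) = (x \in I n g).
    by case: (lfaceP (esym hh)) => ->; rewrite // !st ?lface_next.
  by move=> e; rewrite e addbb in hy.
exists k.1; split; first by exists k.
apply: le_trans (nrm_triangle (f (emb R x.1)) _ _) _; apply: lerD; first exact: sub_edge_near.
rewrite rdilB nrm_cmul -mulr_natr ler_wpM2l ?nrm_ge0 //.
have := @emb_near x.1 k.1 1; apply.
  by case: (lfaceP kx) => ->; case: (k) => [[a b] [[] []]]; rewrite /enext /tip /rotl /dx /=; lia.
by case: (lfaceP kx) => ->; case: (k) => [[a b] [[] []]]; rewrite /enext /tip /rotl /dy /=; lia.
Qed.

Definition plane_set : set (R * R) := limit_set c (shift sigma) covered spread.
Definition border_set (g : oedge) : set (R * R) :=
  limit_set c (shift sigma) (bordering g) spread.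

Lemma covers_swivel n x : covers (I n) origin (swivel x) = covers (I n) origin (eprev x).
Proof. by rewrite /eprev covers_rev. Qed.

Lemma bordering_covered g n p : g = origin \/ g = erev origin ->
  bordering g n p -> covered n p.
Proof.
move=> hg [x hx <-]; have sub y : y \in I n g -> covers (I n) origin y.
  by rewrite covers_split; case: hg => -> ->; rewrite ?orbT.
case: (boolP (x \in I n g)) hx => [/sub hx _|_ /= /sub]; first by exists x.
by rewrite -covers_swivel => hx; exists (swivel x).
Qed.

Lemma border_sub g : g = origin \/ g = erev origin -> border_set g `<=` plane_set.
Proof.
by move=> hg x hx n; have [p /(bordering_covered hg) hp h] := hx n; exists p.
Qed.

(** The path of [g] lies along faces over the left face of [g], that of [erev g] along faces over
    its right face. So the edge missing from the first path at this corner is not covered in the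
    opposite orientation either. *)
Lemma border_gap g n p : g = origin \/ g = erev origin -> bordering g n p ->
  exists2 x : oedge, ~~ covers (I n) origin x & x.1 = p.
Proof.
move=> hg [x hx <-].
have cg y : covers (I n) origin y = (y \in I n g) || (y \in I n (erev g)).
  by rewrite covers_split; case: hg => ->; rewrite ?erevK // orbC.
have op y z : y \in I n g -> lface z = lface y -> z \notin I n (erev g).
  move=> yg zy; have [h hh zh] := tiling_face (tI n) yg zy.
  apply/negP => /(tiling_disj (tI n) zh) e; have := rface_neq g.
  by rewrite -hh e eqxx.
case: (boolP (x \in I n g)) hx => /= [hx nx|nx hx].
  exists (swivel x) => //; rewrite covers_swivel cg negb_or nx.
  by apply: op hx _; rewrite lface_prev.
exists x => //; rewrite cg negb_or nx.
by apply: op hx _; rewrite lface_prev.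
Qed.

Lemma nat_above (a : R) : exists M : nat, a <= M%:R.
Proof.
by exists (Num.bound `|a|); apply: le_trans (ler_norm _) _; exact/ltW/archi_boundP.
Qed.

Lemma iter_near n x y r : nrm (iter n f x - iter n f y) <= r * lam ^+ n -> nrm (x - y) <= r.
Proof. by rewrite nrm_rdil mulrC ler_pM2r // lamX_gt0. Qed.

(* Next to a bordering vertex lies an edge [g1] outside the tile. Far enough down,
   [g1] covers a large disc alone, whose centre is then not in [plane_set]. *)
Lemma border_not_interior g x : g = origin \/ g = erev origin ->
  border_set g x -> ~ interior plane_set x.
Proof.
move=> hg hx /nbhs_nrm[e e0 he]; pose r := reach + (margin c spread + 1).
have [n hn] : exists n, r / e + 1 <= lam ^+ n by exact: lam_large.
have [p hp px] := hx n; have [g1 ng1 g1p] := border_gap hg hp.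
have [M hM] := nat_above (margin c spread + 1).
have [j [y [yg hy]]] := interior_vertex tP (equivariant_sub_edge sigma)
  (size_sub_edge sigma) (size_base_path sigma_filling) M g1.
(* The centre of the disc pulled back to level 0: near enough to [x] to lie in the assumed
   neighbourhood. *)
have [w hw] := rdil_surj (shift sigma) c2 (j + n) (emb R y.1).
have wT : plane_set w.
  apply: he; have : nrm (iter n f w - iter n f x) <= r.
    apply: le_trans (nrm_triangle (emb R p) _ _) _; apply: lerD => //.
    by apply: (@iter_near j); rewrite -iterD hw -g1p; exact: iterate_near.
  rewrite nrm_rdil mulrC -ler_pdivlMr ?lamX_gt0 // => h; apply: le_lt_trans h _.
  rewrite ltr_pdivrMr ?lamX_gt0 // mulrC -ltr_pdivrMr //; lra.
have [q [z zq zy] qy] := wT (j + n)%N; rewrite hw -zy in qy.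
have [z1 z2] := near_emb (le_trans qy hM).
have : covers (I n) origin g1.
  have := hy z z1 z2; rewrite /covers => /orP[] hz; first by rewrite -/(covers _ _ _) -(covers_descend n hz).
  by rewrite -/(covers _ _ _) -(covers_descend n hz) covers_rev.
by apply/negP.
Qed.

Lemma plane_boundary x : plane_set x -> ~ interior plane_set x ->
  border_set origin x \/ border_set (erev origin) x.
Proof.
move=> hx nx.
(* [reach + 2] leads from an uncovered edge to the image of [y], 1 from there to that of [x], and
   the rest to a covered vertex. *)
have [M hM] := nat_above (reach + 3 + (margin c spread + 1)).
pose D : R := ((M%:Z) *+ 2)%:~R + (margin c spread + 1).
have key n : close c (shift sigma) (bordering origin) n x D \/
    close c (shift sigma) (bordering (erev origin)) n x D.
  have [y ny hxy] : exists2 y, ~ plane_set y & nrm (y - x) <= (lam ^+ n)^-1.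
    apply: contrapT => no; apply/nx/nbhs_nrm; exists (lam ^+ n)^-1.
      by rewrite invr_gt0 lamX_gt0.
    by move=> y hy; apply: contrapT => ny; apply: no; exists y => //; exact: ltW.
  (* As [y] is outside the limit set, closeness fails at all deep levels even for the larger bound
     2, which allows for rounding to a grid point. *)
  have [k hk] : exists k, forall m, (k <= m)%N -> ~ close c (shift sigma) covered m y 2.
    apply: contrapT => no; apply: ny; apply: (limit_often c2 spread_ge0 covered_down (M := 2)).
    move=> k; apply: contrapT => nk; apply: no; exists k => m km hm; apply: nk.
    by exists m.
  have {}hk := hk (k + n)%N (leq_addr _ _).
  set z := iter (k + n) f y in hk.
  pose v : oedge := ((Num.floor z.1, Num.floor z.2), (false, false)).
  have vz : nrm (emb R v.1 - z) <= 2.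
    have fl (a : R) : `|(Num.floor a)%:~R - a| <= 1.
      by have /andP[] := floor_itv a; rewrite intrD ler_norml; lra.
    apply: le_trans (nrm_coord _) _; rewrite -[2]/(1 + 1); apply: lerD; exact: fl.
  have [h vh] := tiling_cover (tI k) v.
  have nh : ~~ covers (I n) origin h.
    rewrite -(covers_descend n vh); apply/negP => cv; apply: hk.
    by exists v.1 => //; exists v.
  have hy : nrm (iter n f y - emb R h.1) <= reach + 2.
    apply: (@iter_near k); rewrite -iterD -/z.
    apply: le_trans (nrm_triangle (emb R v.1) _ _) _; rewrite nrmB addrC mulrDl.
    apply: lerD; first exact: iterate_near.
    by apply: le_trans vz _; rewrite ler_peMr // exprn_ege1 // ltW // lam_gt1.
  have [p [u cu <-] pu] := hx n.
  have : nrm (emb R h.1 - emb R u.1) <= M%:R.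
    apply: le_trans hM; apply: le_trans (nrm_triangle (iter n f x) _ _) _.
    apply: lerD; last by rewrite nrmB.
    apply: le_trans (nrm_triangle (iter n f y) _ _) _.
    have -> : reach + 3 = (reach + 2) + 1 by ring.
    apply: lerD; first by rewrite nrmB.
    rewrite nrm_rdil; apply: le_trans (ler_wpM2l (ltW (lamX_gt0 _ c2 n)) hxy) _.
    by rewrite divff // gt_eqF // lamX_gt0.
  case/near_emb=> h1 h2.
  have [w [w1 w2]] := frontier (fun z => covers_rev (I n) origin z) h1 h2 cu nh.
  rewrite covers_swivel !covers_split => hw.
  have wx : nrm (emb R w.1 - iter n f x) <= D.
    apply: le_trans (nrm_triangle (emb R u.1) _ _) _; apply: lerD => //.
    exact: emb_near.
  have [hb|hb] : (w \in I n origin) (+) (eprev w \in I n origin) \/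
      (w \in I n (erev origin)) (+) (eprev w \in I n (erev origin)).
    by move: hw; do 4!case: (_ \in _); auto.
  - by left; exists w.1 => //; exists w.
  - by right; exists w.1 => //; exists w.
have often g : (forall n, exists2 m, (n <= m)%N & close c (shift sigma) (bordering g) m x D) ->
    border_set g x.
  exact: (limit_often c2 spread_ge0 (@bordering_down g)).
(* One of the two alternatives of [key] holds at infinitely many levels. *)
case: (pselect (border_set origin x)) => [|no]; [by left | right].
apply/often => n; apply: contrapT => nn; apply/no/often => m; exists (maxn n m); first exact: leq_maxr.
case: (key (maxn n m)) => // h; case: nn; exists (maxn n m) => //; exact: leq_maxl.
Qed.

Lemma boundary_plane_set : boundary plane_set = border_set origin `|` border_set (erev origin).
Proof.
have cl : closed plane_set := limit_closed c2 spread_ge0 covered_down.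
rewrite /boundary -(closure_id _).1 //; apply/seteqP; split=> [x [] | x []].
- exact: plane_boundary.
- by move=> h; split; [apply: border_sub h | apply: border_not_interior h]; left.
- by move=> h; split; [apply: border_sub h | apply: border_not_interior h]; right.
Qed.
End Limits.

(** * The curves *)

Section Polylines.
Variable R : realType.
Implicit Types (p d u v z : R * R).

Definition unit_step u v : bool := nrm (v - u) <= 1.

Lemma polyline_near p V z : path unit_step p V -> polyline (p :: V) z ->
  exists2 v, v \in p :: V & nrm (z - v) <= 1.
Proof.
move=> /(pathP 0) hp [k hk [t /andP[t0 t1] ->]]; exists (nth 0 (p :: V) k).
  by apply: mem_nth; exact: ltnW.
rewrite addrC addKr; have := hp k hk; rewrite /unit_step /=; set u := _ - _ => hu.
apply: le_trans hu; have -> : t *: u = cmul (t, 0) u.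
  by case: (u) => a b; rewrite /cmul /=; apply: pairE; rewrite ?mul0r ?subr0 ?addr0.
by rewrite nrm_cmul ler_piMl ?nrm_ge0 // /nrm /= expr0n addr0 sqrtr_sqr ger0_norm.
Qed.

Lemma mem_polyline (V : seq (R * R)) v : (1 < size V)%N -> v \in V -> polyline V v.
Proof.
move=> V2 vV; have := nth_index 0 vV; have := vV; rewrite -index_mem.
case: (ltnP (index v V).+1 (size V)) => [h _ e|].
  by exists (index v V) => //; exists 0; rewrite ?lexx ?ler01 // scale0r addr0 e.
case: (index v V) => [|k] h1 h2 e; first by rewrite leqNgt V2 in h1.
by exists k => //; exists 1; rewrite ?lexx ?ler01 // scale1r addrCA subrr addr0 e.
Qed.

Lemma turn_nrm x d : nrm (turn_dir x d) = nrm d.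
Proof. by case: x; rewrite /nrm //= sqrrN addrC. Qed.

Lemma draw_unit p d w : nrm d <= 1 -> path unit_step p (draw_from p d w).
Proof.
elim: w p d => [|x w IH] p d //= hd.
by case: x; rewrite /= ?IH // ?[nrm (turn_left _)](turn_nrm Lft)
  ?[nrm (turn_right _)](turn_nrm Rgt) // andbT /unit_step addrC addKr.
Qed.

Lemma bdraw_unit p d w : nrm d <= 1 -> path unit_step p (bdraw_from p d w).
Proof.
elim: w p d => [|x w IH] p d //= hd; rewrite IH ?turn_nrm // andbT /unit_step.
by rewrite ![_ + _ - _]addrC !addKr turn_nrm hd.
Qed.

Lemma cmul_turn x (a d : R * R) : turn_dir x (cmul a d) = cmul a (turn_dir x d).
Proof.
by case: x; rewrite /turn_dir /turn_left /turn_right /cmul //=; apply: pairE; ring.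
Qed.

Lemma cmulDr (a : R * R) u v : cmul a (u + v) = cmul a u + cmul a v.
Proof. by rewrite /cmul /=; apply: pairE => /=; ring. Qed.
Lemma cmulA (a b u : R * R) : cmul a (cmul b u) = cmul (cmul a b) u.
Proof. by rewrite /cmul /=; apply: pairE => /=; ring. Qed.

Lemma draw_similar a b p d w : [seq cmul a z + b | z <- draw_from p d w] =
  draw_from (cmul a p + b) (cmul a d) w.
Proof.
have e u v : cmul a (u + v) + b = cmul a u + b + cmul a v by rewrite cmulDr addrAC.
elim: w p d => [|x w IH] p d //=.
case: x; rewrite /= ?IH ?e //; congr draw_from.
  exact: esym (cmul_turn Rgt a d).
exact: esym (cmul_turn Lft a d).
Qed.

Lemma bdraw_similar a b p d w : [seq cmul a z + b | z <- bdraw_from p d w] =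
  bdraw_from (cmul a p + b) (cmul a d) w.
Proof.
have e u v : cmul a (u + v) + b = cmul a u + b + cmul a v by rewrite cmulDr addrAC.
by elim: w p d => [|x w IH] p d //=; rewrite IH !e -cmul_turn.
Qed.

Definition dvec (d : dir) : R * R := emb R (dx d, dy d).
(* Half a diagonal, pointing from the base of an edge with direction [d] to its left face. *)
Definition diag (d : dir) : R * R := 2^-1 *: (dvec d + dvec (rotl d)).

Lemma emb_tipE x : emb R (tip x) = emb R x.1 + dvec x.2.
Proof. by rewrite /dvec /emb /= !intrD. Qed.
Lemma dvec_rotl (d : dir) : dvec (rotl d) = turn_left (dvec d).
Proof. by case: d => [[] []]; rewrite /dvec /emb /turn_left /dx /dy /= ?oppr0 ?opprK. Qed.
Lemma dvec_rotr (d : dir) : dvec (rotr d) = turn_right (dvec d).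
Proof. by case: d => [[] []]; rewrite /dvec /emb /turn_right /dx /dy /= ?oppr0 ?opprK. Qed.
Lemma nrm_dvec (d : dir) : nrm (dvec d) = 1.
Proof.
rewrite -(sqrtr1 R); congr Num.sqrt.
by case: d => [[] []]; rewrite /dvec /emb /dx /dy /= expr0n /= ?sqrrN ?expr1n ?addr0 ?add0r.
Qed.
Lemma diagE (d : dir) : diag d = cmul (dvec d) (2^-1, 2^-1).
Proof.
rewrite /diag dvec_rotl; case: (dvec d) => a b.
by rewrite /cmul /=; apply: pairE; rewrite /= /GRing.scale /=; ring.
Qed.
Lemma diag_rotr (d : dir) : diag (rotr d) = cmul (dvec d) (2^-1, - 2^-1).
Proof.
rewrite diagE dvec_rotr; case: (dvec d) => a b.
by rewrite /cmul /=; apply: pairE => /=; ring.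
Qed.
Lemma diag_nrm (d : dir) : nrm (diag d) <= 1.
Proof.
rewrite diagE nrm_cmul nrm_dvec mul1r; apply: nrm_le => //=.
by rewrite expr1n; lra.
Qed.

Lemma bdraw_turn x (g : oedge) : let h := pivot true (Some x) g in
  emb R g.1 + diag g.2 + turn_dir x (diag g.2) = emb R h.1 /\
  turn_dir x (diag g.2) = diag (backward h).2.
Proof.
move=> h; rewrite !diagE /h; case: g {h} => [[a b] [[] []]]; case: x; split;
  rewrite /emb /pivot /backward /cmul /dvec /emb /turn_left /turn_right /enext /tip /opp /rotl /dx /dy /= ?intrD;
  apply: pairE => /=; by field.
Qed.

(** The centres visited are the bases of the letters; a corner is half a diagonal away, whence the
    error in the first part. *)
Lemma bdraw_letters g w :
  (forall v, v \in bdraw_from (emb R g.1) (diag g.2) w ->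
     exists l, l \in bword g (bturns w) /\ nrm (v - emb R l.2.1) <= 1) /\
  (forall l, l \in bword g (bturns w) ->
     emb R l.2.1 \in emb R g.1 :: bdraw_from (emb R g.1) (diag g.2) w).
Proof.
elim: w g => [|[b x] w IH] g; first by split.
have [e1 e2] := bdraw_turn x g; rewrite [bturns _]/= -/(bturns w) [bword _ _]/= [bdraw_from _ _ _]/=.
rewrite e1 e2; set h := pivot true (Some x) g; have [/= i1 i2] := IH (backward h); split.
  move=> v; rewrite !inE => /or3P[/eqP->|/eqP->|/i1[l [hl lv]]].
  - exists (true, g); rewrite !inE eqxx; split=> //.
    by rewrite addrC addKr diag_nrm.
  - by exists (false, h); rewrite !inE eqxx orbT subrr nrm0.
  - by exists l; rewrite !inE hl !orbT.
move=> l; rewrite !inE => /or3P[/eqP->|/eqP->|/i2]; rewrite /= ?eqxx ?orbT //.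
by rewrite inE => /orP[]->; rewrite ?orbT.
Qed.
End Polylines.

(** * Normalised curves and their limits *)

Section Curves.
Variables (R : realType) (sigma : symbol -> seq symbol)
  (sigma_folding : folding_rule sigma) (sigma_filling : plane_filling sigma).
Local Notation P := (sub_edge sigma).
Local Notation I n := (iterate P n).
Local Notation c := (base_end sigma).
Local Notation f := (rdil (R := R) c (shift sigma)).
Local Notation lam := (lam R c).
Local Notation tau := (boundary_rule (sigma A)).
Let tP : tiling P := tiling_sub_edge sigma_folding sigma_filling.
Let tI n : tiling (I n) := tiling_iterate n tP.
Let c2 := base_norm sigma_folding sigma_filling.

(* Brings the curves, drawn from 0 with initial direction east, to the place of
   [I n origin]. *)
Definition frame n (z : R * R) : R * R :=
  cmul (dvec R (efirst (I n) origin).2) z + emb R (efirst (I n) origin).1.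

Lemma emb0 : emb R (0, 0) = 0. Proof. by []. Qed.

Lemma cmul0r (a : R * R) : cmul a 0 = 0.
Proof. by rewrite /cmul /= !mulr0 subr0 addr0. Qed.

Lemma frame0 n : frame n 0 = iter n f 0.
Proof.
by rewrite /frame cmul0r add0r (efirst_iterate sigma_folding sigma_filling) emb_iterate emb0.
Qed.

Lemma nrm_frame n u v : nrm (frame n u - frame n v) = nrm (u - v).
Proof.
rewrite -[RHS]mul1r -(nrm_dvec R (efirst (I n) origin).2) -nrm_cmul; congr nrm.
rewrite /frame opprD addrACA subrr addr0 -[in RHS](subrK v u).
by case: u v (dvec _ _) => u1 u2 [v1 v2] [a b]; rewrite /cmul /=; apply: pairE => /=; ring.
Qed.

Lemma east_dvec : east R = dvec R (false, false). Proof. by []. Qed.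

Lemma frame_draw n : [seq frame n z | z <- draw 0 (east R) (subst_iter sigma n A)] =
  emb R (efirst (I n) origin).1 :: [seq emb R (tip x) | x <- I n origin].
Proof.
rewrite /draw map_cons draw_similar /frame cmul0r add0r; congr cons.
set g := efirst (I n) origin.
have -> : cmul (dvec R g.2) (east R) = dvec R g.2.
  by case: (dvec R g.2) => a b; rewrite /cmul /= !mulr1 !mulr0 subr0 add0r.
rewrite (draw_trace (F := emb R) (D := dvec R)); first last.
- exact: dvec_rotr.
- exact: dvec_rotl.
- by move=> p d; exact: emb_tipE.
have [] := @trace_subst _ sigma_folding sigma_filling n A origin isT erefl.
by move=> -> _.
Qed.

Lemma frame_endpoint n :
  frame n (endpoint 0 (east R) (subst_iter sigma n A)) = iter n f (1, 0).
Proof.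
rewrite -[(1, 0)]/(emb R (tip origin)) -emb_iterate.
rewrite -(elast_iterate sigma_folding sigma_filling n) /elast /endpoint.
have := congr1 behead (frame_draw n); set V := draw_from _ _ _ => e.
change (map (frame n) V = [seq emb R (tip x) | x <- I n origin]) in e.
have : last (frame n 0) (map (frame n) V) = frame n (last 0 V) by rewrite last_map.
move=> <-; rewrite e; case: (I n origin) (tiling_neq0 (tI n) origin) => // x X _.
exact: (last_map (fun y => emb R (tip y)) X x).
Qed.

(** An iterate of z |-> c z + t is complex affine, hence determined by its values at 0 and 1. *)
Lemma iter_affine n x : iter n f x - iter n f 0 = cmul (iter n f (1, 0) - iter n f 0) x.
Proof.
elim: n => [|n IH].
  by rewrite /= !subr0 /cmul /= !mul0r !mul1r subr0 addr0; case: x.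
by rewrite !iterS !rdilB IH cmulA.
Qed.

(** Both sides are orientation-preserving similarities that agree at the two ends of the drawn path.
    This carries statements about level n over to the normalised curves. *)
Lemma frame_normalize n z : iter n f (normalize sigma n z) = frame n z.
Proof.
set e := endpoint 0 (east R) (subst_iter sigma n A).
have fe : iter n f (1, 0) - iter n f 0 = cmul (dvec R (efirst (I n) origin).2) e.
  rewrite -frame_endpoint -frame0 -/e /frame cmul0r add0r addrK //.
have e0 : e.1 ^+ 2 + e.2 ^+ 2 != 0.
  have h : nrm e = lam ^+ n.
    rewrite -[LHS]mul1r -(nrm_dvec R (efirst (I n) origin).2) -nrm_cmul -fe nrm_rdil.
    have -> : nrm ((1, 0) - 0 : R * R) = 1 by rewrite subr0 /nrm /= expr0n addr0 expr1n sqrtr1.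
    by rewrite mulr1.
  by rewrite -nrm_sq h expf_neq0 // gt_eqF // lamX_gt0.
have ez : cmul e (normalize sigma n z) = z.
  rewrite /normalize -/e /similarity !subr0; move: e0; case: (e) => a b; case: z => z1 z2 /= h.
  by rewrite /cmul /=; apply: pairE; rewrite /GRing.scale /=; field.
rewrite -[LHS](subrK (iter n f 0)) iter_affine fe -cmulA ez -frame0.
by rewrite /frame cmul0r add0r.
Qed.

Lemma curve_limit (S : nat -> int * int -> Prop) (W : nat -> seq (R * R)) :
  (forall n p, S n p -> exists q, S n.+1 q /\ nrm (emb R q - f (emb R p)) <= spread R sigma) ->
  (forall n q, S n.+1 q -> exists p, S n p /\ nrm (emb R q - f (emb R p)) <= spread R sigma) ->
  (exists p, S 0 p) -> (exists M : R, forall p, S 0 p -> nrm (emb R p) <= M) ->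
  (forall n, path (@unit_step R) 0 (W n)) ->
  (forall n v, v \in map (frame n) (0 :: W n) -> exists2 p, S n p & nrm (v - emb R p) <= 1) ->
  (forall n p, S n p -> (0 < size (W n))%N /\ emb R p \in map (frame n) (0 :: W n)) ->
  hausdorff_limit (fun n => normalize sigma n @` polyline (0 :: W n))
    (limit_set c (shift sigma) S (spread R sigma)).
Proof.
move=> up down ne bd step WS SW.
(* [E] is 1 from a point of the polyline to a vertex of it, plus 1 from there to a point of [S]. *)
apply: (limit_hausdorff c2 (spread_ge0 R sigma) up down ne bd (E := 2)).
  move=> n _ [z /(polyline_near (step n))[v vW zv] <-]; rewrite frame_normalize.
  have [|p hp vp] := WS n (frame n v); first exact: map_f.
  exists p => //; apply: le_trans (nrm_triangle (frame n v) _ _) _.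
  by rewrite nrm_frame -[2]/(1 + 1) lerD.
move=> n p /SW[sz /mapP[v vW e]]; exists (normalize sigma n v); last by rewrite frame_normalize.
by exists v => //; exact: mem_polyline.
Qed.

Lemma sigma_limit : hausdorff_limit (sigma_curve sigma) (@plane_set R sigma).
Proof.
apply: curve_limit.
- exact: (@covered_up R sigma sigma_folding sigma_filling).
- exact: (@covered_down R sigma sigma_folding sigma_filling).
- by exists (0, 0), origin; rewrite // /covers inE eqxx.
- exists (nrm (emb R (0, 0)) + nrm (emb R (tip origin))) => p [x + <-].
  rewrite /covers !inE => /orP[] /eqP e; first by rewrite e lerDl nrm_ge0.
  by rewrite -[x]erevK e lerDr nrm_ge0.
- move=> n; apply: draw_unit.
  by rewrite east_dvec nrm_dvec.
- move=> n v; rewrite -/(draw _ _ _) frame_draw inE => /orP[/eqP->|/mapP[x xI ->]].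
    exists (efirst (I n) origin).1; last by rewrite subrr nrm0.
    by exists (efirst (I n) origin); rewrite // /covers (efirst_in (tI n)).
  exists (tip x); last by rewrite subrr nrm0.
  by exists (erev x); rewrite // covers_rev /covers xI.
- move=> n p hp; rewrite -/(draw _ _ _) frame_draw.
  have := congr1 size (frame_draw n); rewrite /= !size_map => -[->]; have := tiling_neq0 (tI n) origin; have := tiling_path (tI n) origin.
  case: hp => x; rewrite /covers /efirst; case E : (I n origin) => [|y Y] //= hc <- hp _.
  split=> //; case/orP: hc => [xY|xY].
    have := path_vertices hp; move/(_ (index x (y :: Y))); rewrite index_mem => /(_ xY).
    rewrite nth_index // => hx.
    suff : emb R x.1 \in map (emb R) (y.1 :: map tip (y :: Y)) by rewrite map_cons -map_comp.
    rewrite -hx; apply: map_f.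
    by apply: mem_nth; rewrite [size _]/= size_map ltnS; exact: index_size x (y :: Y).
  rewrite in_cons; apply/orP; right.
  have -> : x.1 = tip (erev x) by exact/esym/(congr1 fst (erevK x)).
  exact: (map_f (fun z => emb R (tip z)) xY).
Qed.

(** The word of a turn sequence is reduced, so it is the normal form of the left side, whose letters
    are known. *)
Lemma bword_bordering n g0 h ts : homotopic (bword g0 ts) (lside (I n h)) ->
  (forall l, l \in bword g0 ts -> bordering sigma h n l.2.1) /\
  (forall p, bordering sigma h n p -> exists2 l, l \in bword g0 ts & l.2.1 = p).
Proof.
move=> H; split=> [[b x] hx|p [x hx <-]].
  exists x => //; apply: (boundary_mem (tI n) (b := b)).
  by rewrite -(H [::] isT) act_id // bword_reduced.
by have [b hb] := boundary_exponent (tI n) H hx; exists (b, x).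
Qed.

Lemma tau_limit (h : oedge) (g : nat -> oedge) (d : R * R) (x : bletter) :
  (forall n, (g n).1 = (efirst (I n) origin).1) ->
  (forall n, diag R (g n).2 = cmul (dvec R (efirst (I n) origin).2) d) ->
  (forall n, let w := bword (g n) (bturns (subst_iter tau n x)) in
    (forall l, l \in w -> bordering sigma h n l.2.1) /\
    (forall p, bordering sigma h n p -> exists2 l, l \in w & l.2.1 = p)) ->
  hausdorff_limit (fun n => normalize sigma n @` polyline (bdraw 0 d (subst_iter tau n x)))
    (@border_set R sigma h).
Proof.
move=> g1 gd hW.
have ne : exists p, bordering sigma h 0 p.
  exists h.1, h; rewrite // /iterate /= !inE eqxx eprev_eq.
  by case: (h) => [[a b] [[] []]]; rewrite xpair_eqE andbF.
have e n : [seq frame n z | z <- bdraw 0 d (subst_iter tau n x)] =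
    emb R (g n).1 :: bdraw_from (emb R (g n).1) (diag R (g n).2) (subst_iter tau n x).
  rewrite /bdraw map_cons bdraw_similar gd g1 /frame cmul0r add0r //.
apply: curve_limit.
- exact: (@bordering_up R sigma sigma_folding sigma_filling h).
- exact: (@bordering_down R sigma sigma_folding sigma_filling h).
- exact: ne.
- exists (nrm (emb R h.1) + nrm (emb R (tip h))) => p [y + <-].
  rewrite /iterate /= !inE eprev_eq; case: eqP => [-> _|_ /= /eqP->]; first by rewrite lerDl nrm_ge0.
  by rewrite lerDr nrm_ge0.
- move=> n; apply: bdraw_unit.
  by have := diag_nrm R (g n).2; rewrite gd nrm_cmul nrm_dvec mul1r.
- move=> n v; rewrite -/(bdraw _ _ _) e inE.
  have [bd1 _] := bdraw_letters R (g n) (subst_iter tau n x); have [h1 h2] := hW n.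
  case/orP=> [/eqP->|/bd1[l [/h1 hl vl]]]; last by exists l.2.1.
  (* The border is not empty, so the word has a first letter; its base is the starting point of the
     curve. *)
  have [p /h2[l lw _]] := S_nonempty (@bordering_up R sigma sigma_folding sigma_filling h) ne n.
  exists (g n).1; last by rewrite subrr nrm0.
  by apply: (h1 (true, g n)); case: (bturns _) lw => // t ts _; rewrite inE eqxx.
- move=> n p; have [h1 h2] := hW n => /h2[l lw <-]; rewrite -/(bdraw _ _ _) e.
  have [_ bd2] := bdraw_letters R (g n) (subst_iter tau n x); split; last exact: bd2.
  by case: (subst_iter tau n x) lw.
Qed.

Lemma tau_R_limit : hausdorff_limit (tau_curve_R sigma) (@border_set R sigma origin).
Proof.
apply: (@tau_limit origin (fun n => efirst (I n) origin)) => // n; first exact: diagE.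
exact: bword_bordering (boundary_word_R sigma_folding sigma_filling n).
Qed.

Lemma tau_L_limit : hausdorff_limit (tau_curve_L sigma) (@border_set R sigma (erev origin)).
Proof.
have e n : efirst (I n) (enext (erev origin)) =
    ((efirst (I n) origin).1, rotr (efirst (I n) origin).2).
  by rewrite enext_rev (efirst_rotr (tI n)).
apply: (@tau_limit (erev origin) (fun n => efirst (I n) (enext (erev origin)))) => n.
- by rewrite e.
- by rewrite e diag_rotr.
(* The curve follows the path, while the left side of the reversed path runs against it; the inverse
   word visits the same vertices. *)
move=> w; have h := homotopic_inv (boundary_word_L sigma_folding sigma_filling n).
rewrite winvK -/w in h.
have [wi _] := bword_invert (efirst (I n) (enext (erev origin)))
  (bturns (subst_iter tau n (true, Lft))).
rewrite -/w in wi; rewrite -wi in h; have [h1 h2] := bword_bordering h.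
split=> [l lw|p /h2[l]]; first by apply: (h1 (linv l)); rewrite wi mem_winv linvK.
by rewrite wi mem_winv => lw <-; exists (linv l).
Qed.
End Curves.

Theorem theorem1 (R : realType) (sigma : symbol -> seq symbol)
    (sigma_folding : folding_rule sigma)
    (sigma_filling : plane_filling sigma) :
  exists sigmaA tauR tauL : set (R * R),
    [/\ hausdorff_limit (sigma_curve sigma) sigmaA,
        hausdorff_limit (tau_curve_R sigma) tauR,
        hausdorff_limit (tau_curve_L sigma) tauL
      & boundary sigmaA = tauR `|` tauL].
Proof.
exists (plane_set sigma), (border_set sigma origin), (border_set sigma (erev origin)).
split; [exact: sigma_limit | exact: tau_R_limit | exact: tau_L_limit |].
exact: boundary_plane_set.
Qed.
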